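(* Let $n,m\ge 1$, $A\in\mathbb{R}^{n\times n}$, $B\in\mathbb{R}^{n\times m}$, and assume that $\operatorname{Re}\lambda\le 0$ for every $\lambda\in\sigma(A)$ and that $\operatorname{rank}(B,AB,\ldots,A^{n-1}B)=n$. Suppose that one of the following three conditions holds: (a) for every $x\in\mathbb{R}^n\setminus\{0\}$ there exists $\varepsilon_x\in(0,|x|)$ such that $u_{\varepsilon,x}^*(t)=u_{0,x}^*(t)$ for all $0<t\le T_\varepsilon^*(x)$ and all $0<\varepsilon<\varepsilon_x$; (b) there exist constants $\beta'>0$ and $a'\le0$ such that $BB^\top=\beta' I_n$ and $A+A^\top=2a'I_n$; (c) there exists $\Psi:[0,\infty)\to[0,\infty)$ with $\Psi(0)=0$ such that $V_0(x)=\Psi(|x|)$ for all $x\in\mathbb{R}^n$. Then the following hold, with $\beta=\frac1n\operatorname{tr}(BB^\top)$. (i) $V_0\in C^{0,1}(\mathbb{R}^n)\cap C^\infty(\mathbb{R}^n\setminus\{0\})$ and $$1+\min_{|u|\le1}\langle\nabla V_0(x),Ax+Bu\rangle=0,\qquad x\ne0 .$$ (ii) The problem $(P_{0,x})$ admits the optimal state feedback $$K(x)=-\frac{B^\top x}{\sqrt{\beta}\,|x|},\qquad x\ne0 .$$ (iii) For every $x\ne0$, $K(x)$ is the unique minimizer of the problem $\min_{|v|\le1}\langle\nabla V_0(x),Ax+Bv\rangle$. In particular, for the optimal state $z_{0,x}^*$ of $(P_{0,x})$, $u_{0,x}^*(t)=K(z_{0,x}^*(t))$ for a.e. $t\in(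0,T_0^*(x))$.
   Context: $|\cdot|$ is the Euclidean norm; $C^{0,1}(\mathbb{R}^n)$ denotes the Lipschitz continuous functions. Consider the control system $\dot z(t)=Az(t)+Bu(t)$, $z(0)=x$, with controls in $\mathcal U_{ad}=\{u\in L^\infty(0,\infty;\mathbb{R}^m):\|u\|_{L^\infty(0,\infty;\mathbb{R}^m)}\le 1\}$ (pointwise Euclidean norm at most $1$ a.e.); $z(\cdot;x,u)$ denotes its solution. Let $\overline B_\varepsilon(0)=\{y\in\mathbb{R}^n:|y|\le\varepsilon\}$ for $\varepsilon\ge0$ (so $\overline B_0(0)=\{0\}$). For $x\ne0$ and $0\le\varepsilon<|x|$ the minimum-time problem $(P_{\varepsilon,x})$ has optimal time $$T_\varepsilon^*(x)=\inf\{T>0: z(T;x,u)\in\overline B_\varepsilon(0)\text{ for some }u\in\mathcal U_{ad}\},$$ and $u\in\mathcal U_{ad}$ is optimal for $(P_{\varepsilon,x})$ if $z(T_\varepsilon^*(x);x,u)\in\overline B_\varepsilon(0)$. Under the stated hypotheses on $(A,B)$, it is standard that $T_\varepsilon^*(x)$ is finite and that an optimal control exists and is unique up to a.e. equality on $(0,T_\varepsilon^*(x))$; it has a unique representative on $(0,T_\varepsilon^*(x)]$ that is piecewise continuous and left-continuous with finitely many discontinuities. $u_{\varepsilon,x}^*$ denotes this representative, extended by $0$ to $(T_\varepsilon^*(x),\infty)$, and $z_{\varepsilon,x}^*(t)=z(t;x,u_{\varepsilon,x}^* )$ for $0\le t\le T_\varepsilon^*(x)$ is the optimal state. The point-target minimum-time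 function is $V_0(x)=T_0^*(x)$ for $x\ne0$ and $V_0(0)=0$. A map $K:\mathbb{R}^n\setminus\{0\}\to\mathbb{R}^m$ is an optimal state feedback for $(P_{0,x})$ if the optimal control and optimal state of $(P_{0,x})$ satisfy $u_{0,x}^*(t)=K(z_{0,x}^*(t))$ for a.e. $t\in(0,T_0^*(x))$. *)

(* Defs.v *)
From HB Require Import structures.
From mathcomp Require Import all_boot all_order all_algebra.
From mathcomp Require Import complex.
From mathcomp Require Import all_classical all_reals all_analysis.

Set Implicit Arguments.
Unset Strict Implicit.
Unset Printing Implicit Defensive.

Import Order.TTheory GRing.Theory Num.Theory.
Import numFieldNormedType.Exports.

Local Open Scope classical_set_scope.
Local Open Scope ring_scope.

Section Euclidean.
Context {R : realType}.

Definition dotp {k : nat} (x y : 'cV[R]_k) : R := \sum_i x i 0 * y i 0.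

(* The library norm [`|x|] on matrices is the sup norm (same topology). *)
Definition enorm {k : nat} (x : 'cV[R]_k) : R := Num.sqrt (dotp x x).

End Euclidean.

Section Calculus.
Context {R : realType} {n : nat}.
Implicit Types (f : 'cV[R]_n -> R) (D : set 'cV[R]_n).

Definition partial (i : 'I_n) f : 'cV[R]_n -> R :=
  fun x => 'D_(delta_mx i 0) f x.

Definition grad f (x : 'cV[R]_n) : 'cV[R]_n := \col_i partial i f x.

Definition iter_partial (s : seq 'I_n) f : 'cV[R]_n -> R := foldr partial f s.

(* For open [D]: all partial derivatives of all orders exist and are
   continuous on [D]. *)
Definition smooth_on D f : Prop :=
  forall (s : seq 'I_n) (x : 'cV[R]_n), D x ->
    {for x, continuous (iter_partial s f)} /\
    forall i : 'I_n, derivable (iter_partial s f) x (delta_mx i 0).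

Definition elipschitz f : Prop :=
  exists L : R, forall x y, `|f x - f y| <= L * enorm (x - y).

End Calculus.

Section Minimization.
Context {R : realType} {T : Type}.

Definition is_min (mu : R) (D : set T) (J : T -> R) : Prop :=
  (J @` D) mu /\ lbound (J @` D) mu.

Definition minimizer (D : set T) (J : T -> R) (v : T) : Prop :=
  D v /\ forall w, D w -> J v <= J w.

Definition unique_minimizer (D : set T) (J : T -> R) (v : T) : Prop :=
  minimizer D J v /\ forall w, minimizer D J w -> w = v.

End Minimization.

Section ControlSystem.
Context {R : realType} {n m : nat}.
Variables (A : 'M[R]_n) (B : 'M[R]_(n, m)).

Local Notation mu := (@lebesgue_measure R).

Definition spectrum_nonpos : Prop :=
  forall lam : complex R,
    eigenvalue (map_mx (real_complex R) A) lam -> complex.Re lam <= 0.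

Definition kalman : Prop := \rank (\mxrow_(j < n) (A ^+ j *m B)) = n.

(* Controls and states are functions on the whole of [R]; only the values of a
   control on ]0, +oo[ and those of a state on [0, +oo[ are meaningful. *)
Definition admissible (u : R -> 'cV[R]_m) : Prop :=
  (forall i : 'I_m, measurable_fun (`]0, +oo[ : set R) (fun t : R => u t i 0)) /\
  {ae mu, forall t : R, 0 < t -> enorm (u t) <= 1}.

(* Caratheodory solution, through the equivalent integral equation. *)
Definition is_state (x : 'cV[R]_n) (u : R -> 'cV[R]_m) (z : R -> 'cV[R]_n) :
  Prop :=
  {within `[0, +oo[, continuous z} /\
  forall t : R, 0 <= t -> forall i : 'I_n,
    z t i 0 =
      x i 0 + \int[mu]_(s in `[0, t]) ((A *m z s + B *m u s) i 0).

Definition state (x : 'cV[R]_n) (u : R -> 'cV[R]_m) : R -> 'cV[R]_n :=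
  xget (fun=> 0) [set z | is_state x u z].

Definition reach_times (eps : R) (x : 'cV[R]_n) : set R :=
  [set T | 0 < T /\
    exists u, admissible u /\ enorm (state x u T) <= eps].

(* [inf] is real-valued: it is the true infimum as the set is nonempty under
   the standing assumptions, and bounded below by 0. *)
Definition Topt (eps : R) (x : 'cV[R]_n) : R := inf (reach_times eps x).

Definition optimal (eps : R) (x : 'cV[R]_n) (u : R -> 'cV[R]_m) : Prop :=
  admissible u /\ enorm (state x u (Topt eps x)) <= eps.

Definition pw_left_continuous (T : R) (u : R -> 'cV[R]_m) : Prop :=
  [/\ exists s : seq R, forall t : R, 0 < t < T -> t \notin s ->
        {for t, continuous u},
      forall t : R, 0 < t <= T -> u r @[r --> t^'-] --> u t
    & forall t : R, 0 <= t < T -> cvg (u r @[r --> t^'+])].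

(* These requirements determine [u] completely: left-continuity fixes the
   representative on ]0, Topt], and [u] is 0 elsewhere. *)
Definition is_u_star (eps : R) (x : 'cV[R]_n) (u : R -> 'cV[R]_m) : Prop :=
  [/\ optimal eps x u,
      pw_left_continuous (Topt eps x) u
    & forall t, ~~ (0 < t <= Topt eps x) -> u t = 0].

Definition u_star (eps : R) (x : 'cV[R]_n) : R -> 'cV[R]_m :=
  xget (fun=> 0) [set u | is_u_star eps x u].

Definition z_star (eps : R) (x : 'cV[R]_n) : R -> 'cV[R]_n :=
  state x (u_star eps x).

Definition V0 (x : 'cV[R]_n) : R := if x == 0 then 0 else Topt 0 x.

Definition feedback_along (K : 'cV[R]_n -> 'cV[R]_m) (x : 'cV[R]_n) : Prop :=
  {ae mu, forall t : R, 0 < t < Topt 0 x -> u_star 0 x t = K (z_star 0 x t)}.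

(* The value of [K] at 0 is irrelevant. *)
Definition optimal_feedback (K : 'cV[R]_n -> 'cV[R]_m) : Prop :=
  forall x, x != 0 -> feedback_along K x.

Definition cond_a : Prop :=
  forall x : 'cV[R]_n, x != 0 ->
    exists2 eps_x : R, 0 < eps_x < enorm x &
      forall eps, 0 < eps < eps_x ->
        forall t, 0 < t <= Topt eps x -> u_star eps x t = u_star 0 x t.

Definition cond_b : Prop :=
  exists beta' a' : R,
    [/\ 0 < beta', a' <= 0, B *m B^T = beta'%:M & A + A^T = (2 * a')%:M].

Definition cond_c : Prop :=
  exists Psi : R -> R,
    [/\ forall r, 0 <= r -> 0 <= Psi r,
        Psi 0 = 0
      & forall x : 'cV[R]_n, V0 x = Psi (enorm x)].

Definition hamiltonian (x : 'cV[R]_n) (v : 'cV[R]_m) : R :=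
  dotp (grad V0 x) (A *m x + B *m v).

Definition uball : set 'cV[R]_m := [set v | enorm v <= 1].

Definition beta : R := \tr (B *m B^T) / n%:R.

Definition Kopt (x : 'cV[R]_n) : 'cV[R]_m :=
  - ((Num.sqrt beta * enorm x)^-1 *: (B^T *m x)).

End ControlSystem.

(* Main.v *)
(** Each condition forces the system to be isotropic: [B B^T = b^2 I] and
    [A + A^T = 2 a I], where [a <= 0] because the spectrum lies in the closed
    left half plane.  Then [E(t) = exp(t A)] is [exp(a t)] times an isometry, the
    adjoint can be taken equal to the initial state [x], and the control
    [- B^T x / (b |x|)] drives [|z|] to 0 along [r' = a r - b].  So [V_0] is an
    explicit function of [|x|].

    Optimal trajectories are produced backwards.  A control aligned with the
    observed adjoint, [u(t) = - B^T E(-t)^T p / |B^T E(-t)^T p|], brings its own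
    starting point to 0 in the least time, since [p] separates that point from
    the points that can be brought to 0 earlier.

    In case (c) the support functions
    [p |-> \int_0^T |B^T E(-s)^T p| ds] depend on [|p|] only, hence so does the
    integrand, and evaluating it and its derivative at [s = 0] gives isotropy.

    In case (a) the optimal controls for the point and for a small ball coincide,
    so by the maximum principle for the ball the adjoint of the point problem and
    the one issued from the hitting point on the sphere have parallel outputs.
    That hitting point is itself an integral of the control over the short
    remaining time.  As the radius tends to 0 this yields in turn the injectivity
    of [B^T], that [B B^T] is scalar, and, comparing along the remaining arc,
    that [A + A^T] is scalar. *)

Require Import Defs.
From HB Require Import structures.
From mathcomp Require Import all_boot all_order all_algebra.
From mathcomp Require Import complex ring lra.
From mathcomp Require Import all_classical all_reals all_analysis.
From mathcomp Require Import measurable_realfun.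

Set Implicit Arguments.
Unset Strict Implicit.
Unset Printing Implicit Defensive.

Import Order.TTheory GRing.Theory Num.Theory.
Import numFieldNormedType.Exports.

Local Open Scope classical_set_scope.
Local Open Scope ring_scope.

(** * Integrals of locally bounded measurable functions *)

Section Integral.
Context {R : realType}.
Implicit Types (f g p : R -> R) (a b c t : R).

(** [Topt] is an infimum and [u_star], [state] are choices with default values, so each says
    something only once a witness is exhibited. This dictates the backward construction: [p], [T]
    and an explicit [u] are fixed first and the starting point is [- drift u T]. Condition (a) can
    then be exploited on arcs made by hand, whose optimal control is known almost everywhere from
    the equality case of Cauchy-Schwarz under the integral. A witness for [u_star] must also be
    piecewise left-continuous. Hence arcs are built from an output of the form scalar times nowhere
    vanishing direction, with at most one sign change of the scalar. The first arc used under (a)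
    really changes sign: as long as [B^T] may have a kernel, the contradiction has to come from an
    output that passes through 0. The hitting point on a small sphere tends to 0 with the radius, so
    it carries information only after division by the remaining time [T - S]; the quotient tends to
    [B] applied to the unit output at [T]. Vector identities are tested against an arbitrary [p],
    which turns them into scalar integrals of [dotp (obs (- s) p) (u s)]. *)

Lemma ae_imp (P Q : R -> Prop) : (forall s, P s -> Q s) ->
  {ae (@lebesgue_measure R), forall s, P s} ->
  {ae (@lebesgue_measure R), forall s, Q s}.
Proof.
by move=> PQ /(@filterS _ _ (ae_filter_ringOfSetsType _)); apply; exact: PQ.
Qed.

Lemma ae_imp2 (P Q S : R -> Prop) : (forall s, P s -> Q s -> S s) ->
  {ae (@lebesgue_measure R), forall s, P s} ->
  {ae (@lebesgue_measure R), forall s, Q s} ->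
  {ae (@lebesgue_measure R), forall s, S s}.
Proof.
by move=> PQ; exact: (@filterS2 _ _ (ae_filter_ringOfSetsType _)).
Qed.

(** Stable under sums and products and integrable on every compact interval, so that linearity of
    integrals has no side condition tied to the interval. *)
Definition locbm f := measurable_fun setT f /\
  forall T, exists C, forall s, `|s| <= T -> `|f s| <= C.

(** Not an oriented integral: it is 0 when [b < a], so additivity asks for ordered endpoints. *)
Definition intg f a b : R := \int[@lebesgue_measure R]_(s in `[a, b]) f s.

Lemma locbm_bound f a b : locbm f ->
  exists2 C, 0 <= C & forall s, a <= s <= b -> `|f s| <= C.
Proof.
move=> [_ /(_ (`|a| + `|b|))[C fC]]; exists `|C| => // s /andP[as_ sb].
apply: (le_trans _ (ler_norm C)); apply: fC; rewrite ler_norml.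
have := ler_norm b; have := ler_norm (- a); rewrite normrN.
have := normr_ge0 a; have := normr_ge0 b => *; apply/andP; split; lra.
Qed.

Lemma locbm_integrable f a b : locbm f ->
  (@lebesgue_measure R).-integrable `[a, b] (EFin \o f).
Proof.
move=> lf; have [C C0 fC] := locbm_bound a b lf.
case: lf => mf _; apply: measurable_bounded_integrable => //=.
- by rewrite lebesgue_measure_itv /=; case: ifPn => // _; rewrite -EFinD ltry.
- exact: measurable_funTS.
- exists C; split; first exact: num_real.
  move=> x Cx s /=; rewrite in_itv /= => /fC fs.
  exact: le_trans fs (ltW Cx).
Qed.

Lemma continuous_locbm f : continuous f -> locbm f.
Proof.
move=> cf; split; first exact: continuous_measurable_fun.
move=> T; have [T0|T0] := leP 0 T; last first.
  by exists 0 => s sT; have := le_lt_trans sT T0; rewrite ltNge normr_ge0.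
have cn : {within `[- T, T], continuous (fun x => `|f x|)}.
  apply: continuous_subspaceT => x.
  exact: (continuous_comp (cf x) (@norm_continuous _ _ _)).
have [|c _ cmax] := EVT_max _ cn; first by lra.
by exists `|f c| => s; rewrite ler_norml => sT; apply: cmax; rewrite in_itv.
Qed.

Lemma locbm_cst c : locbm (fun=> c).
Proof. by apply: continuous_locbm => x; exact: cvg_cst. Qed.

Lemma locbmD f g : locbm f -> locbm g -> locbm (fun s => f s + g s).
Proof.
move=> [mf bf] [mg bg]; split; first exact: measurable_funD.
move=> T; have [C fC] := bf T; have [C' gC] := bg T; exists (C + C') => s sT.
by rewrite (le_trans (ler_normD _ _))// lerD ?fC ?gC.
Qed.

Lemma locbmM f g : locbm f -> locbm g -> locbm (fun s => f s * g s).
Proof.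
move=> [mf bf] [mg bg]; split; first exact: measurable_funM.
move=> T; have [C fC] := bf T; have [C' gC] := bg T; exists (C * C') => s sT.
by rewrite normrM ler_pM ?fC ?gC.
Qed.

Lemma locbmZ c f : locbm f -> locbm (fun s => c * f s).
Proof. by move=> lf; apply: locbmM => //; exact: locbm_cst. Qed.

Lemma locbmN f : locbm f -> locbm (fun s => - f s).
Proof.
by move=> /(locbmZ (-1)); congr locbm; apply/funext => s; rewrite mulN1r.
Qed.

Lemma locbmB f g : locbm f -> locbm g -> locbm (fun s => f s - g s).
Proof. by move=> lf /locbmN; exact: locbmD. Qed.

Lemma locbm_sum (I : Type) (r : seq I) (F : I -> R -> R) :
  (forall i, locbm (F i)) -> locbm (fun s => \sum_(i <- r) F i s).
Proof.
move=> lF; elim: r => [|i r IH].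
  rewrite (_ : (fun s => _) = fun=> 0); first exact: locbm_cst.
  by apply/funext => s; rewrite big_nil.
rewrite (_ : (fun s => _) = fun s => F i s + \sum_(j <- r) F j s).
  exact: locbmD.
by apply/funext => s; rewrite big_cons.
Qed.

Lemma eq_intg f g a b : (forall s, a <= s <= b -> f s = g s) ->
  intg f a b = intg g a b.
Proof.
by move=> fg; apply: eq_Rintegral => s; rewrite inE /= in_itv /= => /fg.
Qed.

Lemma intgD f g a b : locbm f -> locbm g ->
  intg (fun s => f s + g s) a b = intg f a b + intg g a b.
Proof. by move=> lf lg; apply: RintegralD => //; exact: locbm_integrable. Qed.

Lemma intgB f g a b : locbm f -> locbm g ->
  intg (fun s => f s - g s) a b = intg f a b - intg g a b.
Proof. by move=> lf lg; apply: RintegralB => //; exact: locbm_integrable. Qed.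

Lemma intgZ c f a b : locbm f -> intg (fun s => c * f s) a b = c * intg f a b.
Proof. by move=> lf; apply: RintegralZl => //; exact: locbm_integrable. Qed.

Lemma intgN f a b : locbm f -> intg (fun s => - f s) a b = - intg f a b.
Proof.
move=> lf; rewrite -[RHS]mulN1r -intgZ //.
by apply: eq_intg => s _; rewrite mulN1r.
Qed.

Lemma intg0 a b : intg (fun=> 0) a b = 0.
Proof. by rewrite /intg Rintegral_cst // mul0r. Qed.

Lemma intg_cst c a b : a <= b -> intg (fun=> c) a b = c * (b - a).
Proof.
move=> ab; rewrite /intg Rintegral_cst //= lebesgue_measure_itv /= lte_fin.
move: ab; rewrite le_eqVlt => /predU1P[->|->]; last by rewrite -EFinB.
by rewrite ltxx subrr.
Qed.

Lemma intg_sum (I : Type) (r : seq I) (F : I -> R -> R) a b :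
  (forall i, locbm (F i)) ->
  intg (fun s => \sum_(i <- r) F i s) a b = \sum_(i <- r) intg (F i) a b.
Proof.
move=> lF; elim: r => [|i r IH].
  rewrite big_nil -[RHS](intg0 a b).
  by apply: eq_intg => s _; rewrite big_nil.
rewrite big_cons -IH -intgD //; last exact: locbm_sum.
by apply: eq_intg => s _; rewrite big_cons.
Qed.

Lemma le_intg f g a b : locbm f -> locbm g ->
  (forall s, a <= s <= b -> f s <= g s) -> intg f a b <= intg g a b.
Proof.
move=> lf lg fg; apply: le_Rintegral; [by []|exact: locbm_integrable|exact: locbm_integrable|].
by move=> s; rewrite /= in_itv /=; exact: fg.
Qed.

Lemma intg_ge0 f a b : (forall s, a <= s <= b -> 0 <= f s) -> 0 <= intg f a b.
Proof.
by move=> f0; apply: Rintegral_ge0 => s /=; rewrite in_itv /= => /f0.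
Qed.

Lemma intg_bound f a b C : a <= b -> locbm f ->
  (forall s, a <= s <= b -> `|f s| <= C) -> `|intg f a b| <= C * (b - a).
Proof.
move=> ab lf fC; rewrite -intg_cst // ler_norml -intgN; last exact: locbm_cst.
apply/andP; split; apply: le_intg => //; try exact: locbm_cst;
  by move=> s /fC; rewrite ler_norml => /andP[].
Qed.

Lemma intg_cat f a b c : locbm f -> a <= b -> b <= c ->
  intg f a b + intg f b c = intg f a c.
Proof.
move=> lf ab bc; have := locbm_integrable a c lf.
move=> /(@Rintegral_itvB _ f (BLeft a) (BRight c) b).
rewrite !bnd_simp => /(_ ab bc) eqI.
rewrite /intg -[X in _ + X](@Rintegral_itv_obnd_cbnd _ b (BRight c)).
  by rewrite -eqI addrC subrK.
apply: integrableS (locbm_integrable b c lf) => //.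
by apply: subset_itvr; rewrite bnd_simp.
Qed.

Lemma intg_point f a : intg f a a = 0.
Proof. by rewrite /intg set_itv1 Rintegral_set1. Qed.

(** Measurability is local because the integrand of [is_state] contains an admissible control, known
    to be measurable on the positive half line only. *)
Lemma intg_ae f g a b :
  measurable_fun (`[a, b] : set R) f -> measurable_fun (`[a, b] : set R) g ->
  {ae (@lebesgue_measure R), forall s, a <= s <= b -> f s = g s} ->
  intg f a b = intg g a b.
Proof.
move=> mf mg fg; rewrite /intg /Rintegral; congr fine.
apply: ae_eq_integral => //; [exact/measurable_EFinP|exact/measurable_EFinP|].
apply: ae_imp fg => s fg.
by rewrite /= in_itv /= => sab; rewrite fg.
Qed.

Lemma intg_eq0_ae f a b : locbm f -> (forall s, a <= s <= b -> 0 <= f s) ->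
  intg f a b = 0 ->
  {ae (@lebesgue_measure R), forall s, a <= s <= b -> f s = 0}.
Proof.
move=> lf f0 if0; have mf : measurable_fun (`[a, b] : set R) (fun s => (f s)%:E).
  by apply/measurable_EFinP; case: lf => mf _; exact: measurable_funTS.
have : (\int[@lebesgue_measure R]_(x in `[a, b]) `|(EFin \o f) x| = 0)%E.
  have -> : (\int[@lebesgue_measure R]_(x in `[a, b]) `|(EFin \o f) x| =
      \int[@lebesgue_measure R]_(x in `[a, b]) (f x)%:E)%E.
    apply: eq_integral => s; rewrite inE /= in_itv /= => /f0 fs.
    by rewrite ger0_norm.
  rewrite -[LHS]fineK; first by congr EFin.
  by apply: integrable_fin_num => //; exact: locbm_integrable.
move=> /(proj1 (ae_eq_integral_abs (@lebesgue_measure R) (measurable_itv _) mf)).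
apply: ae_imp => s; rewrite /= in_itv /= => fs sab.
by have [] := fs sab.
Qed.

(* The increments of [D] over a partition of mesh [(b - a) / N] sum up to at
   most [C * (b - a) ^+ 2 / N]. *)
Lemma quadratic_increments_cst (D : R -> R) a b C : a <= b ->
  (forall s t, a <= s -> s <= t -> t <= b -> `|D t - D s| <= C * (t - s) ^+ 2) ->
  D a = D b.
Proof.
move=> ab DC; apply/eqP; rewrite eq_sym -subr_eq0 -normr_le0; apply/ler_addgt0Pr => e e0.
rewrite add0r.
have [N Ngt] : exists N : nat, `|C| * (b - a) ^+ 2 / e < N.+1%:R.
  exists (Num.truncn (`|C| * (b - a) ^+ 2 / e)).
  by rewrite truncnS_gt.
have N0 : 0 < N.+1%:R :> R by rewrite ltr0n.
pose h := (b - a) / N.+1%:R.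
have h0 : 0 <= h by rewrite divr_ge0 // subr_ge0.
pose x (i : nat) := a + i%:R * h.
have xN : x N.+1 = b by rewrite /x /h mulrC divfK ?gt_eqF // addrC subrK.
have x0 : x 0%N = a by rewrite /x mul0r addr0.
rewrite -{1}xN -{1}x0 -(telescope_sumr (D \o x)) //.
apply: le_trans (ler_norm_sum _ _ _) _.
apply: (@le_trans _ _ (\sum_(0 <= i < N.+1) C * h ^+ 2)).
  rewrite big_nat_cond [leRHS]big_nat_cond; apply: ler_sum => i /andP[/andP[_ iN] _].
  have xx : x i.+1 - x i = h by rewrite /x -natr1; ring.
  rewrite -xx; apply: DC.
  - by rewrite /x lerDl mulr_ge0.
  - by rewrite -subr_ge0 xx.
  - by rewrite -xN /x lerD2l ler_wpM2r // ler_nat.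
rewrite sumr_const_nat subn0 -mulr_natr /h expr_div_n.
have -> : C * ((b - a) ^+ 2 / N.+1%:R ^+ 2) * N.+1%:R = C * (b - a) ^+ 2 / N.+1%:R.
  by field; rewrite ?gt_eqF //= ?pnatr_eq0; lra.
rewrite ler_pdivrMr //; move: Ngt; rewrite ltr_pdivrMr // => /ltW.
rewrite [leRHS]mulrC; apply: le_trans.
by rewrite ler_wpM2r ?sqr_ge0 // ler_norm.
Qed.

Lemma continuous_derive_intg p p' a b : a <= b ->
  (forall s, is_derive s (1 : R) p (p' s)) -> continuous p' ->
  intg p' a b = p b - p a.
Proof.
rewrite le_eqVlt => /predU1P[->|ab] dp cp'; first by rewrite intg_point subrr.
have cp : continuous p.
  move=> s; apply: differentiable_continuous; apply/derivable1_diffP.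
  exact: (@ex_derive _ _ _ _ _ _ _ (dp s)).
rewrite /intg /Rintegral (@continuous_FTC2 _ _ p) //.
- exact: continuous_subspaceT.
- split.
  + by move=> s _; exact: (@ex_derive _ _ _ _ _ _ _ (dp s)).
  + exact: cvg_at_right_filter (cp a).
  + exact: cvg_at_left_filter (cp b).
- by move=> s _; rewrite derive1E; exact: (@derive_val _ _ _ _ _ _ _ (dp s)).
Qed.

Lemma intg_increment f a b T C : locbm f -> 0 <= a -> a <= b -> b <= T ->
  (forall s, 0 <= s <= T -> `|f s| <= C) ->
  `|intg f 0 b - intg f 0 a| <= C * (b - a).
Proof.
move=> lf a0 ab bT fC; rewrite -(intg_cat lf a0 ab) addrC addKr.
apply: intg_bound => // s /andP[as_ sb]; apply: fC.
by rewrite (le_trans a0 as_) (le_trans sb bT).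
Qed.

Lemma intg_lt0 f a b : b < a -> intg f a b = 0.
Proof.
move=> ba; rewrite /intg set_itv_ge ?Rintegral_set0 //.
by rewrite bnd_simp -ltNge.
Qed.

Lemma continuous_intg f : locbm f -> continuous (intg f 0).
Proof.
move=> lf t; pose T := `|t| + 1; have [C C0 fC] := locbm_bound 0 T lf.
have C1 : 0 < C + 1 by lra.
have tT : t <= T by rewrite /T; have := ler_norm t; lra.
(* Negative endpoints are included: there [intg f 0] is 0, and the two regimes are joined at 0. *)
have lip a b : 0 <= T -> a <= b -> b <= T -> `|intg f 0 b - intg f 0 a| <= C * (b - a).
  move=> T0 ab bT; have [b0|b0] := ltP b 0.
    by rewrite !intg_lt0 ?subrr ?normr0 ?mulr_ge0 ?subr_ge0 // (le_lt_trans ab).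
  have [a0|a0] := ltP a 0; last exact: (@intg_increment _ _ _ T).
  rewrite (intg_lt0 _ a0) -[X in _ - X](intg_point f 0).
  apply: le_trans (intg_increment (C := C) lf (lexx 0) b0 bT fC) _.
  by rewrite ler_wpM2l // lerD2l lerN2 ltW.
have T0 : 0 <= T by rewrite /T; have := normr_ge0 t; lra.
apply/(@cvgrPdist_lt _ R^o) => e e0; near=> s.
have sT : s <= T.
  near: s; apply: lt_le_nbhsl; rewrite /T; have := ler_norm t; lra.
have se : `|t - s| < e / (C + 1).
  near: s; apply: (@cvgr_dist_lt _ R^o) => //; exact: divr_gt0.
rewrite (@le_lt_trans _ _ (C * `|t - s|)) //.
  have [ts|st] := leP t s.
    by rewrite distrC (distrC t) (ger0_norm (_ : 0 <= s - t)) ?subr_ge0 ?lip.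
  by rewrite (ger0_norm (_ : 0 <= t - s)) ?subr_ge0 ?lip // ltW.
rewrite (@le_lt_trans _ _ ((C + 1) * `|t - s|)) //.
  by rewrite ler_wpM2r //; lra.
by rewrite mulrC -ltr_pdivlMr.
Unshelve. all: by end_near. Qed.

(** As [f] is merely measurable, its primitive need not be differentiable and the product rule is
    out of reach. Instead the defect [D] of the formula has increments of second order in the step,
    hence is constant. *)
Lemma intg_by_parts f p p' t : locbm f ->
  (forall s, is_derive s (1 : R) p (p' s)) -> continuous p' -> 0 <= t ->
  p t * intg f 0 t =
  intg (fun s => p s * f s) 0 t + intg (fun s => p' s * intg f 0 s) 0 t.
Proof.
move=> lf dp cp' t0.
have cp : continuous p.
  move=> s; apply: differentiable_continuous; apply/derivable1_diffP.
  exact: (@ex_derive _ _ _ _ _ _ _ (dp s)).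
have lp := continuous_locbm cp; have lp' := continuous_locbm cp'.
have lF := continuous_locbm (continuous_intg lf).
have lpf := locbmM lp lf; have lp'F := locbmM lp' lF.
have [C C0 fC] := locbm_bound 0 t lf; have [K K0 pK] := locbm_bound 0 t lp'.
pose D s := p s * intg f 0 s - intg (fun s => p s * f s) 0 s -
  intg (fun s => p' s * intg f 0 s) 0 s.
suff: D 0 = D t.
  rewrite /D !intg_point mulr0 !subr0 => /esym/eqP.
  by rewrite subr_eq0 subr_eq => /eqP ->; rewrite addrC.
apply: (@quadratic_increments_cst _ _ _ (2 * K * C)) => // a b a0 ab bt.
have Lp s r : 0 <= s -> s <= r -> r <= t -> `|p r - p s| <= K * (r - s).
  move=> s0 sr rt; rewrite -(continuous_derive_intg sr dp cp').
  apply: intg_bound => // x /andP[sx xr]; apply: pK.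
  by rewrite (le_trans s0 sx) (le_trans xr rt).
(* An exact identity whose integrands each contain an increment over [[a, b]]; both integrals are at
   most [K * C * (b - a) ^+ 2] in absolute value. *)
have -> : D b - D a =
    intg (fun s => p' s * (intg f 0 b - intg f 0 s)) a b +
    intg (fun s => (p a - p s) * f s) a b.
  have -> : intg (fun s => p' s * (intg f 0 b - intg f 0 s)) a b =
      (p b - p a) * intg f 0 b - intg (fun s => p' s * intg f 0 s) a b.
    rewrite -(continuous_derive_intg ab dp cp') mulrC -intgZ // -intgB //.
      by apply: eq_intg => s _; ring.
    exact: locbmZ.
  have -> : intg (fun s => (p a - p s) * f s) a b =
      p a * intg f a b - intg (fun s => p s * f s) a b.
    rewrite -intgZ // -intgB //; last exact: locbmZ.
    by apply: eq_intg => s _; ring.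
  rewrite /D -(intg_cat lf a0 ab) -(intg_cat lpf a0 ab) -(intg_cat lp'F a0 ab).
  ring.
rewrite (_ : 2 * K * C * (b - a) ^+ 2 =
  K * (C * (b - a)) * (b - a) + (K * (b - a)) * C * (b - a)); last by ring.
apply: le_trans (ler_normD _ _) (lerD _ _); apply: intg_bound => //.
- by apply: locbmM => //; apply: locbmB => //; exact: locbm_cst.
- move=> s /andP[as_ sb]; rewrite normrM ler_pM //.
    by apply: pK; rewrite (le_trans a0 as_) (le_trans sb bt).
  apply: le_trans (intg_increment lf (le_trans a0 as_) sb bt fC) _.
  by rewrite ler_wpM2l //; lra.
- by apply: locbmM => //; apply: locbmB => //; exact: locbm_cst.
- move=> s /andP[as_ sb]; rewrite normrM ler_pM //.
    rewrite distrC; apply: le_trans (Lp _ _ a0 as_ (le_trans sb bt)) _.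
    by rewrite ler_wpM2l //; lra.
  by apply: fC; rewrite (le_trans a0 as_) (le_trans sb bt).
Qed.

End Integral.

(** * Directional derivatives and continuity of real-valued expressions *)

Section Calculus.
Context {R : realType}.
Implicit Types (f g p : R -> R) (t : R).

Section DirectionalDerivative.
Context {V : normedModType R}.
Implicit Types (h k : V -> R) (x v : V).

Lemma is_derive_cst_fun (c : R) x v : is_derive x v (fun=> c) 0.
Proof. exact: (is_derive_cst c x v). Qed.

Lemma is_derive_add h k dh dk x v : is_derive x v h dh ->
  is_derive x v k dk -> is_derive x v (fun y => h y + k y) (dh + dk).
Proof. by move=> hh hk; exact: is_deriveD. Qed.

Lemma is_derive_mul h k dh dk x v : is_derive x v h dh ->
  is_derive x v k dk ->
  is_derive x v (fun y => h y * k y) (dh * k x + h x * dk).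
Proof.
move=> hh hk; apply: is_derive_eq (is_deriveM hh hk) _.
by rewrite /GRing.scale /= addrC mulrC.
Qed.

Lemma is_derive_bigsum (I : Type) (r : seq I) (F : I -> V -> R) dF x v :
  (forall i, is_derive x v (F i) (dF i)) ->
  is_derive x v (fun s => \sum_(i <- r) F i s) (\sum_(i <- r) dF i).
Proof.
move=> hF; elim: r => [|i r IH].
  rewrite big_nil (_ : (fun s => _) = fun=> 0); first exact: is_derive_cst_fun.
  by apply/funext => s; rewrite big_nil.
rewrite big_cons (_ : (fun s => _) = fun s => F i s + \sum_(j <- r) F j s).
  exact: is_derive_add.
by apply/funext => s; rewrite big_cons.
Qed.

(** Restriction to the line through [x] along [v] lets the one-variable chain rule serve for partial
    derivatives. *)
Lemma is_derive_line h x v dh :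
  is_derive x v h dh <-> is_derive (0 : R) (1 : R) (fun e => h (e *: v + x)) dh.
Proof.
have E : (fun e : R => e^-1 *: ((h \o shift x) (e *: v) - h x)) =
    (fun e : R => e^-1 *: (((fun e => h (e *: v + x)) \o shift 0) (e *: 1) -
      h (0 *: v + x))).
  by apply/funext => e /=; rewrite addr0 scale0r add0r /GRing.scale /= mulr1.
by split=> -[dh1 dh2]; constructor; move: dh1 dh2;
  rewrite /derivable /derive E.
Qed.

Lemma is_derive_comp g dg h dh x v : is_derive (h x) (1 : R) g dg ->
  is_derive x v h dh -> is_derive x v (fun y => g (h y)) (dg * dh).
Proof.
move=> hg /is_derive_line hh; apply/is_derive_line.
apply: (@is_derive1_comp _ g (fun e => h (e *: v + x))) => //.
by rewrite scale0r add0r.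
Qed.

End DirectionalDerivative.

Lemma is_derive_oppc f df t : is_derive (- t) (1 : R) f df ->
  is_derive t (1 : R) (fun s => f (- s)) (- df).
Proof.
move=> hf; have hN : is_derive t (1 : R) (fun s : R => - s) (- 1).
  exact: is_deriveNid.
apply: is_derive_eq (is_derive1_comp hf hN) _.
by rewrite mulrN1.
Qed.

Lemma is_derive_shiftc f df (c : R) t : is_derive (c + t) (1 : R) f df ->
  is_derive t (1 : R) (fun s => f (c + s)) df.
Proof.
move=> hf; have hN : is_derive t (1 : R) (fun s : R => c + s) 1.
  apply: is_derive_eq (is_derive_add (is_derive_cst_fun c t 1) (is_derive_id t 1)) _.
  by rewrite add0r.
apply: is_derive_eq (is_derive1_comp hf hN) _.
by rewrite mulr1.
Qed.

Lemma continuous_derive1 (p p' : R -> R) :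
  (forall s, is_derive s (1 : R) p (p' s)) -> continuous p.
Proof.
move=> dp s; apply: differentiable_continuous; apply/derivable1_diffP.
exact: (@ex_derive _ _ _ _ _ _ _ (dp s)).
Qed.

Section Continuity.
Context {T : topologicalType}.
Implicit Types (h k : T -> R) (x : T).

Lemma continuous_at_add h k x : {for x, continuous h} -> {for x, continuous k} ->
  {for x, continuous (fun y => h y + k y)}.
Proof. by move=> ch ck; exact: (@cvgD _ R^o). Qed.

Lemma continuous_at_mul h k x : {for x, continuous h} -> {for x, continuous k} ->
  {for x, continuous (fun y => h y * k y)}.
Proof. by move=> ch ck; exact: cvgM. Qed.

Lemma continuous_at_cst (c : R) x : {for x, continuous (fun _ : T => c)}.
Proof. exact: cvg_cst. Qed.

Lemma continuous_at_inv h x : h x != 0 -> {for x, continuous h} ->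
  {for x, continuous (fun y => (h y)^-1)}.
Proof. by move=> hx ch; exact: cvgV. Qed.

Lemma continuous_at_sub h k x : {for x, continuous h} -> {for x, continuous k} ->
  {for x, continuous (fun y => h y - k y)}.
Proof. by move=> ch ck; exact: (@cvgB _ R^o). Qed.

Lemma continuous_at_sum (I : Type) (r : seq I) (F : I -> T -> R) x :
  (forall i, {for x, continuous (F i)}) ->
  {for x, continuous (fun y => \sum_(i <- r) F i y)}.
Proof.
move=> hF; elim: r => [|i r IH].
  rewrite (_ : (fun s => _) = fun=> 0); first exact: cvg_cst.
  by apply/funext => s; rewrite big_nil.
rewrite (_ : (fun s => _) = fun s => F i s + \sum_(j <- r) F j s).
  exact: continuous_at_add.
by apply/funext => s; rewrite big_cons.
Qed.

End Continuity.

End Calculus.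

(** * The matrix exponential *)

Section MatrixExponential.
Context {R : realType} {n : nat}.
Implicit Types (A : 'M[R]_n) (s t : R).

(** The sum of all absolute entries is submultiplicative; it makes the exponential series of a real
    number dominate each entry. *)
Lemma normr_expmx_coef A k i j :
  `|(A ^+ k) i j| <= (\sum_i \sum_j `|A i j|) ^+ k.
Proof.
elim: k i j => [|k IH] i j.
  by rewrite expr0 expr0 mxE; case: eqP => _; rewrite ?normr1 ?normr0.
rewrite !exprS -mulmxE mxE (le_trans (ler_norm_sum _ _ _)) //.
apply: (@le_trans _ _ ((\sum_l `|A i l|) * (\sum_i \sum_j `|A i j|) ^+ k)).
  by rewrite mulr_suml; apply: ler_sum => l _; rewrite normrM ler_wpM2l.
rewrite ler_wpM2r //.
  by rewrite exprn_ge0 // sumr_ge0 // => l _; rewrite sumr_ge0.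
rewrite [leRHS](bigD1 i) //= lerDl sumr_ge0 // => l _; exact: sumr_ge0.
Qed.

Definition expmx_coef A i j (k : nat) : R := (A ^+ k) i j / k`!%:R.

(** Entrywise a real power series, so that termwise differentiation of scalar power series
    applies. *)
Definition expmx A t : 'M[R]_n :=
  \matrix_(i, j) limn (pseries (expmx_coef A i j) t).

Lemma cvg_expmx A i j t :
  pseries (expmx_coef A i j) t @ \oo --> expmx A t i j.
Proof.
rewrite mxE.
apply: normed_cvg; set C := \sum_i \sum_j `|A i j|.
apply: (series_le_cvg _ _ _ (is_cvg_series_exp_coeff (C * `|t|))) => k.
- exact: normr_ge0.
- by rewrite /exp_coeff divr_ge0 // exprn_ge0 // mulr_ge0 //
    sumr_ge0 // => l _; rewrite sumr_ge0.
- rewrite /exp_coeff /expmx_coef /=.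
  rewrite !normrM normrX normfV (ger0_norm (ler0n _ _)).
  by rewrite exprMn mulrAC ler_wpM2r ?invr_ge0 // ler_wpM2r ?exprn_ge0 //
    normr_expmx_coef.
Qed.

Lemma expmx_coef_diffs A i j k :
  pseries_diffs (expmx_coef A i j) k = (A ^+ k.+1) i j / k`!%:R.
Proof.
rewrite /pseries_diffs /expmx_coef factS natrM invfM mulrCA [X in _ * X]mulrA.
by rewrite mulfV ?mul1r // pnatr_eq0.
Qed.

Lemma cvg_pseries_sum (I : finType) (c : I -> R) (f : I -> nat -> R) l t :
  (forall i, pseries (f i) t @ \oo --> l i) ->
  pseries (fun k => \sum_i c i * f i k) t @ \oo --> \sum_i c i * l i.
Proof.
move=> cf.
rewrite (_ : pseries _ t = fun N => \sum_i c i * pseries (f i) t N).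
  apply: cvg_big; first exact: add_continuous.
  by move=> i _; apply: cvgMr; exact: cf.
apply/funext => N; rewrite /pseries /series /=.
under eq_bigr do rewrite mulr_suml.
rewrite exchange_big /=; apply: eq_bigr => i _.
by rewrite mulr_sumr; apply: eq_bigr => k _; rewrite mulrA.
Qed.

Lemma cvg_expmxMl A i j t :
  pseries (pseries_diffs (expmx_coef A i j)) t @ \oo --> (A *m expmx A t) i j.
Proof.
rewrite mxE (_ : pseries_diffs _ = fun k => \sum_l A i l * expmx_coef A l j k).
  by apply: cvg_pseries_sum => l; exact: cvg_expmx.
apply/funext => k; rewrite expmx_coef_diffs exprS -mulmxE mxE mulr_suml.
by apply: eq_bigr => l _; rewrite mulrA.
Qed.

Lemma cvg_expmxMr A i j t :
  pseries (pseries_diffs (expmx_coef A i j)) t @ \oo --> (expmx A t *m A) i j.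
Proof.
rewrite mxE; under eq_bigr do rewrite mulrC.
rewrite (_ : pseries_diffs _ = fun k => \sum_l A l j * expmx_coef A i l k).
  by apply: cvg_pseries_sum => l; exact: cvg_expmx.
apply/funext => k; rewrite expmx_coef_diffs exprSr -mulmxE mxE mulr_suml.
by apply: eq_bigr => l _; rewrite mulrA (mulrC (A l j)).
Qed.

(** The differentiated series has both products as limit, according to the side on which one factor
    [A] is taken out of [A ^+ k.+1]. *)
Lemma expmx_comm A t : A *m expmx A t = expmx A t *m A.
Proof.
apply/matrixP => i j.
apply: cvg_unique (@cvg_expmxMl A i j t) (@cvg_expmxMr A i j t).
exact: norm_hausdorff.
Qed.

Lemma is_derive_expmx A i j t :
  is_derive t (1 : R) (fun s => expmx A s i j) ((A *m expmx A t) i j).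
Proof.
rewrite (_ : (fun s => _) = fun s => limn (pseries (expmx_coef A i j) s)).
  rewrite -(cvg_lim (@norm_hausdorff _ _) (@cvg_expmxMl A i j t)).
  apply: (@pseries_snd_diffs _ _ (`|t| + 1)).
  - by apply/cvg_ex; eexists; exact: cvg_expmx.
  - by apply/cvg_ex; eexists; exact: cvg_expmxMl.
  (* Taking one factor [A] out reduces the second differentiated series to the first. *)
  - rewrite (_ : pseries_diffs (pseries_diffs _) =
        fun k => \sum_l A i l * pseries_diffs (expmx_coef A l j) k).
      apply/cvg_ex; eexists; apply: cvg_pseries_sum => l; exact: cvg_expmxMl.
    apply/funext => k; rewrite {1}/pseries_diffs expmx_coef_diffs.
    under eq_bigr do rewrite expmx_coef_diffs mulrA.
    rewrite -mulr_suml factS natrM invfM mulrCA [X in _ * X]mulrA.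
    by rewrite mulfV ?pnatr_eq0 // mul1r [in LHS]exprS -mulmxE mxE.
  - by rewrite [ltRHS]ger0_norm ?addr_ge0 // ltrDl.
by apply/funext => s; rewrite mxE.
Qed.

Lemma continuous_expmx A i j : continuous (fun s => expmx A s i j).
Proof. exact: continuous_derive1 (is_derive_expmx A i j). Qed.

Lemma expmx0 A : expmx A 0 = 1%:M.
Proof.
apply/matrixP => i j; rewrite [LHS]mxE.
apply: lim_near_cst => //; near=> N.
rewrite -[N]prednK; last by near: N.
rewrite /pseries /series /= big_nat_recl //= big1 => [|k _].
  by rewrite addr0 /expmx_coef expr0 fact0 expr0 divr1 mulr1.
by rewrite exprS mul0r mulr0.
Unshelve. all: by end_near. Qed.

(** By commutation the derivative of [E(s + r) E(- r)] in [r] vanishes. Invertibility and the group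
    law both follow, with no product of series. *)
Lemma expmxDK A s t : expmx A (s + t) *m expmx A (- t) = expmx A s.
Proof.
suff h : forall i j, (expmx A (s + t) *m expmx A (- t)) i j = expmx A s i j.
  exact/matrixP.
move=> i j; pose F r := (expmx A (s + r) *m expmx A (- r)) i j.
have F0 : F 0 = expmx A s i j by rewrite /F addr0 oppr0 expmx0 mulmx1.
rewrite -F0; apply: (@is_derive_0_is_cst _ F) => r.
have -> : F = fun r => \sum_k expmx A (s + r) i k * expmx A (- r) k j.
  by apply/funext => x; rewrite /F mxE.
apply: is_derive_eq.
  apply: is_derive_bigsum => k; apply: is_derive_mul.
    exact: is_derive_shiftc (is_derive_expmx _ _ _ _).
  exact: is_derive_oppc (is_derive_expmx _ _ _ _).
apply: (@etrans _ _ ((A *m expmx A (s + r) *m expmx A (- r)) i j -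
    (expmx A (s + r) *m (A *m expmx A (- r))) i j)).
  rewrite [X in _ = X - _]mxE [X in _ = _ - X]mxE -sumrB.
  by apply: eq_bigr => k _; rewrite mulrN.
by rewrite mulmxA expmx_comm subrr.
Qed.

Lemma expmxNK A t : expmx A t *m expmx A (- t) = 1%:M.
Proof. by rewrite -[t in expmx A t]add0r expmxDK expmx0. Qed.

Lemma expmxD A s t : expmx A (s + t) = expmx A s *m expmx A t.
Proof.
rewrite -(expmxDK A s t) -mulmxA.
by have := expmxNK A (- t); rewrite opprK => ->; rewrite mulmx1.
Qed.

End MatrixExponential.

(** * Euclidean geometry of columns and the equality case of Cauchy-Schwarz *)

Section EuclideanTheory.
Context {R : realType}.
Implicit Types (k : nat).

Lemma dotpC k (x y : 'cV[R]_k) : dotp x y = dotp y x.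
Proof. by apply: eq_bigr => i _; rewrite mulrC. Qed.

Lemma dotpDl k (x y z : 'cV[R]_k) : dotp (x + y) z = dotp x z + dotp y z.
Proof. by rewrite -big_split; apply: eq_bigr => i _; rewrite mxE mulrDl. Qed.

Lemma dotpDr k (x y z : 'cV[R]_k) : dotp z (x + y) = dotp z x + dotp z y.
Proof. by rewrite dotpC dotpDl !(dotpC z). Qed.

Lemma dotpZl k a (x y : 'cV[R]_k) : dotp (a *: x) y = a * dotp x y.
Proof. by rewrite mulr_sumr; apply: eq_bigr => i _; rewrite mxE mulrA. Qed.

Lemma dotpZr k a (x y : 'cV[R]_k) : dotp x (a *: y) = a * dotp x y.
Proof. by rewrite dotpC dotpZl dotpC. Qed.

Lemma dotpNl k (x y : 'cV[R]_k) : dotp (- x) y = - dotp x y.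
Proof. by rewrite -scaleN1r dotpZl mulN1r. Qed.

Lemma dotpNr k (x y : 'cV[R]_k) : dotp x (- y) = - dotp x y.
Proof. by rewrite dotpC dotpNl dotpC. Qed.

Lemma dotp0l k (x : 'cV[R]_k) : dotp 0 x = 0.
Proof. by rewrite -(scale0r 0) dotpZl mul0r. Qed.

Lemma dotp0r k (x : 'cV[R]_k) : dotp x 0 = 0.
Proof. by rewrite dotpC dotp0l. Qed.

Lemma dotp_mulmxl k l (M : 'M[R]_(l, k)) (x : 'cV[R]_k) (y : 'cV[R]_l) :
  dotp (M *m x) y = dotp x (M^T *m y).
Proof.
rewrite /dotp; under eq_bigr do rewrite mxE mulr_suml.
rewrite exchange_big; apply: eq_bigr => i _; rewrite mxE mulr_sumr.
by apply: eq_bigr => j _; rewrite mxE mulrCA mulrA.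
Qed.

Lemma dotp_mulmxr k l (M : 'M[R]_(l, k)) (x : 'cV[R]_l) (y : 'cV[R]_k) :
  dotp x (M *m y) = dotp (M^T *m x) y.
Proof. by rewrite dotpC dotp_mulmxl dotpC. Qed.

Lemma dotp_deltal k i (x : 'cV[R]_k) : dotp (delta_mx i 0) x = x i 0.
Proof.
rewrite /dotp (bigD1 i) //= big1 => [|j ji]; first by rewrite mxE !eqxx mul1r addr0.
by rewrite mxE (negbTE ji) mul0r.
Qed.

Lemma dotp_ge0 k (x : 'cV[R]_k) : 0 <= dotp x x.
Proof. by apply: sumr_ge0 => i _; rewrite -expr2 sqr_ge0. Qed.

Lemma dotp_eq0 k (x : 'cV[R]_k) : dotp x x = 0 -> x = 0.
Proof.
move/eqP; rewrite psumr_eq0; last by move=> i _; rewrite -expr2 sqr_ge0.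
move=> /allP h; apply/matrixP => i j; rewrite ord1 !mxE.
by have := h i (mem_index_enum _); rewrite /= mulf_eq0 orbb => /eqP.
Qed.

Lemma dotp_inj k (x y : 'cV[R]_k) : (forall p, dotp p x = dotp p y) -> x = y.
Proof.
move=> h; apply/eqP; rewrite -subr_eq0; apply/eqP/dotp_eq0.
by rewrite dotpDr dotpNr h subrr.
Qed.

Lemma enorm_ge0 k (x : 'cV[R]_k) : 0 <= enorm x.
Proof. exact: sqrtr_ge0. Qed.

Lemma sqr_enorm k (x : 'cV[R]_k) : enorm x ^+ 2 = dotp x x.
Proof. by rewrite sqr_sqrtr // dotp_ge0. Qed.

Lemma enorm0 k : enorm (0 : 'cV[R]_k) = 0.
Proof. by rewrite /enorm dotp0l sqrtr0. Qed.

Lemma enorm_eq0 k (x : 'cV[R]_k) : enorm x = 0 -> x = 0.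
Proof. by move=> x0; apply: dotp_eq0; rewrite -sqr_enorm x0 expr0n. Qed.

Lemma enorm_gt0 k (x : 'cV[R]_k) : x != 0 -> 0 < enorm x.
Proof.
move=> x0; rewrite lt_neqAle enorm_ge0 andbT eq_sym.
by apply: contra x0 => /eqP/enorm_eq0 ->.
Qed.

Lemma enormZ k a (x : 'cV[R]_k) : enorm (a *: x) = `|a| * enorm x.
Proof.
by rewrite /enorm dotpZl dotpZr mulrA -expr2 sqrtrM ?sqr_ge0 // sqrtr_sqr.
Qed.

Lemma enormN k (x : 'cV[R]_k) : enorm (- x) = enorm x.
Proof. by rewrite -scaleN1r enormZ normrN1 mul1r. Qed.

Lemma dotp_le k (x y : 'cV[R]_k) : dotp x y <= enorm x * enorm y.
Proof.
have [->|y0] := eqVneq y 0; first by rewrite dotp0r enorm0 mulr0.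
have [->|x0] := eqVneq x 0; first by rewrite dotp0l enorm0 mul0r.
have yp := enorm_gt0 y0; have xp := enorm_gt0 x0.
(* The squared norm of this vector is [2 |x| |y| (|x| |y| - <x, y>)]. *)
have := dotp_ge0 (enorm y *: x - enorm x *: y).
rewrite dotpDl !dotpDr !dotpNl !dotpNr !dotpZl !dotpZr -!sqr_enorm (dotpC y x).
rewrite (_ : _ + _ = 2 * (enorm x * enorm y) * (enorm x * enorm y - dotp x y)).
  by rewrite pmulr_rge0 ?mulr_gt0 // subr_ge0.
ring.
Qed.

Lemma enormD k (x y : 'cV[R]_k) : enorm (x + y) <= enorm x + enorm y.
Proof.
rewrite -(@ler_pXn2r _ 2) ?nnegrE ?addr_ge0 ?enorm_ge0 // sqr_enorm.
rewrite dotpDl !dotpDr sqrrD !sqr_enorm (dotpC y x).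
have := dotp_le x y; lra.
Qed.

Lemma enormB_dist k (x y : 'cV[R]_k) : `|enorm x - enorm y| <= enorm (x - y).
Proof.
have h (a b : 'cV[R]_k) : enorm a - enorm b <= enorm (a - b).
  by rewrite lerBlDr -[X in enorm X <= _](subrK b) enormD.
by rewrite ler_norml h andbT lerNl opprB -[enorm (x - y)]enormN opprB h.
Qed.

Lemma normr_coord_le k (x : 'cV[R]_k) i : `|x i 0| <= enorm x.
Proof.
rewrite -sqrtr_sqr ler_sqrt ?dotp_ge0 // /dotp (bigD1 i) //= -expr2 lerDl.
by apply: sumr_ge0 => j _; rewrite -expr2 sqr_ge0.
Qed.

(** At 0 the value is 0, since the inverse of 0 is 0; the pairing with [x] and the bound by 1
    therefore hold for every [x]. *)
Definition unitv k (x : 'cV[R]_k) : 'cV[R]_k := (enorm x)^-1 *: x.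

Lemma dotp_unitv k (x : 'cV[R]_k) : dotp x (unitv x) = enorm x.
Proof.
have [->|x0] := eqVneq x 0; first by rewrite dotp0l enorm0.
by rewrite dotpZr -sqr_enorm expr2 mulKf // gt_eqF // enorm_gt0.
Qed.

Lemma enorm_unitv k (x : 'cV[R]_k) : x != 0 -> enorm (unitv x) = 1.
Proof.
move=> x0; rewrite enormZ ger0_norm ?invr_ge0 ?enorm_ge0 // mulVf //.
by rewrite gt_eqF // enorm_gt0.
Qed.

Lemma enorm_unitv_le1 k (x : 'cV[R]_k) : enorm (unitv x) <= 1.
Proof.
have [->|x0] := eqVneq x 0; last by rewrite enorm_unitv.
by rewrite /unitv scaler0 enorm0.
Qed.

Lemma unitvZ k a (x : 'cV[R]_k) : 0 < a -> unitv (a *: x) = unitv x.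
Proof.
move=> a0; rewrite /unitv enormZ gtr0_norm // scalerA invfM mulrAC mulVf ?mul1r //.
by rewrite gt_eqF.
Qed.

Lemma unitvN k (x : 'cV[R]_k) : unitv (- x) = - unitv x.
Proof. by rewrite /unitv enormN scalerN. Qed.

Lemma unitvK k (x : 'cV[R]_k) : enorm x *: unitv x = x.
Proof.
have [->|x0] := eqVneq x 0; first by rewrite /unitv !scaler0.
by rewrite scalerA mulfV ?scale1r // gt_eqF // enorm_gt0.
Qed.

Lemma dotp_le_unit_ball k (w v : 'cV[R]_k) : enorm v <= 1 ->
  0 <= dotp w v + enorm w.
Proof.
move=> v1; have : - dotp w v <= enorm w; last by lra.
rewrite -dotpNr (le_trans (dotp_le _ _)) // enormN.
by rewrite ler_piMr // enorm_ge0.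
Qed.

(* Expanding the square,
   [| |w| v + w |^2 = |w|^2 |v|^2 + 2 |w| <w, v> + |w|^2 <= 0]. *)
Lemma dotp_unit_ball_eq k (w v : 'cV[R]_k) : enorm v <= 1 ->
  dotp w v + enorm w = 0 -> enorm w *: v = - w.
Proof.
move=> v1 wv; apply/eqP; rewrite -addr_eq0; apply/eqP/enorm_eq0.
apply/eqP; rewrite -sqrf_eq0 eq_le sqr_ge0 andbT sqr_enorm.
rewrite dotpDl !dotpDr !dotpZl !dotpZr -!sqr_enorm (dotpC v w).
have -> : dotp w v = - enorm w by apply/eqP; rewrite -addr_eq0 wv.
have -> : enorm w * (enorm w * enorm v ^+ 2) + enorm w * - enorm w +
  (enorm w * - enorm w + enorm w ^+ 2) = enorm w ^+ 2 * (enorm v ^+ 2 - 1) by ring.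
by rewrite mulr_ge0_le0 ?sqr_ge0 // subr_le0 expr_le1 // enorm_ge0.
Qed.

Lemma cvg_mxP {T : Type} (F : set_system T) {FF : Filter F} (k l : nat)
    (f : T -> 'M[R]_(k, l)) (M : 'M[R]_(k, l)) :
  (forall i j, f s i j @[s --> F] --> M i j) -> f s @[s --> F] --> M.
Proof.
move=> fM X [P MP PX] /=.
have : \forall s \near F, forall i j, P i j (f s i j).
  apply: filter_forall => i; apply: filter_forall => j.
  exact: (fM i j).
by apply: filterS => s hs; apply: PX => i j; exact: hs.
Qed.

Lemma continuous_dotp (T : topologicalType) k (f g : T -> 'cV[R]_k) x :
  (forall i, {for x, continuous (fun y => f y i 0)}) ->
  (forall i, {for x, continuous (fun y => g y i 0)}) ->
  {for x, continuous (fun y => dotp (f y) (g y))}.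
Proof.
by move=> cf cg; apply: continuous_at_sum => i; exact: continuous_at_mul.
Qed.

Lemma continuous_enorm (T : topologicalType) k (f : T -> 'cV[R]_k) x :
  (forall i, {for x, continuous (fun y => f y i 0)}) ->
  {for x, continuous (fun y => enorm (f y))}.
Proof.
move=> cf; apply: (@continuous_comp _ _ _ _ Num.sqrt).
  exact: continuous_dotp.
exact: sqrt_continuous.
Qed.

Lemma continuous_mulmx (T : topologicalType) k l r (f : T -> 'M[R]_(k, l))
    (g : T -> 'M[R]_(l, r)) x :
  (forall i j, {for x, continuous (fun y => f y i j)}) ->
  (forall i j, {for x, continuous (fun y => g y i j)}) ->
  forall i j, {for x, continuous (fun y => (f y *m g y) i j)}.
Proof.
move=> cf cg i j.
rewrite (_ : (fun y => _) = fun y => \sum_h f y i h * g y h j).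
  by apply: continuous_at_sum => h; exact: continuous_at_mul.
by apply/funext => y; rewrite mxE.
Qed.

Lemma locbm_dotp k (f g : R -> 'cV[R]_k) :
  (forall i, locbm (fun s => f s i 0)) -> (forall i, locbm (fun s => g s i 0)) ->
  locbm (fun s => dotp (f s) (g s)).
Proof. by move=> lf lg; apply: locbm_sum => i; exact: locbmM. Qed.

Lemma locbm_mulmx k l r (f : R -> 'M[R]_(k, l)) (g : R -> 'M[R]_(l, r)) :
  (forall i j, locbm (fun s => f s i j)) ->
  (forall i j, locbm (fun s => g s i j)) ->
  forall i j, locbm (fun s => (f s *m g s) i j).
Proof.
move=> lf lg i j.
rewrite (_ : (fun y => _) = fun y => \sum_h f y i h * g y h j).
  by apply: locbm_sum => h; exact: locbmM.
by apply/funext => y; rewrite mxE.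
Qed.

End EuclideanTheory.

(** * States of the control system *)

Section States.
Context {R : realType} {n m : nat}.
Variables (A : 'M[R]_n) (B : 'M[R]_(n, m)).
Implicit Types (x p : 'cV[R]_n) (u v : R -> 'cV[R]_m) (z : R -> 'cV[R]_n).

(** Admissible controls without exceptional sets: measurable on all of [R] and bounded everywhere.
    Each admissible control agrees almost everywhere on positive times with a clean one. *)
Definition clean u :=
  (forall i, measurable_fun (setT : set R) (fun t : R => u t i 0)) /\
  forall t, enorm (u t) <= 1.

Lemma clean_locbm u i : clean u -> locbm (fun t => u t i 0).
Proof.
move=> [mu bu]; split; first exact: mu.
by move=> T; exists 1 => s _; apply: le_trans (normr_coord_le _ _) (bu s).
Qed.

Lemma clean_admissible u : clean u -> admissible u.
Proof.
move=> [mu bu]; split; first by move=> i; exact: measurable_funTS.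
by apply: (ae_imp (P := fun _ => True)) => [s _ _|]; [exact: bu|exact: aeW].
Qed.

(** The adjoint equation [q' = - A^T q], [q(0) = p], has solution [E(-t)^T p]; its output through
    [B^T] at time [t] is [obs (- t) p]. *)
Definition obs (s : R) p : 'cV[R]_m := B^T *m ((expmx A s)^T *m p).

Lemma obsE s p : obs s p = B^T *m ((expmx A s)^T *m p).
Proof. by []. Qed.

Lemma obs0 p : obs 0 p = B^T *m p.
Proof. by rewrite /obs expmx0 trmx1 mul1mx. Qed.

Lemma obsN s p : obs s (- p) = - obs s p.
Proof. by rewrite /obs !mulmxN. Qed.

Lemma obsZ c s p : obs s (c *: p) = c *: obs s p.
Proof. by rewrite /obs -!scalemxAr. Qed.

Lemma dotp_obs s p (w : 'cV[R]_m) :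
  dotp (obs s p) w = dotp p (expmx A s *m (B *m w)).
Proof. by rewrite /obs !dotp_mulmxl !trmxK. Qed.

(** The effect of the control pulled back to time 0, so that [resp] is the variation of constants
    formula and [u] brings [x] to 0 at time [t] exactly when [x = - drift u t]. *)
Definition drift u t : 'cV[R]_n :=
  \col_i intg (fun s => (expmx A (- s) *m (B *m u s)) i 0) 0 t.

Definition resp x u t : 'cV[R]_n := expmx A t *m (x + drift u t).

Lemma respE x u t : resp x u t = expmx A t *m (x + drift u t).
Proof. by []. Qed.

Lemma continuous_obs p i : continuous (fun s => obs s p i 0).
Proof.
move=> s; apply: (@continuous_mulmx _ _ _ _ _ (fun=> B^T)
  (fun s => (expmx A s)^T *m p)) => [a b|]; first exact: cvg_cst.
apply: continuous_mulmx => a b; last exact: cvg_cst.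
rewrite (_ : (fun y => _) = (fun y => expmx A y b a)).
  exact: continuous_expmx.
by apply/funext => y; rewrite mxE.
Qed.

Lemma continuous_oppc (f : R -> R) :
  continuous f -> continuous (fun s => f (- s)).
Proof.
move=> cf s; apply: (@continuous_comp _ _ _ (-%R) f); last exact: cf.
exact: (@oppr_continuous _ R^o).
Qed.

Lemma continuous_obs_oppc p i : continuous (fun s => obs (- s) p i 0).
Proof. exact: (continuous_oppc (@continuous_obs p i)). Qed.

Lemma locbm_drift u i : clean u ->
  locbm (fun s => (expmx A (- s) *m (B *m u s)) i 0).
Proof.
move=> cu; apply: locbm_mulmx => a b.
  exact: (continuous_locbm (continuous_oppc (@continuous_expmx _ _ A a b))).
apply: locbm_mulmx => c d; first exact: locbm_cst.
by rewrite (ord1 d); exact: clean_locbm.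
Qed.

Lemma locbm_obs_dotp u p : clean u -> locbm (fun s => dotp (obs (- s) p) (u s)).
Proof.
move=> cu; apply: locbm_dotp => i; last exact: clean_locbm.
exact: (continuous_locbm (continuous_oppc (@continuous_obs p i))).
Qed.

Lemma dotp_drift u p t : clean u ->
  dotp p (drift u t) = intg (fun s => dotp (obs (- s) p) (u s)) 0 t.
Proof.
move=> cu; transitivity
  (intg (fun s => \sum_i p i 0 * (expmx A (- s) *m (B *m u s)) i 0) 0 t).
  rewrite intg_sum; last by move=> i; exact/locbmZ/locbm_drift.
  by apply: eq_bigr => i _; rewrite mxE intgZ //; exact: locbm_drift.
apply: eq_intg => s _; rewrite /obs -/(dotp _ _) mulmxA.
by rewrite dotp_mulmxr trmx_mul -mulmxA.
Qed.

Lemma dotp_resp x u p t : clean u ->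
  dotp p (expmx A (- t) *m resp x u t) =
  dotp p x + intg (fun s => dotp (obs (- s) p) (u s)) 0 t.
Proof.
move=> cu; rewrite /resp mulmxA.
have := expmxNK A (- t); rewrite opprK => ->.
by rewrite mul1mx dotpDr dotp_drift.
Qed.

Lemma continuous_drift u i : clean u -> continuous (fun t => drift u t i 0).
Proof.
move=> cu; rewrite (_ : (fun t => _) = 
  intg (fun s => (expmx A (- s) *m (B *m u s)) i 0) 0).
  exact/continuous_intg/locbm_drift.
by apply/funext => t; rewrite mxE.
Qed.

Lemma continuous_resp x u i : clean u -> continuous (fun t => resp x u t i 0).
Proof.
move=> cu t; apply: continuous_mulmx => a b; first exact: continuous_expmx.
rewrite (ord1 b) (_ : (fun y => _) = (fun y => x a 0 + drift u y a 0)).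
  by apply: continuous_at_add; [exact: cvg_cst|exact: continuous_drift].
by apply/funext => y; rewrite mxE.
Qed.

(** Integration by parts of [E(t)] against [drift u t] replaces differentiation, which a measurable
    control does not allow at every time. *)
Lemma is_state_resp x u : clean u -> is_state A B x u (resp x u).
Proof.
move=> cu; split.
  apply: continuous_subspaceT => t; apply: cvg_mxP => i j.
  by rewrite (ord1 j); exact: continuous_resp.
move=> t t0 i; have lr := locbm_drift _ cu.
rewrite -/(intg _ 0 t).
have E0 j : expmx A t i j * drift u t j 0 =
    intg (fun s => expmx A s i j * (expmx A (- s) *m (B *m u s)) j 0) 0 t +
    intg (fun s => (A *m expmx A s) i j * drift u s j 0) 0 t.
  rewrite [drift u t j 0]mxE.
  have cAE : continuous (fun s => (A *m expmx A s) i j).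
    move=> s; apply: continuous_mulmx => a b; first exact: cvg_cst.
    exact: continuous_expmx.
  apply: etrans (intg_by_parts (lr j) (is_derive_expmx A i j) cAE t0) _.
  congr (_ + _); apply: eq_intg => s _.
  by rewrite [drift u s j 0]mxE.
have lAE j : locbm (fun s => (A *m expmx A s) i j).
  apply: continuous_locbm => s; apply: continuous_mulmx => a b.
    exact: cvg_cst.
  exact: continuous_expmx.
have lE j : locbm (fun s => expmx A s i j).
  exact/continuous_locbm/continuous_expmx.
have ld j : locbm (fun s => drift u s j 0).
  exact/continuous_locbm/continuous_drift.
have Ex : (expmx A t *m x) i 0 = x i 0 + intg (fun s => (A *m expmx A s *m x) i 0) 0 t.
  have Exj j : expmx A t i j * x j 0 = (1%:M : 'M[R]_n) i j * x j 0 +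
      intg (fun s => x j 0 * (A *m expmx A s) i j) 0 t.
    rewrite intgZ // (continuous_derive_intg t0 (is_derive_expmx A i j)).
      by rewrite expmx0; ring.
    move=> s; apply: continuous_mulmx => a b; first exact: cvg_cst.
    exact: continuous_expmx.
  rewrite mxE; under eq_bigr do rewrite Exj.
  rewrite big_split /= -intg_sum; last by move=> j; exact: locbmZ.
  congr (_ + _); first by rewrite -[in RHS](mul1mx x) mxE.
  apply: eq_intg => s _; rewrite mxE; by apply: eq_bigr => j _; rewrite mulrC.
rewrite /resp mulmxDr mxE Ex -addrA; congr (_ + _).
rewrite mxE; under eq_bigr do rewrite E0.
rewrite big_split /= -!intg_sum; last 2 first.
- by move=> j; exact: locbmM.
- by move=> j; exact: locbmM.
have lAEx : locbm (fun s => (A *m expmx A s *m x) i 0).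
  apply: locbm_mulmx => [a b|]; last by move=> a b; exact: locbm_cst.
  apply: locbm_mulmx => c d; first exact: locbm_cst.
  exact/continuous_locbm/continuous_expmx.
rewrite addrCA -!intgD //; first last.
- by apply: locbm_sum => j; exact: locbmM.
- apply: locbmD => //; by apply: locbm_sum => j; exact: locbmM.
- by apply: locbm_sum => j; exact: locbmM.
apply: eq_intg => s _.
have -> : \sum_j expmx A s i j * (expmx A (- s) *m (B *m u s)) j 0 = (B *m u s) i 0.
  have := erefl ((expmx A s *m (expmx A (- s) *m (B *m u s))) i 0).
  by rewrite {1}mulmxA expmxNK mul1mx [in RHS]mxE => ->.
have -> : \sum_i0 (A *m expmx A s) i i0 * drift u s i0 0 = (A *m expmx A s *m drift u s) i 0.
  by rewrite [RHS]mxE.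
by rewrite mulmxA mulmxDr [RHS]mxE [in RHS]mxE addrC.
Qed.

(** A state is continuous only within [[0, +oo[]; freezing it at its value at 0 for negative times
    gives a function to which [locbm] applies. *)
Lemma continuous_clamp z i : {within `[0, +oo[, continuous z} ->
  continuous (fun s : R => z (Num.max 0 s) i 0).
Proof.
move=> cz.
have cmax : continuous (fun s : R => Num.max 0 s).
  by move=> s; apply: continuous_max => //; exact: cvg_cst.
move=> s X zX.
have zP : nbhs (z (Num.max 0 s)) [set M | X (M i 0)] :=
  @coord_continuous R n 1 i 0 (z (Num.max 0 s)) X zX.
have w : nbhs_subspace (A := `[0, +oo[%classic : set R) (Num.max 0 s)
  (z @^-1` [set M | X (M i 0)]) := cz _ _ zP.
rewrite -nbhs_subspace_in /= in w; last by rewrite in_itv /= andbT le_max lexx.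
have := cmax s _ w; apply: (@filterS _ (nbhs s)) => r h.
by apply: h; rewrite /= in_itv /= andbT le_max lexx.
Qed.

Lemma is_state_unique x u z : clean u -> is_state A B x u z ->
  forall t : R, 0 <= t -> z t = resp x u t.
Proof.
move=> cu [cz ez] t t0; have [_ er] := is_state_resp x cu.
(* Extended by its value at [0], the difference [d] is continuous on [R] and
   solves the homogeneous equation. *)
pose d (s : R) : 'cV[R]_n := z (Num.max 0 s) - resp x u (Num.max 0 s).
have cmax : continuous (fun s : R => Num.max 0 s).
  by move=> s; apply: continuous_max => //; exact: cvg_cst.
have zc i : continuous (fun s : R => z (Num.max 0 s) i 0).
  exact: continuous_clamp.
have rc i := @continuous_resp x u i cu.
have dc i : continuous (fun s => d s i 0).
  move=> s; rewrite (_ : (fun s => _) =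
      fun s : R => z (Num.max 0 s) i 0 + - resp x u (Num.max 0 s) i 0).
    apply: (@continuous_at_add R R (fun s => z (Num.max 0 s) i 0)
      (fun s => - resp x u (Num.max 0 s) i 0)); first exact: zc.
    apply: (@continuousN _ R^o).
    exact: (@continuous_comp R R R (Num.max 0) (fun s : R => resp x u s i 0) s
      (cmax s) (rc i _)).
  by apply/funext => y; rewrite !mxE.
have ld i := continuous_locbm (dc i).
have lAd i : locbm (fun s => (A *m d s) i 0).
  apply: locbm_mulmx => a b; first exact: locbm_cst.
  by rewrite (ord1 b); exact: ld.
have lAz i : locbm (fun s => (A *m z (Num.max 0 s) + B *m u s) i 0).
  rewrite (_ : (fun s => _) = fun s => (A *m z (Num.max 0 s)) i 0 + (B *m u s) i 0).
    apply: locbmD; apply: locbm_mulmx => a b; try exact: locbm_cst.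
      by rewrite (ord1 b); exact/continuous_locbm/zc.
    by rewrite (ord1 b); exact: clean_locbm.
  by apply/funext => s; rewrite mxE.
have lAr i : locbm (fun s => (A *m resp x u s + B *m u s) i 0).
  rewrite (_ : (fun s => _) = fun s => (A *m resp x u s) i 0 + (B *m u s) i 0).
    apply: locbmD; apply: locbm_mulmx => a b; try exact: locbm_cst.
      by rewrite (ord1 b); exact/continuous_locbm/rc.
    by rewrite (ord1 b); exact: clean_locbm.
  by apply/funext => s; rewrite mxE.
have dE i s : 0 <= s -> d s i 0 = intg (fun r => (A *m d r) i 0) 0 s.
  move=> s0; rewrite /d (max_idPr s0) mxE mxE ez // er // -!/(intg _ 0 s).
  have -> : intg (fun r => (A *m z r + B *m u r) i 0) 0 s =
      intg (fun r => (A *m z (Num.max 0 r) + B *m u r) i 0) 0 s.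
    by apply: eq_intg => r /andP[r0 _]; rewrite (max_idPr r0).
  rewrite opprD addrACA subrr add0r -intgB //.
  apply: eq_intg => r /andP[r0 _].
  by rewrite (max_idPr r0) mulmxBr !mxE; ring.
have lF i : locbm (intg (fun r => (A *m d r) i 0) 0).
  exact/continuous_locbm/continuous_intg.
have dN i j s : is_derive s (1 : R) (fun s : R => expmx A (- s) i j)
    (- (expmx A (- s) *m A) i j).
  rewrite -expmx_comm; exact: is_derive_oppc (is_derive_expmx _ _ _ _).
have cN i j : continuous (fun s : R => expmx A (- s) i j).
  exact: continuous_derive1 (dN i j).
have cNA i j : continuous (fun s : R => (expmx A (- s) *m A) i j).
  move=> s; apply: (@continuous_mulmx _ _ _ _ _ (fun s : R => expmx A (- s))
    (fun=> A)) => a b; [exact: cN|exact: cvg_cst].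
(* Integrating factor: by parts, [E(-t) d(t)] is the integral of [E(-s) A d(s) - E(-s) A d(s)]. *)
have E0 : expmx A (- t) *m d t = 0.
  apply/matrixP => i j; rewrite (ord1 j) [LHS]mxE [RHS]mxE.
  under eq_bigr => k _.
    rewrite dE // (intg_by_parts (lAd k) (dN i k)) //; last first.
      by move=> s; apply: (@continuousN _ R^o); exact: cNA.
    over.
  rewrite big_split /= -!intg_sum; last 2 first.
  - by move=> k; apply: locbmM => //; exact/locbmN/continuous_locbm.
  - by move=> k; apply: locbmM => //; exact/continuous_locbm.
  rewrite -intgD; last 2 first.
  - by apply: locbm_sum => k; apply: locbmM => //; exact/continuous_locbm.
  - by apply: locbm_sum => k; apply: locbmM => //; exact/locbmN/continuous_locbm.
  rewrite -[RHS](intg0 0 t); apply: eq_intg => s /andP[s0 _].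
  transitivity ((expmx A (- s) *m (A *m d s)) i 0 - (expmx A (- s) *m A *m d s) i 0).
    rewrite [X in _ = X - _]mxE [X in _ = _ - X]mxE -sumrN; congr (_ + _).
    by apply: eq_bigr => k _; rewrite -dE // mulNr.
  by rewrite mulmxA subrr.
have /eqP : d t = 0.
  have := congr1 (mulmx (expmx A t)) E0.
  by rewrite mulmxA expmxNK mul1mx mulmx0.
by rewrite /d (max_idPr t0) subr_eq0 => /eqP.
Qed.

Lemma stateE x u t : clean u -> 0 <= t -> state A B x u t = resp x u t.
Proof.
move=> cu t0; rewrite /state; case: xgetP => [z -> /= hz|h].
  exact: is_state_unique.
by case: (h _ (is_state_resp x cu)).
Qed.

Lemma admissible_clean u : admissible u ->
  exists2 v, clean v &
    {ae (@lebesgue_measure R), forall t, 0 < t -> u t = v t}.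
Proof.
move=> [mu bu].
(* Zero replaces [u] on the null set of positive times where the bound fails, and on nonpositive
   times, where [u] is unconstrained. *)
pose v (t : R) : 'cV[R]_m := if (0 < t) && (enorm (u t) <= 1) then u t else 0.
exists v; last by apply: ae_imp bu => t ut t0; rewrite /v t0 ut.
split; last by move=> t; rewrite /v; case: ifPn => [/andP[]//|_]; rewrite enorm0.
move=> i; rewrite (_ : (fun t => _) =
    fun t : R => if 0 < t then (if enorm (u t) <= 1 then u t i 0 else 0) else 0); last first.
  by apply/funext => t; rewrite /v; case: (0 < t) => //=; [case: ifPn|]; rewrite ?mxE.
have mO : measurable_fun (`]0, +oo[ : set R) (fun t => enorm (u t)).
  apply: (@measurableT_comp _ _ _ _ _ _ (Num.sqrt : R -> R)).
    exact: continuous_measurable_fun (@sqrt_continuous _).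
  by apply: measurable_sum => j; exact: measurable_funM.
have seti : setT `&` ((fun t : R => 0 < t) @^-1` [set true]) = `]0, +oo[%classic.
  by apply/seteqP; split => t /=; rewrite in_itv /= andbT; [case|].
apply: measurable_fun_if => //.
- exact: measurable_fun_ltr.
- rewrite seti; apply: measurable_fun_if => //.
  + exact: measurable_fun_ler.
  + apply: measurable_funS (mu i) => //; exact: subIsetl.
Qed.

Lemma ae_neq (c : R) : {ae (@lebesgue_measure R), forall s : R, s != c}.
Proof.
exists [set c]; split => //; first exact: lebesgue_measure_set1.
by move=> s /= /negP; rewrite negbK => /eqP.
Qed.

Lemma measurable_fun_itvcc (f : R -> R) t :
  measurable_fun (`]0, +oo[ : set R) f -> measurable_fun (`[0, t] : set R) f.
Proof.
move=> mf; apply: (@measurable_funS _ _ _ _ (`[0, +oo[ : set R)) => //.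
  by move=> s /=; rewrite !in_itv /= andbT => /andP[].
rewrite -(@setU1itv _ _ _ _ false); last by rewrite bnd_simp.
by apply/measurable_funU => //; split => //; exact: measurable_fun_set1.
Qed.

Lemma measurable_field u z i t :
  (forall j, measurable_fun (`]0, +oo[ : set R) (fun s : R => u s j 0)) ->
  {within `[0, +oo[, continuous z} ->
  measurable_fun (`[0, t] : set R) (fun s : R => (A *m z s + B *m u s) i 0).
Proof.
move=> mu cz.
apply: (eq_measurable_fun (fun s : R =>
    \sum_j A i j * z (Num.max 0 s) j 0 + \sum_j B i j * u s j 0)).
  move=> s; rewrite inE /= in_itv /= => /andP[s0 _].
  by rewrite (max_idPr s0) !mxE.
apply: measurable_funD; apply: measurable_sum => j.
  apply: measurable_funM => //; apply: measurable_funTS.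
  by apply: continuous_measurable_fun; exact: continuous_clamp.
by apply: measurable_funM => //; exact: measurable_fun_itvcc.
Qed.

Lemma is_state_ae x u v : admissible u -> admissible v ->
  {ae (@lebesgue_measure R), forall t, 0 < t -> u t = v t} ->
  is_state A B x u = is_state A B x v.
Proof.
move=> [mu _] [mv _] uv; apply/funext => z; apply/propext.
suff h t i : {within `[0, +oo[, continuous z} ->
    intg (fun s => (A *m z s + B *m u s) i 0) 0 t =
    intg (fun s => (A *m z s + B *m v s) i 0) 0 t.
  by split=> -[cz ez]; split=> // t t0 i; rewrite ez //; congr (_ + _);
    [|apply/esym]; exact: h.
move=> cz; apply: intg_ae; try exact: measurable_field.
apply: ae_imp2 uv (ae_neq 0) => s uvs s0 /andP[s0' _].
by rewrite uvs // lt_neqAle eq_sym s0.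
Qed.

Lemma state_ae x u v : admissible u -> admissible v ->
  {ae (@lebesgue_measure R), forall t, 0 < t -> u t = v t} ->
  state A B x u = state A B x v.
Proof. by move=> au av uv; rewrite /state (is_state_ae x au av uv). Qed.

(** Trades the chosen [state] and almost-everywhere constraints for clean controls and the explicit
    formula [resp]. *)
Lemma reach_timesP eps x t : reach_times A B eps x t <->
  0 < t /\ exists2 u, clean u & enorm (resp x u t) <= eps.
Proof.
split=> [[t0 [u [au ut]]]|[t0 [u cu ut]]]; split=> //.
  have [v cv uv] := admissible_clean au; exists v => //.
  have <- := stateE x cv (ltW t0).
  by rewrite -(state_ae x au (clean_admissible cv) uv).
exists u; split; first exact: clean_admissible.
by have -> := stateE x cu (ltW t0).
Qed.

End States.

(** * Time-optimality of aligned controls *)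

Section Extremals.
Context {R : realType} {n m : nat}.
Variables (A : 'M[R]_n) (B : 'M[R]_(n, m)).
Implicit Types (x p : 'cV[R]_n) (u v : R -> 'cV[R]_m) (f : R -> R).

Local Notation obs := (obs A B).
Local Notation drift := (drift A B).
Local Notation resp := (resp A B).

Lemma intg_gt0 f a b c : continuous f -> (forall s, a <= s <= b -> 0 <= f s) ->
  a < b -> a <= c <= b -> 0 < f c -> 0 < intg f a b.
Proof.
move=> cf f0 ab /andP[ac cb] fc; have lf := continuous_locbm cf.
have /cvgrPdist_lt /(_ (f c / 2) (divr_gt0 fc (ltr0Sn _ 1))) := cf c.
move=> /nbhs_ballP[e /= e0 he].
pose c1 := Num.max a (c - e / 2); pose c2 := Num.min b (c + e / 2).
have ac1 : a <= c1 by rewrite le_max lexx.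
have c2b : c2 <= b by rewrite ge_min lexx.
have c1c2 : c1 < c2.
  by rewrite /c1 /c2 gt_max !lt_min; apply/andP; split; apply/andP; split; lra.
have hf s : c1 <= s <= c2 -> f c / 2 <= f s.
  rewrite /c1 /c2 ge_max le_min => /andP[/andP[_ s1] /andP[_ s2]].
  have : `|f c - f s| < f c / 2.
    by apply: he; rewrite /ball /= ltr_norml; apply/andP; split; lra.
  rewrite ltr_norml => /andP[]; lra.
rewrite -(intg_cat lf ac1 (le_trans (ltW c1c2) c2b)).
rewrite -(intg_cat lf (ltW c1c2) c2b).
have p1 : 0 <= intg f a c1.
  apply: intg_ge0 => s /andP[as_ sc]; apply: f0.
  by rewrite as_ (le_trans sc (le_trans (ltW c1c2) c2b)).
have p3 : 0 <= intg f c2 b.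
  apply: intg_ge0 => s /andP[as_ sc]; apply: f0.
  by rewrite sc (le_trans (le_trans ac1 (ltW c1c2)) as_).
have p2 : f c / 2 * (c2 - c1) <= intg f c1 c2.
  by rewrite -(intg_cst _ (ltW c1c2)); exact: (le_intg (locbm_cst _) lf hf).
have : 0 < f c / 2 * (c2 - c1).
  by rewrite mulr_gt0 ?subr_gt0 // divr_gt0.
lra.
Qed.

(* The support function at [p] of the set of points that can be brought to 0 at
   time [T]. *)
Definition hsupp p (T : R) : R := intg (fun s => enorm (obs (- s) p)) 0 T.

Lemma continuous_enorm_obs p : continuous (fun s : R => enorm (obs (- s) p)).
Proof.
move=> s; apply: (@continuous_enorm _ R _ (fun s : R => obs (- s) p)) => i.
exact: (@continuous_obs_oppc _ _ _ A B p i).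
Qed.

Lemma locbm_enorm_obs p : locbm (fun s : R => enorm (obs (- s) p)).
Proof. by apply: continuous_locbm; exact: continuous_enorm_obs. Qed.

Lemma hsupp_le p (S T : R) : 0 <= S -> S <= T -> hsupp p S <= hsupp p T.
Proof.
move=> S0 ST; rewrite /hsupp -(intg_cat (locbm_enorm_obs p) S0 ST) lerDl.
by apply: intg_ge0 => s _; exact: enorm_ge0.
Qed.

Lemma hsupp_lt p (S T c : R) : 0 <= S -> S < T -> S <= c <= T ->
  obs (- c) p != 0 -> hsupp p S < hsupp p T.
Proof.
move=> S0 ST ScT oc; rewrite /hsupp -(intg_cat (locbm_enorm_obs p) S0 (ltW ST)).
rewrite ltrDl; apply: (@intg_gt0 _ _ _ c) => //.
- exact: continuous_enorm_obs.
- by move=> s _; exact: enorm_ge0.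
- exact: enorm_gt0.
Qed.

(** The integrand of [dotp_resp] is at least [- enorm (obs (- s) p)]. The end point is kept as a
    remainder so that the bound also serves targets that are balls. *)
Lemma dotp_le_hsuppD p x u (T : R) : clean u ->
  dotp p x <= hsupp p T + dotp p (expmx A (- T) *m resp x u T).
Proof.
move=> cu; have h0 := dotp_resp A B x p T cu.
have : 0 <= intg (fun s => dotp (obs (- s) p) (u s) + enorm (obs (- s) p)) 0 T.
  by apply: intg_ge0 => s _; apply: dotp_le_unit_ball; case: cu.
rewrite intgD; [rewrite -/(hsupp p T); lra|exact: locbm_obs_dotp|].
exact: locbm_enorm_obs.
Qed.

Lemma dotp_le_hsupp p x u (T : R) : clean u -> resp x u T = 0 ->
  dotp p x <= hsupp p T.
Proof.
move=> cu xT; have := dotp_le_hsuppD p x T cu.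
by rewrite xT mulmx0 dotp0r addr0.
Qed.

(** A nonnegative integrand with zero integral vanishes almost everywhere, and the equality case of
    Cauchy-Schwarz fixes the direction of [v]. The factor [enorm (obs (- t) p)] makes the conclusion
    empty where the output vanishes. *)
Lemma dotp_eq_hsupp p x v (T : R) : clean v -> resp x v T = 0 ->
  dotp p x = hsupp p T ->
  {ae (@lebesgue_measure R), forall t, 0 <= t <= T ->
     enorm (obs (- t) p) *: v t = - obs (- t) p}.
Proof.
move=> cv xT px; have := dotp_resp A B x p T cv; rewrite xT mulmx0 dotp0r => h0.
have lo := locbm_obs_dotp A B p cv; have le := locbm_enorm_obs p.
have : intg (fun s => dotp (obs (- s) p) (v s) + enorm (obs (- s) p)) 0 T = 0.
  by rewrite intgD // -/(hsupp p T) -px addrC -h0.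
move=> /(intg_eq0_ae (locbmD lo le)); case: cv => _ bv.
move=> /(_ (fun s _ => dotp_le_unit_ball _ (bv s))).
apply: ae_imp => s hs /hs; exact: dotp_unit_ball_eq.
Qed.

(* A control aligned with the adjoint [p] is extremal: the linear functional
   [p] certifies that no control steers [x] to the origin before time [T]. *)
Definition aligned p u T :=
  {ae (@lebesgue_measure R), forall t, 0 < t < T -> u t = - unitv (obs (- t) p)}.

Section Synthesis.
Variables (p : 'cV[R]_n) (T : R) (u : R -> 'cV[R]_m).
Hypothesis T0 : 0 < T.
Hypothesis cu : clean u.
Hypothesis au : aligned p u T.
Hypothesis hT : forall S : R, 0 <= S -> S < T -> hsupp p S < hsupp p T.

(** The only point that [u] brings to 0 at time [T]. *)
Let x := - drift u T.

Lemma synthesis_resp : resp x u T = 0.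
Proof. by rewrite !respE /x addNr mulmx0. Qed.

Lemma synthesis_dotp : dotp p x = hsupp p T.
Proof.
have le := locbm_enorm_obs p.
rewrite /x dotpNr dotp_drift //.
suff -> : intg (fun s => dotp (obs (- s) p) (u s)) 0 T =
    intg (fun s => - enorm (obs (- s) p)) 0 T by rewrite intgN // opprK.
apply: intg_ae.
- by apply: measurable_funTS; case: (locbm_obs_dotp A B p cu).
- by apply: measurable_funTS; case: (locbmN le).
apply: ae_imp2 (ae_neq 0) (ae_imp2 _ (ae_neq T) au); last first.
  by move=> s sT aus; exact: (conj sT aus).
move=> s s0 [sT aus] /andP[s0' sT'].
by rewrite aus ?dotpNr ?dotp_unitv // !lt_neqAle eq_sym s0 s0' sT.
Qed.

Lemma synthesis_neq0 : x != 0.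
Proof.
apply/eqP => x0; have := hT (lexx 0) T0; rewrite /hsupp intg_point -/(hsupp p T).
by rewrite -synthesis_dotp x0 dotp0r ltxx.
Qed.

Lemma synthesis_reach : reach_times A B 0 x T.
Proof. by apply/reach_timesP; split=> //; exists u => //; rewrite synthesis_resp enorm0. Qed.

(** Arrival at a time [S < T] would give [dotp p x <= hsupp p S < hsupp p T = dotp p x]. *)
Lemma synthesis_Topt : Topt A B 0 x = T.
Proof.
apply/eqP; rewrite eq_le; apply/andP; split.
  apply: ge_inf; last exact: synthesis_reach.
  by exists 0 => S [/ltW].
apply: lb_le_inf; first by exists T; exact: synthesis_reach.
move=> S /reach_timesP[S0 [v cv vS]]; rewrite leNgt; apply/negP => ST.
have /enorm_eq0 v0 : enorm (resp x v S) = 0.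
  by apply/eqP; rewrite eq_le vS enorm_ge0.
by have := hT (ltW S0) ST; rewrite -synthesis_dotp ltNge (dotp_le_hsupp p cv v0).
Qed.

Lemma synthesis_optimal : optimal A B 0 x u.
Proof.
split; first exact: clean_admissible.
by rewrite synthesis_Topt stateE ?(ltW T0) // synthesis_resp enorm0.
Qed.

Lemma synthesis_unique v : optimal A B 0 x v ->
  {ae (@lebesgue_measure R), forall t, 0 < t < T ->
     enorm (obs (- t) p) *: v t = - obs (- t) p}.
Proof.
move=> [av vT]; have [w cw vw] := admissible_clean av.
rewrite synthesis_Topt (state_ae A B x av (clean_admissible cw) vw) in vT.
rewrite stateE ?(ltW T0) // in vT.
have /enorm_eq0 w0 : enorm (resp x w T) = 0.
  by apply/eqP; rewrite eq_le vT enorm_ge0.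
apply: ae_imp2 vw (dotp_eq_hsupp cw w0 synthesis_dotp) => t vwt h /andP[t0 tT].
by rewrite vwt // h // (ltW t0) ltW.
Qed.

End Synthesis.

(** For a ball target no witness is constructed, so the default value of the choice has to be faced
    as a case. *)
Lemma u_star_cases eps x : is_u_star A B eps x (u_star A B eps x) \/
  u_star A B eps x = fun=> 0.
Proof. by rewrite /u_star; case: xgetP => [u -> /= ?|_]; [left|right]. Qed.

Lemma is_u_star_u_star eps x u : is_u_star A B eps x u ->
  is_u_star A B eps x (u_star A B eps x).
Proof. by move=> hu; rewrite /u_star; case: xgetP => [v -> //|/(_ u)]. Qed.

End Extremals.

(** * Explicit extremals with at most one switching time *)

Section Switching.
Context {R : realType} {n m : nat}.
Variables (A : 'M[R]_n) (B : 'M[R]_(n, m)).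

Lemma continuous_unitv k (f : R -> 'cV[R]_k) (t : R) :
  (forall i, continuous (fun s => f s i 0)) -> f t != 0 ->
  {for t, continuous (fun s => unitv (f s))}.
Proof.
move=> cf ft; apply: cvg_mxP => i j; rewrite (ord1 j).
rewrite (_ : (fun s => _) = fun s => (enorm (f s))^-1 * f s i 0); last first.
  by apply/funext => s; rewrite mxE.
have -> : unitv (f t) i 0 = (enorm (f t))^-1 * f t i 0 by rewrite mxE.
apply: cvgM; last exact: cf.
apply: cvgV; first by rewrite gt_eqF // enorm_gt0.
by apply: (@continuous_enorm _ R _ f) => l; exact: cf.
Qed.

Lemma measurable_unitv k (f : R -> 'cV[R]_k) i :
  (forall i, continuous (fun s => f s i 0)) ->
  measurable_fun (setT : set R) (fun s : R => unitv (f s) i 0).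
Proof.
(* The inverse norm is written as a real power, measurable also across zeros of [f], where
   continuity fails. *)
move=> cf; rewrite (_ : (fun s => _) =
    fun s => enorm (f s) `^ (- 1) * f s i 0); last first.
  by apply/funext => s; rewrite mxE powR_inv1 // enorm_ge0.
apply: measurable_funM; last exact: continuous_measurable_fun.
apply: (@measurableT_comp _ _ _ _ _ _ (fun r : R => r `^ (- 1))).
  exact: measurable_powR.
apply: continuous_measurable_fun => t.
by apply: (@continuous_enorm _ R _ f) => l; exact: cf.
Qed.

(* [k] is a nowhere vanishing direction of the observed adjoint, whose scalar
   coefficient [chi] changes sign at the switching time [t0]. *)
Variables (k : R -> 'cV[R]_m) (t0 T : R).
Hypothesis ck : forall i, continuous (fun s => k s i 0).
Hypothesis k0 : forall t, 0 <= t <= T -> k t != 0.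
Hypothesis t00 : 0 < t0.
Hypothesis t0T : t0 <= T.

(** The value at [t0] belongs to the left piece, for left-continuity, and the value is 0 off []0,
    T]] as [is_u_star] demands. With [t0 = T] there is no switch. *)
Definition switch (t : R) : 'cV[R]_m :=
  if (0 < t) && (t <= T) then
    if t <= t0 then - unitv (k t) else unitv (k t)
  else 0.

Lemma clean_switch : clean switch.
Proof.
split; last first.
  move=> t; rewrite /switch; case: ifP => _; last by rewrite enorm0.
  by case: ifP => _; rewrite ?enormN enorm_unitv_le1.
move=> i; rewrite (_ : (fun t => _) = fun t : R =>
    if (0 < t) && (t <= T) then
      if t <= t0 then - (unitv (k t) i 0) else unitv (k t) i 0
    else 0); last first.
  by apply/funext => t; rewrite /switch; case: ifP => _; [case: ifP|];
    rewrite ?mxE // => _; rewrite mxE.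
have mle (c : R) : measurable_fun setT (fun t : R => t <= c).
  by apply: measurable_fun_ler => //; exact: measurable_cst.
have mk := measurable_unitv i ck.
apply: measurable_fun_if => //.
- apply: measurable_and; last exact: mle.
  by apply: measurable_fun_ltr => //; exact: measurable_cst.
- apply: measurable_funTS; apply: measurable_fun_if => //.
  + exact: measurable_funTS (measurableT_comp _ mk).
  + exact: measurable_funTS.
Qed.

Lemma pw_left_continuous_switch : pw_left_continuous T switch.
Proof.
have ckv t : 0 <= t <= T -> {for t, continuous (fun s => unitv (k s))}.
  by move=> tT; apply: continuous_unitv => //; exact: k0.
have ckN t : 0 <= t <= T -> {for t, continuous (fun s => - unitv (k s))}.
  by move=> tT; apply: cvgN; exact: ckv.
split.
- exists [:: t0] => t /andP[tp tT]; rewrite inE => tt0.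
  have tI : 0 <= t <= T by rewrite !ltW.
  have [lt|gt] := ltP t t0.
    have swt : switch t = - unitv (k t).
      by rewrite /switch tp (ltW tT) (ltW lt).
    rewrite /prop_for /continuous_at swt.
    apply: cvg_trans (ckN _ tI); apply: near_eq_cvg; near=> s.
    rewrite /switch; have -> : 0 < s by near: s; exact: lt_nbhsr.
    have -> : s <= T by apply: ltW; near: s; exact: lt_nbhsl.
    by have -> : s <= t0 by apply: ltW; near: s; exact: lt_nbhsl.
  have {}gt : t0 < t by rewrite lt_neqAle eq_sym tt0.
  have swt : switch t = unitv (k t).
    by rewrite /switch tp (ltW tT) leNgt gt.
  rewrite /prop_for /continuous_at swt.
  apply: cvg_trans (ckv _ tI); apply: near_eq_cvg; near=> s.
  rewrite /switch; have -> : 0 < s by near: s; exact: lt_nbhsr.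
  have -> : s <= T by apply: ltW; near: s; exact: lt_nbhsl.
  rewrite leNgt; have -> // : t0 < s by near: s; exact: lt_nbhsr.
- move=> t /andP[tp tT]; have tI : 0 <= t <= T by rewrite ltW.
  have sT : \forall s \near t^'-, s <= T.
    near=> s; apply: le_trans tT; apply: ltW; near: s; exact: nbhs_left_lt.
  have s0 : \forall s \near t^'-, 0 < s by exact: nbhs_left_gt.
  have [le|gt] := leP t t0.
    have -> : switch t = - unitv (k t) by rewrite /switch tp tT le.
    apply: cvg_trans (cvg_at_left_filter (ckN _ tI)).
    apply: near_eq_cvg; near=> s; rewrite /switch.
    have -> : 0 < s by near: s.
    have -> : s <= T by near: s.
    have -> // : s <= t0.
    by apply: le_trans le; apply: ltW; near: s; exact: nbhs_left_lt.
  have -> : switch t = unitv (k t) by rewrite /switch tp tT leNgt gt.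
  apply: cvg_trans (cvg_at_left_filter (ckv _ tI)).
  apply: near_eq_cvg; near=> s; rewrite /switch.
  have -> : 0 < s by near: s.
  have -> : s <= T by near: s.
  rewrite leNgt; have -> // : t0 < s by near: s; exact: nbhs_left_gt.
- move=> t /andP[tp tT]; have tI : 0 <= t <= T by rewrite tp ltW.
  have sT : \forall s \near t^'+, s <= T.
    by near=> s; apply: ltW; near: s; exact: nbhs_right_lt.
  have s0 : \forall s \near t^'+, 0 < s.
    near=> s; apply: (le_lt_trans tp); near: s; exact: nbhs_right_gt.
  have [lt|ge] := ltP t t0.
    apply/cvg_ex; exists (- unitv (k t)).
    apply: cvg_trans (cvg_at_right_filter (ckN _ tI)).
    apply: near_eq_cvg; near=> s; rewrite /switch.
    have -> : 0 < s by near: s.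
    have -> : s <= T by near: s.
    by have -> : s <= t0 by apply: ltW; near: s; exact: nbhs_right_lt.
  apply/cvg_ex; exists (unitv (k t)).
  apply: cvg_trans (cvg_at_right_filter (ckv _ tI)).
  apply: near_eq_cvg; near=> s; rewrite /switch.
  have -> : 0 < s by near: s.
  have -> : s <= T by near: s.
  rewrite leNgt; have -> // : t0 < s.
  by apply: (le_lt_trans ge); near: s; exact: nbhs_right_gt.
Unshelve. all: by end_near. Qed.

Variables (p : 'cV[R]_n) (chi : R -> R).
Hypothesis pk : forall t, obs A B (- t) p = chi t *: k t.
Hypothesis chip : forall t, 0 < t < t0 -> 0 < chi t.
Hypothesis chin : forall t, t0 < t < T -> chi t < 0.

Lemma aligned_switch : aligned A B p switch T.
Proof.
apply: ae_imp (ae_neq t0) => t tt0 /andP[tp tT].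
rewrite /switch tp (ltW tT) /= pk.
have [lt|gt|] := ltgtP t t0; last by move=> tE; rewrite tE eqxx in tt0.
  by rewrite unitvZ // chip // tp lt.
have cn : 0 < - chi t by rewrite oppr_gt0 chin // gt.
by rewrite -unitvN -scaleNr unitvZ.
Qed.

Lemma switch_hsupp_lt (S : R) : 0 <= S -> S < T -> hsupp A B p S < hsupp A B p T.
Proof.
move=> S0 ST.
have h c : S < c < T -> c != t0 -> hsupp A B p S < hsupp A B p T.
  move=> /andP[Sc cT] ct0; apply: (@hsupp_lt _ _ _ _ _ _ _ _ c) => //.
    by rewrite !ltW.
  rewrite pk scaler_eq0 negb_or k0 ?andbT; last first.
    by rewrite (le_trans S0) ltW.
  move: ct0; rewrite neq_lt => /orP[lt|gt].
    by rewrite gt_eqF // chip // lt andbT (le_lt_trans S0).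
  by rewrite lt_eqF // chin // gt.
(* A time strictly between [S] and [T] other than [t0] is wanted: the midpoint, or the three-quarter
   point if the midpoint is [t0]. *)
have [e|e] := eqVneq ((S + T) / 2) t0; last by apply: (h ((S + T) / 2)) => //; lra.
by apply: (h ((S + 3 * T) / 4)); [lra|apply/eqP; lra].
Qed.

Lemma switch_Topt : Topt A B 0 (- drift A B switch T) = T.
Proof.
apply: synthesis_Topt clean_switch aligned_switch switch_hsupp_lt.
exact: lt_le_trans t0T.
Qed.

Lemma is_u_star_switch : is_u_star A B 0 (- drift A B switch T) switch.
Proof.
have T0 := lt_le_trans t00 t0T.
split; rewrite ?switch_Topt.
- exact: synthesis_optimal T0 clean_switch aligned_switch switch_hsupp_lt.
- exact: pw_left_continuous_switch.
- by move=> t; rewrite /switch => /negbTE ->.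
Qed.

Lemma u_star_switch : {ae (@lebesgue_measure R), forall t, 0 < t < T ->
  u_star A B 0 (- drift A B switch T) t = switch t}.
Proof.
have T0 := lt_le_trans t00 t0T.
have [ov _ _] := is_u_star_u_star is_u_star_switch.
have := synthesis_unique T0 clean_switch aligned_switch switch_hsupp_lt ov.
apply: ae_imp2 (ae_imp2 _ (ae_neq t0) aligned_switch); last first.
  by move=> t tt0 at_; exact: (conj tt0 at_).
move=> t [tt0 at_] h tT; rewrite at_ //; have /andP[tp tT'] := tT.
have o0 : obs A B (- t) p != 0.
  rewrite pk scaler_eq0 negb_or k0 ?andbT ?(ltW tp) ?(ltW tT') //.
  move: tt0; rewrite neq_lt => /orP[lt|gt]; first by rewrite gt_eqF // chip // tp.
  by rewrite lt_eqF // chin // gt.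
rewrite /unitv -scalerN -h // scalerA mulVf ?scale1r //.
by rewrite gt_eqF // enorm_gt0.
Qed.

End Switching.

(** * The radial minimum time *)

Section RadialTime.
Context {R : realType}.
Variables (b a : R).
Implicit Types (r s t : R).
Hypothesis b0 : 0 < b.
Hypothesis a0 : a <= 0.

(* The radius of the feedback trajectory solves [rho' = a rho - b]; its
   starting value is [b * travel T] when it vanishes at time [T], and
   [arrival] is the inverse map. *)
Definition travel (t : R) : R :=
  if a == 0 then t else (1 - expR (- a * t)) / a.

Definition arrival (r : R) : R :=
  if a == 0 then r / b else - (ln (1 - a * (r / b)) / a).

Lemma is_derive_travel t : is_derive t (1 : R) travel (expR (- a * t)).
Proof.
rewrite /travel; have [a_eq0|a_neq0] := eqVneq a 0.
  by rewrite a_eq0 oppr0 mul0r expR0; exact: is_derive_id.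
have hl : is_derive t (1 : R) (fun s : R => - a * s) (- a).
  apply: is_derive_eq (is_derive_mul (is_derive_cst_fun (- a) t 1) (is_derive_id t 1)) _.
  by rewrite mul0r add0r mulr1.
have he := is_derive_comp (is_derive_expR (- a * t)) hl.
have h1 := is_derive_add (is_derive_cst_fun 1 t 1)
  (is_derive_mul (is_derive_cst_fun (- 1) t 1) he).
have := is_derive_mul h1 (is_derive_cst_fun a^-1 t 1).
move=> h; rewrite (_ : (fun t => _) = fun y : R => (1 + -1 * expR (- a * y)) / a).
  by apply: is_derive_eq h _; field.
by apply/funext => s; rewrite mulN1r.
Qed.

Lemma travel0 : travel 0 = 0.
Proof. by rewrite /travel; case: eqP => // _; rewrite mulr0 expR0 subrr mul0r. Qed.

Lemma travelE t : 0 <= t -> travel t = intg (fun s => expR (- a * s)) 0 t.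
Proof.
move=> t0; rewrite (continuous_derive_intg t0 is_derive_travel).
  by rewrite travel0 subr0.
move=> s; apply: (@continuous_comp R R R (fun s => - a * s) expR).
  exact: (@mulrl_continuous R (- a) s).
exact: continuous_expR.
Qed.

Lemma travel_lt s t : 0 <= s -> s < t -> travel s < travel t.
Proof.
move=> s0 st; have t0 := le_trans s0 (ltW st).
have ce : continuous (fun s : R => expR (- a * s)).
  move=> r; apply: (@continuous_comp R R R (fun s => - a * s) expR).
    exact: (@mulrl_continuous R (- a) r).
  exact: continuous_expR.
rewrite !travelE // -(intg_cat (continuous_locbm ce) s0 (ltW st)) ltrDl.
apply: (intg_gt0 (c := s)) => //; last exact: expR_gt0.
by rewrite lexx ltW.
Qed.

Lemma arrival0 : arrival 0 = 0.
Proof.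
rewrite /arrival; case: eqP => _; first by rewrite mul0r.
by rewrite mul0r mulr0 subr0 ln1 mul0r oppr0.
Qed.

Lemma arrival_arg_gt0 r : 0 <= r -> 0 < 1 - a * (r / b).
Proof.
move=> r0; rewrite subr_gt0 (le_lt_trans _ ltr01) // mulr_le0_ge0 //.
by rewrite divr_ge0 // ltW.
Qed.

Lemma arrivalK r : 0 <= r -> b * travel (arrival r) = r.
Proof.
move=> r0; rewrite /arrival /travel; have [_|a_neq0] := eqVneq a 0.
  by rewrite mulrC divfK // gt_eqF.
rewrite (_ : - a * - _ = ln (1 - a * (r / b))); last by field.
rewrite lnK ?posrE ?arrival_arg_gt0 //; field; rewrite a_neq0 /=.
by rewrite gt_eqF.
Qed.

Lemma arrival_gt0 r : 0 < r -> 0 < arrival r.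
Proof.
move=> r0; rewrite /arrival; have [_|a_neq0] := eqVneq a 0; first exact: divr_gt0.
have an : a < 0 by rewrite lt_neqAle a_neq0.
rewrite oppr_gt0 pmulr_rlt0 ?invr_lt0 // ln_gt0 //.
by rewrite ltrBDr -ltrBDl subrr nmulr_rlt0 // divr_gt0.
Qed.

(** The slope is the reciprocal of the speed [b - a r]. It is two-sided even at 0, because the
    formula stays regular for slightly negative radii. *)
Lemma is_derive_arrival r : 0 <= r ->
  is_derive r (1 : R) arrival (b - a * r)^-1.
Proof.
move=> r0; have bar : b - a * r != 0.
  rewrite gt_eqF // subr_gt0; apply: le_lt_trans b0.
  by rewrite mulr_le0_ge0.
have bn : b != 0 by rewrite gt_eqF.
rewrite /arrival; have [a_eq0|a_neq0] := eqVneq a 0.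
  apply: is_derive_eq (is_derive_mul (is_derive_id r 1) (is_derive_cst_fun b^-1 r 1)) _.
  by rewrite a_eq0; field.
have h1 : is_derive r (1 : R) (fun s : R => 1 + (- a / b) * s) (- a / b).
  apply: is_derive_eq (is_derive_add (is_derive_cst_fun 1 r 1)
    (is_derive_mul (is_derive_cst_fun (- a / b) r 1) (is_derive_id r 1))) _.
  by rewrite mul0r !add0r mulr1.
have p1 : 0 < 1 + - a / b * r.
  by have := arrival_arg_gt0 r0; rewrite (_ : 1 - _ = 1 + - a / b * r) //; field.
have := is_derive_mul (is_derive_cst_fun (- a^-1) r 1)
  (is_derive_comp (h := fun s => 1 + - a / b * s) (is_derive1_ln p1) h1).
move=> h; rewrite (_ : (fun r => _) = fun s => - a^-1 * ln (1 + - a / b * s)).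
  apply: is_derive_eq h _; rewrite mul0r add0r; field.
  by rewrite bar bn a_neq0.
apply/funext => s; rewrite (_ : 1 - a * (s / b) = 1 + - a / b * s).
  by rewrite (mulrC (- a^-1)) mulrN.
by field.
Qed.

(** Since [a <= 0], the speed is at least [b], so the slope is at most [b^-1]. *)
Lemma arrival_lipschitz r s : 0 <= r -> 0 <= s ->
  `|arrival r - arrival s| <= b^-1 * `|r - s|.
Proof.
wlog rs : r s / s <= r => [h r0 s0|r0 s0].
  have [sr|/ltW rs] := leP s r; first exact: h.
  by rewrite distrC (distrC r); exact: h.
have cw : {within `[s, r], continuous arrival}.
  apply: derivable_within_continuous => t; rewrite in_itv /= => /andP[st _].
  exact: (@ex_derive _ _ _ _ _ _ _ (is_derive_arrival (le_trans s0 st))).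
have [t|c] := MVT_segment (df := fun t => (b - a * t)^-1) rs _ cw.
  rewrite in_itv /= => /andP[/ltW st _].
  exact: is_derive_arrival (le_trans s0 st).
rewrite in_itv /= => /andP[sc _] ->.
have c0 := le_trans s0 sc.
have bc : b <= b - a * c by rewrite lerDl oppr_ge0 mulr_le0_ge0.
rewrite normrM ler_wpM2r // ger0_norm; last by rewrite invr_ge0 (le_trans (ltW b0)).
by rewrite lef_pV2 // posrE // (lt_le_trans b0).
Qed.

Context {n : nat}.
Implicit Types (f : 'cV[R]_n -> R) (x : 'cV[R]_n).

(** A class closed under partial derivatives off 0, which reduces smoothness to continuity of its
    members. The two inverses are exactly what differentiating [arrival (enorm x)] produces. *)
Inductive radial_class : ('cV[R]_n -> R) -> Prop :=
| RadialCst c : radial_class (fun=> c)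
| RadialCoord i : radial_class (fun x => x i 0)
| RadialAdd f g : radial_class f -> radial_class g ->
    radial_class (fun x => f x + g x)
| RadialMul f g : radial_class f -> radial_class g ->
    radial_class (fun x => f x * g x)
| RadialInvNorm : radial_class (fun x => (enorm x)^-1)
| RadialInvSpeed : radial_class (fun x => (b - a * enorm x)^-1)
| RadialArrival : radial_class (fun x => arrival (enorm x)).

Lemma is_derive_coord j x v : is_derive x v (fun y : 'cV[R]_n => y j 0) (v j 0).
Proof.
apply/is_derive_line.
rewrite (_ : (fun e => _) = fun e : R => e * v j 0 + x j 0); last first.
  by apply/funext => e; rewrite !mxE.
apply: is_derive_eq (is_derive_add (is_derive_mul (is_derive_id (0 : R) 1)
  (is_derive_cst_fun (v j 0) (0 : R) 1)) (is_derive_cst_fun (x j 0) (0 : R) 1)) _.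
by rewrite mul1r mul0r !addr0.
Qed.

Lemma is_derive_enorm x i : x != 0 ->
  is_derive x (delta_mx i 0) (fun y : 'cV[R]_n => enorm y) (x i 0 * (enorm x)^-1).
Proof.
move=> x0; have ex := enorm_gt0 x0.
have xx : 0 < dotp x x by rewrite -sqr_enorm exprn_gt0.
have hd := is_derive_bigsum (index_enum 'I_n) (fun j =>
  is_derive_mul (is_derive_coord j x (delta_mx i 0)) (is_derive_coord j x (delta_mx i 0))).
have := is_derive_comp (h := fun y : 'cV[R]_n => dotp y y) (is_derive1_sqrt xx) hd.
move=> h; apply: is_derive_eq h _.
rewrite (bigD1 i) //= big1 => [|j ji].
  by rewrite mxE !eqxx /= mul1r mulr1 addr0 -/(enorm x); field; rewrite gt_eqF.
by rewrite mxE (negbTE ji) /= mul0r mulr0 addr0.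
Qed.

Lemma is_derive_inv f df x v : f x != 0 -> is_derive x v f df ->
  is_derive x v (fun y => (f y)^-1) (- ((f x)^-1 * (f x)^-1) * df).
Proof.
move=> fx hf; apply: is_derive_comp hf.
apply: is_derive_eq (is_deriveV fx (is_derive_id (f x) 1)) _.
by rewrite /GRing.scale /= mulr1 -exprVn expr2.
Qed.

Lemma speed_gt0 x : 0 < b - a * enorm x.
Proof.
rewrite subr_gt0; apply: le_lt_trans b0.
by rewrite mulr_le0_ge0 // enorm_ge0.
Qed.

Lemma is_derive_arrival_enorm x i : x != 0 ->
  is_derive x (delta_mx i 0) (fun y : 'cV[R]_n => arrival (enorm y))
    ((b - a * enorm x)^-1 * (x i 0 * (enorm x)^-1)).
Proof.
move=> x0; apply: is_derive_comp (is_derive_enorm i x0).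
exact: is_derive_arrival (enorm_ge0 x).
Qed.

Lemma continuous_enorm_id x : {for x, continuous (fun y : 'cV[R]_n => enorm y)}.
Proof.
apply: (@continuous_enorm _ _ _ (fun y : 'cV[R]_n => y)) => i.
exact: coord_continuous.
Qed.

Lemma near_neq0 x : x != 0 -> \forall y \near x, y != 0.
Proof.
move=> x0; have h : \forall y \near x, 0 < enorm y.
  have := @cvgr_gt R _ (nbhs x) _ _ (enorm x) (@continuous_enorm_id x).
  by apply; exact: enorm_gt0.
near=> y; have : 0 < enorm y by near: y.
by apply: contraTneq => ->; rewrite enorm0 ltxx.
Unshelve. all: by end_near. Qed.

Lemma radial_class_continuous f x : radial_class f -> x != 0 ->
  {for x, continuous f}.
Proof.
move=> hf x0; elim: hf => [c|i|{}f g _ cf _ cg|{}f g _ cf _ cg|||].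
- exact: continuous_at_cst.
- exact: (@coord_continuous R n 1 i 0 x).
- exact: continuous_at_add.
- exact: continuous_at_mul.
- apply: (@continuous_at_inv _ _ (fun y : 'cV[R]_n => enorm y)).
    by rewrite gt_eqF // enorm_gt0.
  exact: continuous_enorm_id.
- apply: (@continuous_at_inv _ _ (fun y : 'cV[R]_n => b - a * enorm y)).
    by rewrite gt_eqF // speed_gt0.
  rewrite (_ : (fun y => _) = fun y : 'cV[R]_n => b + - a * enorm y); last first.
    by apply/funext => y; rewrite mulNr.
  apply: continuous_at_add; first exact: continuous_at_cst.
  apply: continuous_at_mul; first exact: continuous_at_cst.
  exact: continuous_enorm_id.
- apply: (@continuous_comp _ _ _ (fun y : 'cV[R]_n => enorm y) arrival).
    exact: continuous_enorm_id.
  apply/differentiable_continuous/derivable1_diffP.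
  exact: (@ex_derive _ _ _ _ _ _ _ (is_derive_arrival (enorm_ge0 x))).
Qed.

Lemma radial_class_derive f i : radial_class f -> exists2 g, radial_class g &
  forall x, x != 0 -> is_derive x (delta_mx i 0) f (g x).
Proof.
elim=> [c|j|{}f g hf [f' hf' df] hg [g' hg' dg]|{}f g hf [f' hf' df] hg [g' hg' dg]|||].
- exists (fun=> 0); first exact: RadialCst.
  by move=> x _; exact: is_derive_cst_fun.
- exists (fun=> (delta_mx i 0 : 'cV[R]_n) j 0); first exact: RadialCst.
  by move=> x _; exact: is_derive_coord.
- exists (fun x => f' x + g' x); first exact: RadialAdd.
  by move=> x x0; apply: is_derive_add; [exact: df|exact: dg].
- exists (fun x => f' x * g x + f x * g' x).
    by apply: RadialAdd; exact: RadialMul.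
  by move=> x x0; apply: is_derive_mul; [exact: df|exact: dg].
(* The sign is a constant factor because the class has no constructor for opposites. *)
- exists (fun x => -1 * ((enorm x)^-1 * (enorm x)^-1) * (x i 0 * (enorm x)^-1)).
    by do ?apply: RadialMul; constructor.
  move=> x x0; rewrite mulN1r; apply: is_derive_inv.
    by rewrite gt_eqF // enorm_gt0.
  exact: is_derive_enorm.
- exists (fun x => -1 * ((b - a * enorm x)^-1 * (b - a * enorm x)^-1) *
      (- a * (x i 0 * (enorm x)^-1))).
    by do ?apply: RadialMul; constructor.
  move=> x x0; rewrite mulN1r.
  apply: (@is_derive_inv (fun x => b - a * enorm x)); first by rewrite gt_eqF // speed_gt0.
  have := is_derive_add (is_derive_cst_fun b x (delta_mx i 0)) (is_derive_mul
    (is_derive_cst_fun (- a) x (delta_mx i 0)) (is_derive_enorm i x0)).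
  rewrite mul0r !add0r; congr is_derive.
  by apply/funext => y; rewrite mulNr.
- exists (fun x => (b - a * enorm x)^-1 * (x i 0 * (enorm x)^-1)).
    by do ?apply: RadialMul; constructor.
  by move=> x x0; exact: is_derive_arrival_enorm.
Qed.

Lemma radial_class_iter_partial f (s : seq 'I_n) : radial_class f -> exists2 g, radial_class g &
  forall x, x != 0 -> iter_partial s f x = g x.
Proof.
move=> hf; elim: s => [|i s [g hg fg]]; first by exists f.
have [g' hg' dg] := radial_class_derive i hg; exists g' => // x x0 /=.
have : is_derive x (delta_mx i 0) (iter_partial s f) (g' x).
  (* The induction hypothesis holds only off 0, but that set is open, so it can be
     differentiated. *)
  apply: near_eq_is_derive (dg x x0).
  by apply: filterS (near_neq0 x0) => y y0; rewrite fg.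
by move=> [_ <-].
Qed.

Lemma smooth_on_radial_class f : radial_class f -> smooth_on [set x | x != 0] f.
Proof.
move=> hf s x /= x0; have [g hg fg] := radial_class_iter_partial s hf.
have near_fg : \forall y \near x, g y = iter_partial s f y.
  by apply: filterS (near_neq0 x0) => y y0; rewrite fg.
split.
  rewrite /prop_for /continuous_at fg //.
  exact: cvg_trans (near_eq_cvg near_fg) (radial_class_continuous hg x0).
move=> i; have [g' _ dg] := radial_class_derive i hg.
have [] // := near_eq_is_derive near_fg (dg x x0).
Qed.

End RadialTime.

(** * Value function, feedback and Hamiltonian of an isotropic system *)

Section Isotropic.
Context {R : realType} {n m : nat}.
Variables (A : 'M[R]_n) (B : 'M[R]_(n, m)) (b a : R).
Hypothesis b0 : 0 < b.
Hypothesis a0 : a <= 0.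
Hypothesis BB : B *m B^T = (b ^+ 2)%:M.
Hypothesis AA : A + A^T = (2 * a)%:M.
Implicit Types (x p : 'cV[R]_n) (s t : R).

(** Each entry of [E^T E] solves [G' = 2 a G]; multiplied by [exp(- 2 a t)] it becomes constant. *)
Lemma expmx_tr_mul t : (expmx A t)^T *m expmx A t = (expR (2 * a * t))%:M.
Proof.
apply/matrixP => i j.
pose G s := ((expmx A s)^T *m expmx A s) i j.
have dG s : is_derive s (1 : R) G (2 * a * G s).
  rewrite (_ : G = fun s => \sum_k expmx A s k i * expmx A s k j); last first.
    by apply/funext => r; rewrite /G mxE; apply: eq_bigr => k _; rewrite mxE.
  apply: is_derive_eq.
    by apply: is_derive_bigsum => k; apply: is_derive_mul; exact: is_derive_expmx.
  have -> : 2 * a * (\sum_k expmx A s k i * expmx A s k j) =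
      ((expmx A s)^T *m ((A + A^T) *m expmx A s)) i j.
    rewrite AA mul_scalar_mx -scalemxAr [RHS]mxE; congr (_ * _).
    by rewrite [RHS]mxE; apply: eq_bigr => k _; rewrite [_^T _ _]mxE.
  rewrite mulmxDl mulmxDr [X in _ + X]mulmxA -trmx_mul.
  rewrite [RHS]mxE [RHS]addrC big_split /=.
  congr (_ + _).
    by rewrite [RHS]mxE; apply: eq_bigr => k _; rewrite [in RHS]mxE.
  by rewrite [RHS]mxE; apply: eq_bigr => k _; rewrite [in RHS]mxE.
pose H s := expR (- (2 * a) * s) * G s.
have dH s : is_derive s (1 : R) H 0.
  have hl : is_derive s (1 : R) (fun s : R => - (2 * a) * s) (- (2 * a)).
    apply: is_derive_eq (is_derive_mul (is_derive_cst_fun (- (2 * a)) s 1)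
      (is_derive_id s 1)) _.
    by rewrite mul0r add0r mulr1.
  apply: is_derive_eq (is_derive_mul (is_derive_comp (is_derive_expR _) hl) (dG s)) _.
  by ring.
have := @is_derive_0_is_cst _ H t 0 dH.
rewrite /H mulr0 expR0 mul1r /G expmx0 trmx1 mul1mx => /esym HE.
have -> : (expR (2 * a * t))%:M i j = expR (2 * a * t) * (1%:M : 'M[R]_n) i j.
  by rewrite !mxE mulr_natr.
rewrite HE mulrA -expRD.
by rewrite (_ : _ + _ = 0) ?expR0 ?mul1r //; ring.
Qed.

Lemma expmx_tr t : (expmx A t)^T = expR (2 * a * t) *: expmx A (- t).
Proof. by rewrite -mul_scalar_mx -expmx_tr_mul -mulmxA expmxNK mulmx1. Qed.

Lemma enorm_expmx x t : enorm (expmx A t *m x) = expR (a * t) * enorm x.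
Proof.
rewrite /enorm dotp_mulmxl mulmxA expmx_tr_mul mul_scalar_mx dotpZr.
rewrite (_ : 2 * a * t = a * t + a * t); last by ring.
by rewrite expRD -expr2 sqrtrM ?sqr_ge0 // sqrtr_sqr ger0_norm // expR_ge0.
Qed.

Lemma enorm_trB x : enorm (B^T *m x) = b * enorm x.
Proof.
rewrite /enorm dotp_mulmxl trmxK mulmxA BB mul_scalar_mx dotpZr.
by rewrite sqrtrM ?sqr_ge0 // sqrtr_sqr gtr0_norm.
Qed.

(** Why [x] can be its own adjoint: the output is a positive multiple of [B^T] applied to the free
    trajectory [E(t) x]. *)
Lemma obs_isotropic x t :
  obs A B (- t) x = expR (- (2 * a) * t) *: (B^T *m (expmx A t *m x)).
Proof.
rewrite /obs expmx_tr opprK -scalemxAl -scalemxAr; congr (expR _ *: _); ring.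
Qed.

Lemma enorm_obs_isotropic x t :
  enorm (obs A B (- t) x) = b * enorm x * expR (- a * t).
Proof.
rewrite obs_isotropic enormZ ger0_norm ?expR_ge0 // enorm_trB enorm_expmx.
rewrite (_ : - a * t = - (2 * a) * t + a * t); last by ring.
by rewrite expRD; ring.
Qed.

Lemma dotp_obs_isotropic p x t :
  dotp (obs A B (- t) p) (obs A B (- t) x) = (b * expR (- a * t)) ^+ 2 * dotp p x.
Proof.
rewrite !obs_isotropic dotpZl dotpZr dotp_mulmxl trmxK mulmxA BB mul_scalar_mx.
rewrite dotpZr dotp_mulmxl mulmxA expmx_tr_mul mul_scalar_mx dotpZr.
rewrite (_ : - a * t = - (2 * a) * t + a * t); last by ring.
rewrite (_ : 2 * a * t = a * t + a * t); last by ring.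
by rewrite !expRD; ring.
Qed.

Section Trajectory.
Variables (x : 'cV[R]_n).
Hypothesis x0 : x != 0.

Let T := arrival b a (enorm x).
Let T0 : 0 < T.
Proof. exact: arrival_gt0 (enorm_gt0 x0). Qed.
Let k t := obs A B (- t) x.
(** Switching time [T] and coefficient 1: the control is aligned with [x] on all of []0, T]]. *)
Let u := switch k T T.

Let ck i : continuous (fun s => k s i 0).
Proof. exact: (@continuous_obs_oppc _ _ _ A B x i). Qed.

Let k0 t : 0 <= t <= T -> k t != 0.
Proof.
move=> _; apply/eqP => kt; have := enorm_obs_isotropic x t; rewrite -/(k t) kt enorm0.
by apply/eqP; rewrite lt_eqF // mulr_gt0 ?expR_gt0 // mulr_gt0 ?enorm_gt0.
Qed.

Let pk t : obs A B (- t) x = 1 *: k t.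
Proof. by rewrite scale1r. Qed.

Let chip t : 0 < t < T -> 0 < (1 : R).
Proof. by []. Qed.

Let chin t : T < t < T -> (1 : R) < 0.
Proof. by move=> /andP[Tt /(lt_trans Tt)]; rewrite ltxx. Qed.

Let cu : clean u.
Proof. exact: clean_switch. Qed.

(** Against any [p] the integrand is [- b exp(- a s) <p, x> / |x|], so the drift stays on the line
    through [x]; [arrivalK] makes it [- x] at [T]. *)
Lemma drift_isotropic S : 0 <= S -> S <= T ->
  drift A B u S = - ((b * travel a S / enorm x) *: x).
Proof.
move=> S0 ST; have ex := enorm_gt0 x0; apply: dotp_inj => p; rewrite dotp_drift //.
have le : locbm (fun s => - (b / enorm x * dotp p x * expR (- a * s))).
  apply: locbmN; apply: locbmZ; apply: continuous_locbm => s.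
  apply: (@continuous_comp R R R (fun s => - a * s) expR).
    exact: (@mulrl_continuous R (- a) s).
  exact: continuous_expR.
transitivity (intg (fun s => - (b / enorm x * dotp p x * expR (- a * s))) 0 S).
  apply: intg_ae.
  - by apply: measurable_funTS; case: (locbm_obs_dotp A B p cu).
  - by apply: measurable_funTS; case: le.
  apply: ae_imp (ae_neq 0) => s s0 /andP[s0' sS].
  have sT := le_trans sS ST.
  rewrite /u /switch lt_neqAle eq_sym s0 s0' sT /= dotpNr /unitv dotpZr.
  rewrite dotp_obs_isotropic enorm_obs_isotropic; congr (- _).
  by field; rewrite !gt_eqF ?expR_gt0.
have lx : locbm (fun s => expR (- a * s)).
  apply: continuous_locbm => s.
  apply: (@continuous_comp R R R (fun s => - a * s) expR).
    exact: (@mulrl_continuous R (- a) s).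
  exact: continuous_expR.
rewrite intgN; last exact: locbmZ.
rewrite intgZ // -travelE // dotpNr dotpZr; congr (- _); by field; rewrite gt_eqF.
Qed.

Let xE : - drift A B u T = x.
Proof.
rewrite drift_isotropic ?(ltW T0) // opprK arrivalK ?enorm_ge0 // divff ?scale1r //.
by rewrite gt_eqF // enorm_gt0.
Qed.

Lemma Topt_isotropic : Topt A B 0 x = T.
Proof. by have := switch_Topt ck k0 T0 (lexx T) pk chip chin; rewrite xE. Qed.

Lemma u_star_isotropic : {ae (@lebesgue_measure R), forall t, 0 < t < T ->
  u_star A B 0 x t = u t}.
Proof. by have := u_star_switch ck k0 T0 (lexx T) pk chip chin; rewrite xE. Qed.

Lemma is_u_star_isotropic : is_u_star A B 0 x (u_star A B 0 x).
Proof.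
by have := is_u_star_switch ck k0 T0 (lexx T) pk chip chin; rewrite xE => /is_u_star_u_star.
Qed.

Lemma z_star_isotropic t : 0 <= t -> t <= T ->
  z_star A B 0 x t = (1 - b * travel a t / enorm x) *: (expmx A t *m x).
Proof.
move=> t0 tT; have [[au _] _ uo] := is_u_star_isotropic.
(* The chosen control agrees with [u] almost everywhere before [T], and both vanish after [T]. *)
rewrite /z_star (state_ae A B x au (clean_admissible cu)); last first.
  apply: ae_imp2 u_star_isotropic (ae_neq T) => s us sT s0.
  have [lt|gt|sE] := ltgtP s T; [by rewrite us // s0|..]; last by rewrite sE eqxx in sT.
  rewrite uo ?Topt_isotropic; last by rewrite s0 /= -ltNge.
  by rewrite /u /switch leNgt gt andbF.
rewrite stateE // /resp drift_isotropic // scalemxAr; congr (_ *m _).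
by rewrite scalerBl scale1r.
Qed.

Lemma feedback_isotropic : {ae (@lebesgue_measure R), forall t, 0 < t < T ->
  u_star A B 0 x t = - ((b * enorm (z_star A B 0 x t))^-1 *: (B^T *m z_star A B 0 x t))}.
Proof.
apply: ae_imp u_star_isotropic => t ut tT; rewrite ut //.
have /andP[t0 tT'] := tT; have ex := enorm_gt0 x0.
rewrite z_star_isotropic ?(ltW t0) ?(ltW tT') // -enorm_trB -/(unitv _).
(* The scalar is positive since [|x| = b * travel T] and [travel t < travel T]. *)
rewrite -scalemxAr unitvZ; last first.
  rewrite subr_gt0 ltr_pdivrMr // mul1r -[ltRHS](@arrivalK _ b a) ?enorm_ge0 //.
  by rewrite ltr_pM2l // travel_lt // ltW.
rewrite /u /switch t0 (ltW tT') /= /k obs_isotropic unitvZ //.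
exact: expR_gt0.
Qed.

End Trajectory.

Lemma V0_isotropic : V0 A B = fun x => arrival b a (enorm x).
Proof.
apply/funext => x; rewrite /V0; case: eqVneq => [->|x0].
  by rewrite enorm0 arrival0.
exact: Topt_isotropic.
Qed.

Lemma elipschitz_V0 : elipschitz (V0 A B).
Proof.
exists b^-1 => x y; rewrite V0_isotropic.
apply: le_trans (arrival_lipschitz b0 a0 (enorm_ge0 x) (enorm_ge0 y)) _.
by rewrite ler_wpM2l ?invr_ge0 ?(ltW b0) // enormB_dist.
Qed.

Lemma smooth_V0 : smooth_on [set x | x != 0] (V0 A B).
Proof.
rewrite V0_isotropic; apply: (smooth_on_radial_class b0 a0).
exact: RadialArrival.
Qed.

Lemma grad_V0 x : x != 0 ->
  grad (V0 A B) x = ((b - a * enorm x)^-1 * (enorm x)^-1) *: x.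
Proof.
move=> x0; apply/matrixP => i j; rewrite (ord1 j) !mxE /partial V0_isotropic.
have [_ ->] := is_derive_arrival_enorm b0 a0 i x0.
by rewrite mulrA mulrAC.
Qed.

Lemma dotp_A x : dotp x (A *m x) = a * dotp x x.
Proof.
have h : dotp x ((A + A^T) *m x) = 2 * a * dotp x x.
  by rewrite AA mul_scalar_mx dotpZr.
move: h; rewrite mulmxDl dotpDr [X in _ + X]dotp_mulmxr trmxK [X in _ + X]dotpC; lra.
Qed.

(** The gradient is radial, so [A] enters only through [<x, A x> = a |x|^2]. In this form a pairing
    equal to -1 visibly gives the value -1. *)
Lemma hamiltonian_isotropic x v : x != 0 -> hamiltonian A B x v =
  (b - a * enorm x)^-1 * (a * enorm x + dotp (unitv (B^T *m x)) v * b).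
Proof.
move=> x0; have ex := enorm_gt0 x0.
have s0 := speed_gt0 b0 a0 x.
rewrite /hamiltonian grad_V0 // dotpZl dotpDr dotp_A dotp_mulmxr /unitv dotpZl.
rewrite enorm_trB -sqr_enorm; field.
by rewrite !gt_eqF.
Qed.

Let w x : 'cV[R]_m := - unitv (B^T *m x).

Let Bx0 x : x != 0 -> B^T *m x != 0.
Proof.
move=> x0; apply/eqP => Bx; have := enorm_trB x; rewrite Bx enorm0.
by apply/eqP; rewrite lt_eqF // mulr_gt0 // enorm_gt0.
Qed.

Lemma hamiltonian_min x v : x != 0 -> uball v -> -1 <= hamiltonian A B x v.
Proof.
move=> x0 v1; have ex := enorm_gt0 x0.
have s0 := speed_gt0 b0 a0 x.
rewrite hamiltonian_isotropic // mulrC ler_pdivlMr //.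
have := dotp_le_unit_ball (unitv (B^T *m x)) v1.
rewrite enorm_unitv ?Bx0 // => h.
have : 0 <= (dotp (unitv (B^T *m x)) v + 1) * b by rewrite mulr_ge0 // ltW.
lra.
Qed.

Lemma hamiltonian_unitv x : x != 0 -> hamiltonian A B x (w x) = -1.
Proof.
move=> x0; have s0 := speed_gt0 b0 a0 x.
rewrite hamiltonian_isotropic // dotpNr -sqr_enorm enorm_unitv ?Bx0 // expr1n.
by field; rewrite gt_eqF.
Qed.

Lemma hamiltonian_is_min x : x != 0 -> is_min (-1) uball (hamiltonian A B x).
Proof.
move=> x0; split.
  exists (w x); last exact: hamiltonian_unitv.
  by rewrite /uball /= enormN enorm_unitv_le1.
by move=> _ [v v1 <-]; exact: hamiltonian_min.
Qed.

Lemma unique_minimizer_isotropic x : x != 0 ->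
  unique_minimizer uball (hamiltonian A B x) (w x).
Proof.
move=> x0; have s0 := speed_gt0 b0 a0 x.
have w1 : uball (w x) by rewrite /uball /= enormN enorm_unitv_le1.
split.
  by split=> // v v1; rewrite hamiltonian_unitv // hamiltonian_min.
move=> v [v1 /(_ _ w1)]; rewrite hamiltonian_unitv // => hv.
have {}hv : hamiltonian A B x v = -1.
  by apply/eqP; rewrite eq_le hv hamiltonian_min.
have : dotp (unitv (B^T *m x)) v + enorm (unitv (B^T *m x)) = 0.
  rewrite enorm_unitv ?Bx0 //; move: hv; rewrite hamiltonian_isotropic // => hv.
  have : (dotp (unitv (B^T *m x)) v + 1) * b = 0.
    move/(congr1 (fun y => (b - a * enorm x) * y)): hv.
    rewrite mulrA divff ?mul1r; last by rewrite gt_eqF.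
    lra.
  by move/eqP; rewrite mulf_eq0 (gt_eqF b0) orbF => /eqP.
move=> /(dotp_unit_ball_eq v1); rewrite enorm_unitv ?Bx0 // scale1r.
exact.
Qed.

Lemma Kopt_isotropic : (0 < n)%N -> Kopt B = w.
Proof.
move=> n0; have nb : beta B = b ^+ 2.
  by rewrite /beta BB mxtrace_scalar -[X in X / _]mulr_natr mulfK // pnatr_eq0 -lt0n.
apply/funext => x; rewrite /Kopt /w /unitv nb sqrtr_sqr gtr0_norm //.
by rewrite enorm_trB.
Qed.

Lemma feedback_along_isotropic : (0 < n)%N -> optimal_feedback A B (Kopt B).
Proof.
move=> n0 x x0; rewrite /feedback_along Topt_isotropic //.
have := feedback_isotropic x0; rewrite Kopt_isotropic //.
by apply: ae_imp => t h /h ->; rewrite /w /unitv enorm_trB.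
Qed.

End Isotropic.

(** * Radial minimum-time functions *)

Section RadialValue.
Context {R : realType} {n m : nat}.
Variables (A : 'M[R]_n) (B : 'M[R]_(n, m)).
Implicit Types (x p q : 'cV[R]_n) (s t : R).

(** Polarization, then evaluation on basis vectors. *)
Lemma symmetric_scalar_mx (Q : 'M[R]_n) c : Q^T = Q ->
  (forall p, dotp p (Q *m p) = c * dotp p p) -> Q = c%:M.
Proof.
move=> sQ hQ.
have pol p q : dotp p (Q *m q) = c * dotp p q.
  have := hQ (p + q); rewrite mulmxDr !dotpDl !dotpDr !hQ.
  rewrite [dotp q (Q *m p)]dotp_mulmxr sQ [dotp (Q *m q) p]dotpC (dotpC q p); lra.
apply/matrixP => i j; have := pol (delta_mx i 0) (delta_mx j 0).
by rewrite !dotp_deltal -colE !mxE eqxx andbT mulr_natr.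
Qed.

(** The identities derived from condition (c) hold for [s >= 0] only, since integrals start at 0. *)
Lemma one_sided_derive_eq0 (f : R -> R) df : is_derive (0 : R) (1 : R) f df ->
  (forall s, 0 <= s -> f s = 0) -> df = 0.
Proof.
move=> [df1 <-] f0.
have h : h^-1 *: (f (h *: 1 + 0) - f 0) @[h --> (0 : R)^'+] --> 'D_1 f 0.
  exact: cvg_dnbhs_at_right df1.
apply: (cvg_unique _ h) => //.
have : (fun=> 0 : R) h @[h --> (0 : R)^'+] --> (0 : R) by exact: cvg_cst.
apply: cvg_trans; apply: near_eq_cvg; near=> e.
have e0 : 0 < e by near: e; exact: nbhs_right_gt.
by rewrite !f0 ?subrr ?scaler0 // addr0 /GRing.scale /= mulr1 ltW.
Unshelve. all: by end_near. Qed.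

Lemma intg_eq0_continuous (f : R -> R) : continuous f ->
  (forall t, 0 <= t -> intg f 0 t = 0) -> forall s, 0 <= s -> f s = 0.
Proof.
have pos (g : R -> R) s : continuous g -> (forall t, 0 <= t -> intg g 0 t = 0) ->
    0 <= s -> ~ 0 < g s.
  move=> cg ig s0 gs; have lg := continuous_locbm cg.
  have : \forall r \near s, 0 < g r.
    by have := @cvgr_gt R _ (nbhs s) _ _ (g s) (cg s); apply.
  move=> /nbhs_ballP[e /= e0 he].
  have se : s < s + e / 2 by rewrite ltrDl divr_gt0.
  have : 0 < intg g s (s + e / 2).
    apply: (intg_gt0 (c := s)) => //; last by rewrite lexx ltW.
    move=> r /andP[sr re]; apply/ltW/he; rewrite /ball /= ltr_norml.
    by apply/andP; split; lra.
  have := intg_cat lg s0 (ltW se); rewrite !ig //; last by rewrite (le_trans s0) // ltW.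
  by rewrite add0r => ->; rewrite ltxx.
move=> cf if0 s s0; have [lt|gt|] := ltgtP (f s) 0 => //; exfalso; last first.
  exact: (pos f s).
have lf := continuous_locbm cf.
apply: (pos (fun r => - f r) s) => //; last by rewrite oppr_gt0.
  by move=> r; exact: (@continuousN _ R^o _ f r (cf r)).
by move=> t t0; rewrite intgN // if0 // oppr0.
Qed.

(** The separating functional is [x] itself: any reaching time [S] has [f S <= 0], whereas [f] is
    continuous with [f 0 = |x| (|x| - eps) > 0]. *)
Lemma reach_times_lb eps x : 0 <= eps -> eps < enorm x ->
  exists2 d, 0 < d & lbound (reach_times A B eps x) d.
Proof.
move=> e0 ex; have x0 := le_lt_trans e0 ex.
pose f S := dotp x x + (- 1 * hsupp A B x S + - eps * enorm ((expmx A (- S))^T *m x)).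
have cf : {for 0, continuous f}.
  apply: continuous_at_add; first exact: continuous_at_cst.
  apply: continuous_at_add.
    apply: continuous_at_mul; first exact: continuous_at_cst.
    exact: (continuous_intg (locbm_enorm_obs A B x)).
  apply: continuous_at_mul; first exact: continuous_at_cst.
  apply: (@continuous_enorm _ R _ (fun S => (expmx A (- S))^T *m x)) => i.
  apply: (@continuous_mulmx _ R _ _ _ (fun S => (expmx A (- S))^T) (fun=> x)) => j l.
    rewrite (_ : (fun y => _) = fun S => expmx A (- S) l j).
      exact: (continuous_oppc (@continuous_expmx _ _ A l j)).
    by apply/funext => S; rewrite mxE.
  exact: continuous_at_cst.
have f0 : 0 < f 0.
  rewrite /f /hsupp intg_point oppr0 expmx0 trmx1 mul1mx -sqr_enorm mulr0 add0r mulNr.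
  by rewrite subr_gt0 expr2 ltr_pM2r.
have : \forall S \near (0 : R), 0 < f S.
  by have := @cvgr_gt R _ (nbhs (0 : R)) _ _ (f 0) cf; apply.
move=> /nbhs_ballP[d /= d0 hd]; exists d => // S /reach_timesP[S0 [u cu uS]].
rewrite leNgt; apply/negP => Sd.
have : 0 < f S by apply: hd; rewrite /ball /= sub0r normrN gtr0_norm.
have := dotp_le_hsuppD A B x x S cu; rewrite dotp_mulmxr => h1.
have h2 := dotp_le ((expmx A (- S))^T *m x) (resp A B x u S).
have h3 : enorm ((expmx A (- S))^T *m x) * enorm (resp A B x u S) <=
    enorm ((expmx A (- S))^T *m x) * eps by rewrite ler_wpM2l // enorm_ge0.
rewrite /f; lra.
Qed.

Hypothesis cc : cond_c A B.

(** Steering along [p] gives a point [x] with [hsupp p t = <p, x> <= |x|] and [V0 x <= t]. Radiality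
    gives [|x| q] the same minimum time, and pairing it with [q] yields [|x| <= hsupp q t]. *)
Lemma cond_c_hsupp_le p q t : enorm p = 1 -> enorm q = 1 -> 0 < t ->
  hsupp A B p t <= hsupp A B q t.
Proof.
move=> p1 q1 t0; have [Psi [_ _ hPsi]] := cc.
pose u s := - unitv (obs A B (- s) p).
have cu : clean u.
  split=> [i|s]; last by rewrite enormN enorm_unitv_le1.
  rewrite (_ : (fun s => _) = fun s => - (unitv (obs A B (- s) p) i 0)); last first.
    by apply/funext => s; rewrite mxE.
  apply: (measurableT_comp _ (@measurable_unitv _ _ (fun s => obs A B (- s) p) _ _)).
    by [].
  move=> j; exact: (@continuous_obs_oppc _ _ _ A B p j).
pose x := - drift A B u t.
have xt : resp A B x u t = 0 by rewrite /resp addNr mulmx0.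
have px : dotp p x = hsupp A B p t.
  rewrite dotpNr dotp_drift // -intgN; last exact: locbm_obs_dotp.
  by apply: eq_intg => s _; rewrite dotpNr opprK dotp_unitv.
have xr : reach_times A B 0 x t.
  by apply/reach_timesP; split=> //; exists u => //; rewrite xt enorm0.
have hx : hsupp A B p t <= enorm x.
  by rewrite -px (le_trans (dotp_le _ _)) // p1 mul1r.
have [x0|x0] := eqVneq x 0.
  rewrite -px x0 dotp0r; apply: intg_ge0 => s _; exact: enorm_ge0.
have [d d0 hd] := reach_times_lb (lexx 0) (enorm_gt0 x0).
have hl (y : 'cV[R]_n) : has_lbound (reach_times A B 0 y) by exists 0 => S [/ltW].
have Vx0 : 0 < V0 A B x.
  by rewrite /V0 (negbTE x0) (lt_le_trans d0) // lb_le_inf //; exists t.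
have Vxt : V0 A B x <= t.
  by rewrite /V0 (negbTE x0); exact: (ge_inf (hl x)).
pose y := enorm x *: q.
have Vy : V0 A B y = V0 A B x.
  by rewrite !hPsi enormZ q1 mulr1 ger0_norm // enorm_ge0.
have y0 : y != 0.
  rewrite scaler_eq0 negb_or gt_eqF ?enorm_gt0 //=.
  apply/eqP => q00; move: q1; rewrite q00 enorm0 => /eqP.
  by rewrite eq_sym oner_eq0.
have Ty : V0 A B y = Topt A B 0 y by rewrite /V0 (negbTE y0).
(* An empty set would have infimum 0 by convention, against [V0 y = V0 x > 0]. *)
have ny : reach_times A B 0 y !=set0.
  apply/set0P; apply: contraTneq Vx0 => e; rewrite -Vy Ty /Topt e inf0 ltxx //.
(* The infimum is only approached, which costs [e]; continuity of [hsupp q] removes it below. *)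
have key e : 0 < e -> enorm x <= hsupp A B q (t + e).
  move=> e0; have [S Sr Se] := inf_adherent e0 (conj ny (hl y)).
  have /reach_timesP[S0 [v cv vS]] := Sr.
  have /enorm_eq0 v0 : enorm (resp A B y v S) = 0.
    by apply/eqP; rewrite eq_le vS enorm_ge0.
  have := dotp_le_hsupp q cv v0; rewrite dotpZr -sqr_enorm q1 expr1n mulr1 => h.
  apply: (le_trans h); apply: hsupp_le; first exact: ltW.
  apply/ltW/(lt_le_trans Se); rewrite lerD2r.
  by rewrite -/(Topt A B 0 y) -Ty Vy.
apply: (le_trans hx); rewrite leNgt; apply/negP => lt.
have ch : continuous (hsupp A B q).
  exact: (continuous_intg (locbm_enorm_obs A B q)).
have : \forall s \near t, hsupp A B q s < enorm x.
  by have := @cvgr_lt R _ (nbhs t) _ _ (hsupp A B q t) (ch t); apply.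
move=> /nbhs_ballP[e /= e0 he].
have := key (e / 2) (divr_gt0 e0 (ltr0Sn _ 1)).
rewrite leNgt he // /ball /= (_ : t - (t + e / 2) = - (e / 2)); last by ring.
by rewrite normrN gtr0_norm ?divr_gt0 // ltr_pdivrMr // mulr_natr mulr2n ltrDl.
Qed.

(** Exchanging [p] and [q] makes the support functions equal at every time, hence also their
    continuous integrands. *)
Lemma cond_c_obs p q s : enorm p = 1 -> enorm q = 1 -> 0 <= s ->
  enorm (obs A B (- s) p) = enorm (obs A B (- s) q).
Proof.
move=> p1 q1 s0; apply/eqP; rewrite -subr_eq0; apply/eqP.
apply: (intg_eq0_continuous (f := fun s =>
  enorm (obs A B (- s) p) - enorm (obs A B (- s) q))) s0.
  move=> t; apply: (@continuous_at_sub R R (fun s => enorm (obs A B (- s) p))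
    (fun s => enorm (obs A B (- s) q))); exact: continuous_enorm_obs.
move=> t; rewrite le_eqVlt => /predU1P[<-|t0]; first by rewrite intg_point.
rewrite intgB; try exact: locbm_enorm_obs.
apply/eqP; rewrite subr_eq0 eq_le; apply/andP.
by split; exact: cond_c_hsupp_le.
Qed.

Hypothesis n0 : (0 < n)%N.
Hypothesis B0 : B != 0.

Lemma cond_c_isotropic : exists b a, [/\ 0 < b, B *m B^T = (b ^+ 2)%:M &
  A + A^T = (2 * a)%:M].
Proof.
pose i0 := Ordinal n0; pose p0 : 'cV[R]_n := delta_mx i0 0.
have p01 : enorm p0 = 1.
  rewrite /enorm /dotp (bigD1 i0) //= big1 => [|j ji].
    by rewrite mxE !eqxx addr0 mulr1 sqrtr1.
  by rewrite mxE (negbTE ji) mul0r.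
pose k s := enorm (obs A B (- s) p0) ^+ 2.
(* The quadratic form of this symmetric matrix is [|obs (- s) p|^2], which depends on [|p|] only. *)
have Q s : 0 <= s -> expmx A (- s) *m (B *m B^T) *m (expmx A (- s))^T = (k s)%:M.
  move=> s0; apply: symmetric_scalar_mx.
    by rewrite !trmx_mul !trmxK !mulmxA.
  move=> p; have [->|p0n] := eqVneq p 0; first by rewrite !dotp0l mulr0.
  have -> : dotp p (expmx A (- s) *m (B *m B^T) *m (expmx A (- s))^T *m p) =
      enorm (obs A B (- s) p) ^+ 2.
    by rewrite sqr_enorm /obs dotp_mulmxl trmxK dotp_mulmxl trmxK !mulmxA.
  rewrite -{1}[p]unitvK.
  have -> : obs A B (- s) (enorm p *: unitv p) = enorm p *: obs A B (- s) (unitv p).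
    by rewrite /obs -!scalemxAr.
  rewrite enormZ ger0_norm ?enorm_ge0 // exprMn -(sqr_enorm p) mulrC; congr (_ * _).
  by rewrite (@cond_c_obs (unitv p) p0) // enorm_unitv.
have := Q 0 (lexx 0); rewrite oppr0 expmx0 trmx1 mul1mx mulmx1 => BB.
have k00 : k 0 != 0.
  apply: contra B0 => /eqP k00; rewrite k00 in BB.
  apply/eqP/trmx_inj; rewrite trmx0.
  apply/matrixP => i j; have : B^T *m (delta_mx j 0 : 'cV[R]_n) = 0.
    apply: dotp_eq0; rewrite dotp_mulmxl trmxK mulmxA BB.
    by rewrite mul_scalar_mx scale0r dotp0r.
  by move=> /matrixP /(_ i 0); rewrite -colE !mxE.
pose b := enorm (obs A B (- 0) p0).
have b0 : 0 < b.
  rewrite lt_neqAle enorm_ge0 andbT eq_sym.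
  by apply: contra k00 => /eqP; rewrite /k /b => ->; rewrite expr0n.
(* Entries of [E(-s) E(-s)^T]: at 0 their derivative is [- (A + A^T)], and [Q] says that they form a
   scalar matrix. *)
pose G i j s := \sum_l expmx A (- s) i l * expmx A (- s) j l.
have GE i j s : 0 <= s -> G i j s = (k s / k 0) *+ (i == j).
  move=> s0; have := Q s s0; rewrite BB mul_mx_scalar -scalemxAl.
  move=> /matrixP /(_ i j); rewrite !mxE => h.
  have : k 0 * G i j s = k s *+ (i == j).
    rewrite -h; congr (_ * _); apply: eq_bigr => l _.
    by rewrite [_^T _ _]mxE.
  by move=> /(congr1 (fun y => (k 0)^-1 * y)); rewrite mulKf // mulrnAr mulrC.
have dG i j : is_derive (0 : R) (1 : R) (G i j) (- (A + A^T) i j).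
  apply: is_derive_eq.
    apply: is_derive_bigsum => l; apply: is_derive_mul.
      exact: is_derive_oppc (is_derive_expmx _ _ _ _).
    exact: is_derive_oppc (is_derive_expmx _ _ _ _).
  rewrite !oppr0 !expmx0 mulmx1 big_split /= [in RHS]mxE opprD; congr (_ + _).
    rewrite (bigD1 j) //= big1 => [|l lj].
      by rewrite mxE eqxx mulr1 addr0.
    by rewrite [X in _ * X]mxE eq_sym (negbTE lj) mulr0.
  rewrite (bigD1 i) //= big1 => [|l li].
    by rewrite [X in X * _]mxE eqxx mul1r addr0 mxE.
  by rewrite [X in X * _]mxE eq_sym (negbTE li) mul0r.
exists b, ((A + A^T) i0 i0 / 2); split=> //.
apply/matrixP => i j; rewrite [RHS]mxE mulrC divfK //.
have [<-|ij] := eqVneq i j.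
  (* Subtracting two diagonal entries cancels [k s / k 0], so [k] itself is never differentiated. *)
  have := is_derive_add (dG i i) (is_derive_mul (is_derive_cst_fun (-1) (0 : R) 1) (dG i0 i0)).
  move=> /one_sided_derive_eq0 h; rewrite mulr1n.
  have {}h := h _.
  suff : - (A + A^T) i i + (0 * G i0 i0 0 + -1 * - (A + A^T) i0 i0) = 0 by lra.
  by apply: h => s s0; rewrite !GE // !eqxx !mulr1n mulN1r subrr.
rewrite mulr0n; apply/eqP; rewrite -oppr_eq0; apply/eqP.
apply: one_sided_derive_eq0 (dG i j) _ => s s0.
by rewrite GE // (negbTE ij).
Qed.

End RadialValue.

(** * The sign of the symmetric part *)

Section Spectrum.
Context {R : realType} {n : nat}.
Variables (A : 'M[R]_n) (a : R).

(** For the real and imaginary parts [v1], [v2] of an eigenvector, the sum of [<vi, A^T vi>] is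
    [a (|v1|^2 + |v2|^2)], and also [Re lam] times the same, as the cross terms cancel. Thus
    [a = Re lam]. Eigenvectors are rows, whence [A^T]. *)
Lemma spectrum_symmetric_part : (0 < n)%N -> spectrum_nonpos A ->
  A + A^T = (2 * a)%:M -> a <= 0.
Proof.
move=> n0 specA AA; have [lam lamP] := Theorem7' (map_mx (real_complex R) A) n0.
apply: le_trans (specA lam lamP).
have /eigenvalueP[v vA v0] := lamP.
pose v1 : 'cV[R]_n := \col_j complex.Re (v 0 j).
pose v2 : 'cV[R]_n := \col_j complex.Im (v 0 j).
have [r [s lamE]] : exists r s, lam = (r +i* s)%C.
  by case: lam {vA lamP} => r s; exists r, s.
have e1 : A^T *m v1 = r *: v1 - s *: v2.
  apply/matrixP => j i; rewrite (ord1 i).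
  transitivity (complex.Re ((v *m map_mx (real_complex R) A) 0 j)).
    rewrite !mxE raddf_sum; apply: eq_bigr => k _.
    by rewrite !mxE; case: (v 0 k) => c d /=; rewrite mulr0 subr0 mulrC.
  by rewrite vA lamE !mxE; case: (v 0 j).
have e2 : A^T *m v2 = r *: v2 + s *: v1.
  apply/matrixP => j i; rewrite (ord1 i).
  transitivity (complex.Im ((v *m map_mx (real_complex R) A) 0 j)).
    rewrite !mxE raddf_sum; apply: eq_bigr => k _.
    by rewrite !mxE; case: (v 0 k) => c d /=; rewrite mulr0 add0r mulrC.
  by rewrite vA lamE !mxE; case: (v 0 j).
have AAt : A^T + A^T^T = (2 * a)%:M by rewrite trmxK addrC.
have := dotp_A AAt v1; have := dotp_A AAt v2; rewrite e1 e2.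
rewrite !dotpDr dotpNr !dotpZr (dotpC v2 v1) lamE /= => h2 h1.
have vv : 0 < dotp v1 v1 + dotp v2 v2.
  rewrite lt_neqAle addr_ge0 ?dotp_ge0 // andbT eq_sym.
  apply: contra v0; rewrite paddr_eq0 ?dotp_ge0 // => /andP[/eqP/dotp_eq0 v10 /eqP/dotp_eq0 v20].
  apply/eqP/matrixP => i j; rewrite (ord1 i) [RHS]mxE.
  move/matrixP/(_ j 0): v10; move/matrixP/(_ j 0): v20; rewrite !mxE.
  by case: (v 0 j) => c d /= -> ->.
have : (a - r) * (dotp v1 v1 + dotp v2 v2) = 0 by lra.
by move/eqP; rewrite mulf_eq0 (gt_eqF vv) orbF subr_eq0 => /eqP ->.
Qed.

End Spectrum.

(** * Optimal controls shared with ball targets *)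

Section BallTarget.
Context {R : realType} {n m : nat}.
Variables (A : 'M[R]_n) (B : 'M[R]_(n, m)).
Implicit Types (x p q r : 'cV[R]_n) (s t S T : R) (u v w : R -> 'cV[R]_m).

Local Notation obs := (obs A B).
Local Notation resp := (resp A B).
Local Notation drift := (drift A B).

Lemma ae_itv_ex (P : R -> Prop) a b : a < b ->
  {ae (@lebesgue_measure R), forall t, P t} -> exists2 t, a < t < b & P t.
Proof.
move=> ab [N [mN N0 PN]]; apply: contrapT => nP.
have sub : `]a, b[%classic `<=` N.
  move=> t /=; rewrite in_itv /= => tab; apply: PN => /= Pt.
  by apply: nP; exists t.
have h2 : (lebesgue_measure N <= 0)%E by rewrite N0.
have := @le_measure _ _ _ (@lebesgue_measure R) `]a, b[%classic N.
rewrite !inE => /(_ (measurable_itv _) mN sub) /le_trans/(_ h2) h3.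
have := lebesgue_measure_itv `]a, b[; rewrite /= lte_fin ab -EFinD => h4.
have : ((b - a)%:E <= 0)%E by rewrite -h4; exact: h3.
by rewrite lee_fin leNgt subr_gt0 ab.
Qed.

Lemma ae_eq0_continuous (f : R -> R) a b : continuous f ->
  {ae (@lebesgue_measure R), forall t, a < t < b -> f t = 0} ->
  a < b -> forall t, a <= t <= b -> f t = 0.
Proof.
move=> cf fae ab t /andP[at_ tb]; apply/eqP; apply: contrapT => /negP ft.
have : \forall s \near t, f s != 0.
  by have := @cvgr_neq0 _ _ _ (nbhs t) _ _ (f t) (cf t) ft; apply.
move=> /nbhs_ballP[e /= e0 he].
pose c1 := Num.max a (t - e / 2); pose c2 := Num.min b (t + e / 2).
have c1c2 : c1 < c2.
  by rewrite /c1 /c2 gt_max !lt_min; apply/andP; split; apply/andP; split; lra.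
have [s /andP[sc1 sc2] hs] := ae_itv_ex c1c2 fae.
move: sc1 sc2; rewrite gt_max lt_min => /andP[as_ s1] /andP[sb s2].
have /eqP := hs ltac:(by rewrite as_).
apply/negP/he; rewrite /ball /= ltr_norml; apply/andP; split; lra.
Qed.

Lemma obsD s t p : obs s ((expmx A t)^T *m p) = obs (s + t) p.
Proof.
by rewrite !obsE [X in _ *m X]mulmxA -trmx_mul -expmxD addrC.
Qed.

Lemma resp_convex x w v (l : R) t : clean w -> clean v ->
  clean (fun s => (1 - l) *: w s + l *: v s) ->
  resp x (fun s => (1 - l) *: w s + l *: v s) t =
  (1 - l) *: resp x w t + l *: resp x v t.
Proof.
move=> cw cv cl; rewrite !respE !scalemxAr -mulmxDr; congr (_ *m _).
have -> : drift (fun s => (1 - l) *: w s + l *: v s) t =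
    (1 - l) *: drift w t + l *: drift v t.
  apply: dotp_inj => p; rewrite dotpDr !dotpZr !dotp_drift //.
  have lw := locbm_obs_dotp A B p cw; have lv := locbm_obs_dotp A B p cv.
  rewrite -!intgZ // -intgD; try exact: locbmZ.
  by apply: eq_intg => s _; rewrite dotpDr !dotpZr.
by rewrite !scalerDr addrACA -scalerDl subrK scale1r.
Qed.

Lemma clean_convex w v (l : R) : 0 <= l <= 1 -> clean w -> clean v ->
  clean (fun s => (1 - l) *: w s + l *: v s).
Proof.
move=> /andP[l0 l1] [mw bw] [mv bv]; split=> [i|s].
  rewrite (_ : (fun s => _) = fun s => (1 - l) * w s i 0 + l * v s i 0).
    by apply: measurable_funD; exact: measurable_funM.
  by apply/funext => s; rewrite !mxE.
rewrite (le_trans (enormD _ _)) // !enormZ !ger0_norm ?subr_ge0 //.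
have := bw s; have := bv s => h1 h2.
have : (1 - l) * enorm (w s) <= (1 - l) * 1 by rewrite ler_wpM2l // subr_ge0.
have : l * enorm (v s) <= l * 1 by rewrite ler_wpM2l.
lra.
Qed.

Lemma enorm_resp_continuous x w : clean w -> continuous (fun t => enorm (resp x w t)).
Proof.
move=> cw t; apply: (@continuous_enorm _ R _ (fun t => resp x w t)) => i.
exact: continuous_resp.
Qed.

Lemma Topt_le eps x w t : clean w -> 0 < t -> enorm (resp x w t) <= eps ->
  Topt A B eps x <= t.
Proof.
move=> cw t0 wt; apply: ge_inf; first by exists 0 => S [/ltW].
by apply/reach_timesP; split=> //; exists w.
Qed.

(** By continuity, a trajectory in the open ball at [t] was already in the closed ball slightly
    earlier. *)
Lemma Topt_lt eps x w t : clean w -> 0 < t -> enorm (resp x w t) < eps ->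
  Topt A B eps x < t.
Proof.
move=> cw t0 wt.
have : \forall s \near t, enorm (resp x w s) < eps.
  by have := @cvgr_lt R _ (nbhs t) _ _ (enorm (resp x w t))
    (@enorm_resp_continuous x w cw t); apply.
move=> /nbhs_ballP[e /= e0 he].
pose S := Num.max (t / 2) (t - e / 2).
have St : S < t by rewrite gt_max; apply/andP; split; lra.
have S0 : 0 < S by rewrite lt_max divr_gt0.
have Se : t - e / 2 <= S by rewrite le_max lexx orbT.
apply: (le_lt_trans _ St); apply: (Topt_le cw S0); apply/ltW/he.
by rewrite /ball /= gtr0_norm ?subr_gt0 //; lra.
Qed.

Lemma small_quadratic_lt0 (D d : R) : D < 0 -> 0 <= d ->
  exists l, [/\ 0 < l, l <= 1 & l * D + (l * D + l * (l * d)) < 0].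
Proof.
move=> D0 d0; have d1 : 0 < d + 1 by lra.
(* This [l] gives [l d < - D], so the first-order term wins; [d + 1] avoids dividing by a vanishing
   [d]. *)
have l0 : 0 < Num.min 1 (- D / (d + 1)).
  by rewrite lt_min ltr01 divr_gt0 ?oppr_gt0.
have ld : Num.min 1 (- D / (d + 1)) * (d + 1) <= - D.
  by rewrite -ler_pdivlMr // ge_min lexx orbT.
exists (Num.min 1 (- D / (d + 1))); split=> //; first by rewrite ge_min lexx.
move: l0 ld; generalize (Num.min 1 (- D / (d + 1))) => l l0 ld.
rewrite -!mulrDr pmulr_rlt0 //; nra.
Qed.

(* Otherwise a small convex perturbation towards [v] would enter the open ball
   at time [Topt], hence the closed ball strictly earlier. *)
Lemma ball_variation eps x w v : clean w -> clean v ->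
  0 < Topt A B eps x -> enorm (resp x w (Topt A B eps x)) <= eps ->
  dotp (resp x w (Topt A B eps x)) (resp x w (Topt A B eps x)) <=
  dotp (resp x w (Topt A B eps x)) (resp x v (Topt A B eps x)).
Proof.
move=> cw cv; set S := Topt A B eps x => S0 wS; rewrite leNgt; apply/negP => lt.
pose y := resp x w S; pose d := resp x v S - y.
have D0 : dotp y d < 0 by rewrite dotpDr dotpNr subr_lt0.

have [l [l0 l1 ld]] := small_quadratic_lt0 D0 (dotp_ge0 d).
have cl : clean (fun s => (1 - l) *: w s + l *: v s).
  by apply: clean_convex => //; rewrite (ltW l0).
have e0 : 0 <= eps by apply: le_trans wS; exact: enorm_ge0.
have : Topt A B eps x < S; last by rewrite ltxx.
apply: (Topt_lt cl S0); rewrite (resp_convex _ _ cw cv cl).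
have -> : (1 - l) *: resp x w S + l *: resp x v S = y + l *: d.
  by rewrite /d scalerBr scalerBl scale1r -addrA (addrC (- _)).
apply: lt_le_trans wS; rewrite -/y.
rewrite -(@ltr_pXn2r _ 2) ?nnegrE ?enorm_ge0 // !sqr_enorm.
rewrite dotpDl !dotpDr !dotpZl !dotpZr (dotpC d y) -addrA.
by rewrite gtrDl.
Qed.

Lemma clean_aligned p : clean (fun s => - unitv (obs (- s) p)).
Proof.
split=> [i|s]; last by rewrite enormN enorm_unitv_le1.
rewrite (_ : (fun s => _) = fun s => - (unitv (obs (- s) p) i 0)); last first.
  by apply/funext => s; rewrite mxE.
apply: (measurableT_comp _ (@measurable_unitv _ _ (fun s => obs (- s) p) _ _)).
  by [].
move=> j; exact: (@continuous_obs_oppc _ _ _ A B p j).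
Qed.

(** Maximum principle with transversality: the final adjoint is the outward normal [resp x w S],
    pulled back to time 0. By [ball_variation] the optimal [w] pairs with [p] no worse than the
    control aligned with [p], which attains the lower bound. *)
Lemma ball_maximum eps x w S p : clean w -> Topt A B eps x = S ->
  p = (expmx A S)^T *m resp x w S -> 0 < S -> enorm (resp x w S) <= eps ->
  {ae (@lebesgue_measure R), forall t, 0 <= t <= S ->
    enorm (obs (- t) p) *: w t = - obs (- t) p}.
Proof.
move=> cw SE pE S0 wS; have cv := clean_aligned p.
have dp u : dotp (resp x w S) (resp x u S) = dotp p (expmx A (- S) *m resp x u S).
  by rewrite pE dotp_mulmxl trmxK mulmxA expmxNK mul1mx.
have h : dotp p (expmx A (- S) *m resp x w S) <=
    dotp p (expmx A (- S) *m resp x (fun s => - unitv (obs (- s) p)) S).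
  by rewrite -!dp -SE; apply: ball_variation; rewrite ?SE.
have ew := dotp_resp A B x p S cw; have ev := dotp_resp A B x p S cv.
rewrite {}ew {}ev lerD2l in h.
have lw := locbm_obs_dotp A B p cw; have le := locbm_enorm_obs A B p.
have hv : intg (fun s => dotp (obs (- s) p) (- unitv (obs (- s) p))) 0 S =
    - intg (fun s => enorm (obs (- s) p)) 0 S.
  by rewrite -intgN //; apply: eq_intg => s _; rewrite dotpNr dotp_unitv.
rewrite hv in h.
have h0 s : 0 <= dotp (obs (- s) p) (w s) + enorm (obs (- s) p).
  by apply: dotp_le_unit_ball; case: cw.
have e0 : intg (fun s => dotp (obs (- s) p) (w s) + enorm (obs (- s) p)) 0 S = 0.
  apply/eqP; rewrite eq_le intg_ge0 ?andbT //.
  by rewrite intgD // -lerBrDr sub0r.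
have := intg_eq0_ae (locbmD lw le) (fun s _ => h0 s) e0.
by apply: ae_imp => s hs /hs; apply: dotp_unit_ball_eq; case: cw.
Qed.

Lemma resp_local x w v S : clean w -> clean v -> 0 <= S ->
  {ae (@lebesgue_measure R), forall t, 0 < t < S -> w t = v t} ->
  resp x w S = resp x v S.
Proof.
move=> cw cv S0 wv; rewrite !respE; congr (_ *m (_ + _)).
apply: dotp_inj => p; rewrite !dotp_drift //; apply: intg_ae.
- by apply: measurable_funTS; case: (locbm_obs_dotp A B p cw).
- by apply: measurable_funTS; case: (locbm_obs_dotp A B p cv).
apply: ae_imp2 (ae_neq 0) (ae_imp2 _ (ae_neq S) wv); last first.
  by move=> s sS h; exact: (conj sS h).
move=> s s0 [sS h] /andP[s0' sS'].
by rewrite h // !lt_neqAle eq_sym s0 s0' sS.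
Qed.

Lemma dotp_drift_aligned p u r S T : clean u -> aligned A B p u T ->
  0 <= S -> S <= T -> dotp r (drift u S) =
  - intg (fun s => dotp (obs (- s) r) (unitv (obs (- s) p))) 0 S.
Proof.
move=> cu au S0 ST; have cp := clean_aligned p.
have -> : drift u S = drift (fun s => - unitv (obs (- s) p)) S.
  have : {ae (@lebesgue_measure R), forall t, 0 < t < S -> u t = - unitv (obs (- t) p)}.
    by apply: ae_imp au => t h /andP[t0 tS]; rewrite h // t0 (lt_le_trans tS).
  move=> /(resp_local 0 cu cp S0) /(congr1 (mulmx (expmx A (- S)))).
  rewrite !respE !mulmxA; have := expmxNK A (- S); rewrite opprK => ->.
  by rewrite !mul1mx !add0r.
have lp := locbm_obs_dotp A B r cp.
have lq : locbm (fun s => dotp (obs (- s) r) (unitv (obs (- s) p))).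
  by have := locbmN lp; congr locbm; apply/funext => s; rewrite dotpNr opprK.
rewrite (dotp_drift _ _ _ _ cp) -intgN //.
by apply: eq_intg => s _; rewrite dotpNr.
Qed.

End BallTarget.

(** * A control shared by the point and small balls, as the radius tends to 0 *)

Section SharedControls.
Context {R : realType} {n m : nat}.
Variables (A : 'M[R]_n) (B : 'M[R]_(n, m)).
Implicit Types (q r : 'cV[R]_n) (s t S : R).

Local Notation obs := (obs A B).
Local Notation resp := (resp A B).
Local Notation drift := (drift A B).

Lemma resp0 x u : resp x u 0 = x.
Proof.
rewrite !respE expmx0 mul1mx (_ : drift u 0 = 0) ?addr0 //.
by apply/matrixP => i j; rewrite !mxE intg_point.
Qed.

(** The constant branch for [S >= T] turns a left limit of averages into plain continuity at [T]. *)
Lemma continuous_left_average (g : R -> R) T : locbm g -> {for T, continuous g} ->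
  {for T, continuous (fun S => if S < T then intg g S T / (T - S) else g T)}.
Proof.
move=> lg cg; apply/(@cvgrPdist_le _ R^o) => e e0.
have /cvgrPdist_le /(_ e e0) /nbhs_ballP[d /= d0 hd] := cg.
apply/nbhs_ballP; exists d => //= S; rewrite /ball /= ltxx => Sd.
have [ST|TS] := ltP S T; last by rewrite subrr normr0 ltW.
have TS0 : 0 < T - S by rewrite subr_gt0.
have lgc := locbmB (locbm_cst (g T)) lg.
have -> : g T - intg g S T / (T - S) =
    intg (fun s => g T - g s) S T / (T - S).
  rewrite intgB //; last exact: locbm_cst.
  by rewrite intg_cst ?(ltW ST) //; field; rewrite gt_eqF.
rewrite normrM normfV (gtr0_norm TS0) ler_pdivrMr //.
apply: intg_bound => //; first exact: ltW.
move=> s /andP[Ss sT]; apply: hd; rewrite /ball /=.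
move: Sd; rewrite !ger0_norm ?subr_ge0 ?(ltW ST) //.
by apply: le_lt_trans; rewrite lerD2l lerN2.
Qed.

Section Arc.
Variables (p : 'cV[R]_n) (T : R) (u : R -> 'cV[R]_m).
Hypothesis T0 : 0 < T.
Hypothesis cu : clean u.
Hypothesis au : aligned A B p u T.
Hypothesis hT : forall S, 0 <= S -> S < T -> hsupp A B p S < hsupp A B p T.
Hypothesis nz : {ae (@lebesgue_measure R), forall t, 0 < t < T -> obs (- t) p != 0}.
Hypothesis uu : {ae (@lebesgue_measure R), forall t, 0 < t < T ->
  u_star A B 0 (- drift u T) t = u t}.
Hypothesis ca : cond_a A B.

Let x := - drift u T.

Lemma arc_neq0 t : 0 <= t -> t < T -> resp x u t != 0.
Proof.
move=> t0 tT; have x0 : x != 0 := synthesis_neq0 T0 cu au hT.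
move: t0; rewrite le_eqVlt => /predU1P[<-|t0]; first by rewrite resp0.
apply/eqP => rt; have : Topt A B 0 x <= t.
  by apply: (Topt_le cu t0); rewrite rt enorm0.
by rewrite (synthesis_Topt T0 cu au hT) leNgt tT.
Qed.

(** Before [t1] the arc keeps away from 0, so it can enter a smaller ball only after [t1]. *)
Lemma arc_min t1 : 0 <= t1 -> t1 < T -> exists2 c, 0 < c &
  forall t, 0 <= t <= t1 -> c <= enorm (resp x u t).
Proof.
move=> t0 tT; have cw : {within `[0, t1], continuous (fun t => enorm (resp x u t))}.
  by apply: continuous_subspaceT => t; exact: (@enorm_resp_continuous _ _ _ A B x u cu).
have [c] := EVT_min t0 cw.
rewrite in_itv /= => /andP[c0 c1] cmin; exists (enorm (resp x u c)).
  by apply: enorm_gt0; apply: arc_neq0 => //; exact: le_lt_trans tT.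
by move=> t tI; apply: cmin; rewrite in_itv.
Qed.

(** The arc ends at 0, so its position at [S] is what the control still undoes on [[S, T]]. *)
Lemma arc_dotp_resp r S : 0 <= S -> S <= T ->
  dotp r (expmx A (- S) *m resp x u S) =
  intg (fun s => dotp (obs (- s) r) (unitv (obs (- s) p))) S T.
Proof.
move=> S0 ST; rewrite dotp_resp // -dotp_drift // dotpNr.
rewrite !(dotp_drift_aligned _ cu au) ?(ltW T0) // opprK.
have lgr : locbm (fun s => dotp (obs (- s) r) (unitv (obs (- s) p))).
  have := locbmN (locbm_obs_dotp A B r (clean_aligned A B p)).
  by congr locbm; apply/funext => s; rewrite dotpNr opprK.
by rewrite -(intg_cat lgr S0 ST) addrAC subrr add0r.
Qed.

(* For small [eps] the shared control reaches the sphere of radius [eps] at the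
   time [S = Topt eps], shortly before [T]; the maximum principle there forces
   the two adjoints to produce the same control on [0, S]. *)
Lemma shared_adjoint eta : 0 < eta -> exists S, [/\ 0 < S, T - eta < S, S < T &
  forall t, 0 <= t <= S ->
    enorm (obs (- t) ((expmx A S)^T *m resp x u S)) *: obs (- t) p =
    enorm (obs (- t) p) *: obs (- t) ((expmx A S)^T *m resp x u S)].
Proof.
move=> eta0; have x0 : x != 0 := synthesis_neq0 T0 cu au hT.
have [ex /andP[ex0 exx] hex] := ca x0.
pose t1 := Num.max 0 (T - eta).
have t10 : 0 <= t1 by rewrite le_max lexx.
have t1T : t1 < T by rewrite gt_max T0 ltrBlDr ltrDl.
have [c c0 hc] := arc_min t10 t1T.
(* Below [ex] for condition (a), and below [c] so that the ball is hit after [t1], within [eta] of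
   [T]. *)
pose eps := Num.min ex c / 2.
have eps0 : 0 < eps by rewrite divr_gt0 // lt_min ex0.
have epsex : eps < ex.
  apply: (@lt_le_trans _ _ (Num.min ex c)); last by rewrite ge_min lexx.
  by rewrite /eps ltr_pdivrMr // mulr_natr mulr2n ltrDl lt_min ex0.
have epsc : eps < c.
  apply: (@lt_le_trans _ _ (Num.min ex c)); last by rewrite ge_min lexx orbT.
  by rewrite /eps ltr_pdivrMr // mulr_natr mulr2n ltrDl lt_min ex0.
have {}hex := hex eps (introT andP (conj eps0 epsex)).
have rT : resp x u T = 0 by exact: synthesis_resp.
have rTe : enorm (resp x u T) < eps by rewrite rT enorm0.
have [S SE] : exists S, Topt A B eps x = S by exists (Topt A B eps x).
rewrite SE in hex.
have ST : S < T by rewrite -SE; exact: (Topt_lt cu T0 rTe).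
have [d d0 hd] := reach_times_lb A B (ltW eps0) (lt_trans epsex exx).
have S0 : 0 < S.
  rewrite -SE; apply: (lt_le_trans d0); apply: lb_le_inf hd; exists T.
  by apply/reach_timesP; split=> //; exists u => //; exact: ltW.
have itv t : 0 < t < S -> 0 < t < T.
  by move=> /andP[-> tS]; exact: lt_trans ST.
have sub t : 0 < t < S -> u_star A B eps x t = u_star A B 0 x t.
  by move=> /andP[t0 tS]; apply: hex; rewrite t0 ltW.
(* The default value 0 is impossible: the shared control has norm 1 at almost every time before
   [S]. *)
have [[[ave veS] _ _]|ue0] := u_star_cases A B eps x; last first.
  have [t tS [[ut nzt] aut]] := ae_itv_ex S0
    (ae_imp2 (fun t a b => conj a b) (ae_imp2 (fun t a b => conj a b) uu nz) au).
  have tT := itv t tS; have := enorm_unitv (nzt tT).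
  have := ut tT; rewrite -(sub t tS) ue0 (aut tT) => /esym/eqP.
  by rewrite oppr_eq0 => /eqP ->; rewrite enorm0 => /eqP; rewrite eq_sym oner_eq0.
rewrite SE in veS.
have [v cv uev] := admissible_clean ave.
have vS : resp x v S = resp x u S.
  apply: (resp_local A B x cv cu (ltW S0)).
  apply: ae_imp2 uev uu => t h1 h2 tS; have /andP[t0 _] := tS.
  by rewrite -h1 // sub // h2 // itv.
have wS : enorm (resp x u S) <= eps.
  by rewrite -vS -(stateE A B x cv (ltW S0)) -(state_ae A B x ave (clean_admissible cv) uev).
have tS : t1 < S.
  rewrite ltNge; apply/negP => St1.
  have := hc S; rewrite (ltW S0) St1 => /(_ isT) cS.
  by have := lt_le_trans epsc cS; rewrite ltNge wS.
exists S; split=> //.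
  by apply: le_lt_trans tS; rewrite le_max lexx orbT.
pose P := (expmx A S)^T *m resp x u S; rewrite -/P.
have := ball_maximum cu SE (erefl P) S0 wS => hmax t tI.
apply/matrixP => i j; rewrite (ord1 j) [LHS]mxE [RHS]mxE; apply/eqP; rewrite -subr_eq0.
apply/eqP; apply: (ae_eq0_continuous (f := fun t => enorm (obs (- t) P) * obs (- t) p i 0 -
  enorm (obs (- t) p) * obs (- t) P i 0) (a := 0) (b := S)) => //.
  have co q k : continuous (fun t => obs (- t) q k 0).
    exact: (@continuous_obs_oppc _ _ _ A B q k).
  move=> s; apply: (@continuous_at_sub R R (fun t => enorm (obs (- t) P) * obs (- t) p i 0)
    (fun t => enorm (obs (- t) p) * obs (- t) P i 0)).
    by apply: continuous_at_mul; [exact: continuous_enorm_obs|exact: co].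
  by apply: continuous_at_mul; [exact: continuous_enorm_obs|exact: co].
apply: ae_imp2 hmax au => s hs1 hs2 sS; have /andP[s0 sS'] := sS.
have h1 := hs1 ltac:(by rewrite (ltW s0) ltW).
have h2 := hs2 (itv s sS); rewrite h2 scalerN in h1.
(* The two adjoints prescribe the same [u s], which is eliminated here. *)
have h3 : enorm (obs (- s) P) *: obs (- s) p = enorm (obs (- s) p) *: obs (- s) P.
  by rewrite -[in RHS](oppr_inj h1) scalerA mulrC -scalerA unitvK.
by move/matrixP/(_ i 0): h3; rewrite [LHS]mxE [RHS]mxE => ->; rewrite subrr.
Qed.

Hypothesis oT : obs (- T) p != 0.

(** Coordinate [i] of [E(-s) B unitv (obs (- s) p)]. *)
Let g (i : 'I_n) s := dotp (obs (- s) (delta_mx i 0)) (unitv (obs (- s) p)).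

Let lg i : locbm (g i).
Proof.
have := locbmN (locbm_obs_dotp A B (delta_mx i 0) (clean_aligned A B p)).
by congr locbm; apply/funext => s; rewrite dotpNr opprK.
Qed.

Let cg i : {for T, continuous (g i)}.
Proof.
have co q k : continuous (fun s => obs (- s) q k 0).
  exact: (@continuous_obs_oppc _ _ _ A B q k).
apply: (@continuous_dotp R R _ (fun s => obs (- s) (delta_mx i 0))
  (fun s => unitv (obs (- s) p))) => k; first exact: co.
have cu' : {for T, continuous (fun s => unitv (obs (- s) p))}.
  by apply: (@continuous_unitv R _ (fun s => obs (- s) p)) => //; move=> l; exact: co.
exact: (cvg_comp _ _ cu' (@coord_continuous R m 1 k 0 _)).
Qed.

(** The arc at [S], pulled back to time 0 and divided by [T - S], completed continuously at [T]. *)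
Let Y S : 'cV[R]_n :=
  \col_i (if S < T then intg (g i) S T / (T - S) else g i T).

Let cY i : {for T, continuous (fun S => Y S i 0)}.
Proof.
rewrite (_ : (fun S => _) =
    fun S => if S < T then intg (g i) S T / (T - S) else g i T).
  exact: continuous_left_average.
by apply/funext => S; rewrite mxE.
Qed.

Let YT : expmx A T *m Y T = B *m unitv (obs (- T) p).
Proof.
have -> : Y T = expmx A (- T) *m (B *m unitv (obs (- T) p)).
  apply/matrixP => i j; rewrite (ord1 j) [LHS]mxE ltxx /g.
  by rewrite dotp_obs dotp_deltal.
by rewrite mulmxA expmxNK mul1mx.
Qed.

Let resp_Y S : 0 <= S -> S < T -> resp x u S = (T - S) *: (expmx A S *m Y S).
Proof.
move=> S0 ST; rewrite scalemxAr -[LHS]mul1mx -(expmxNK A S) -mulmxA; congr (_ *m _).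
apply: dotp_inj => r; rewrite arc_dotp_resp ?(ltW ST) // dotpZr.
transitivity (intg (fun s => \sum_i r i 0 * g i s) S T).
  apply: eq_intg => s _; rewrite dotp_obs; apply: eq_bigr => i _.
  by rewrite /g dotp_obs dotp_deltal.
rewrite intg_sum; last by move=> i; exact: locbmZ.
rewrite mulr_sumr; apply: eq_bigr => i _.
rewrite intgZ // [Y S i 0]mxE ST; field.
by rewrite subr_eq0 gt_eqF.
Qed.

(** The relation of [shared_adjoint] is positively homogeneous in the hitting point, so [T - S] can
    be divided out before letting [S] tend to [T]. *)
Lemma shared_adjoint_limit t : 0 <= t -> t <= T ->
  let q := (expmx A T)^T *m (B *m unitv (obs (- T) p)) in
  enorm (obs (- t) q) *: obs (- t) p = enorm (obs (- t) p) *: obs (- t) q.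
Proof.
move=> t0 tT q; apply/matrixP => i j; rewrite (ord1 j) [LHS]mxE [RHS]mxE.
apply/eqP; rewrite -subr_eq0; apply/eqP.
have co q' k : continuous (fun t => obs (- t) q' k 0).
  exact: (@continuous_obs_oppc _ _ _ A B q' k).
apply: (ae_eq0_continuous (f := fun t => enorm (obs (- t) q) * obs (- t) p i 0 -
  enorm (obs (- t) p) * obs (- t) q i 0) (a := 0) (b := T)) => //; last by rewrite t0.
  move=> s; apply: (@continuous_at_sub R R (fun t => enorm (obs (- t) q) * obs (- t) p i 0)
    (fun t => enorm (obs (- t) p) * obs (- t) q i 0)).
    by apply: continuous_at_mul; [exact: continuous_enorm_obs|exact: co].
  by apply: continuous_at_mul; [exact: continuous_enorm_obs|exact: co].
apply: (ae_imp (P := fun _ => True)) => [s _ /andP[s0 sT]|]; last exact: aeW.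
pose Q S := (expmx A S)^T *m (expmx A S *m Y S).
pose F S := enorm (obs (- s) (Q S)) * obs (- s) p i 0 -
  enorm (obs (- s) p) * obs (- s) (Q S) i 0.
have QT : Q T = q by rewrite /Q YT.
have cQ k l : {for T, continuous (fun S => Q S k l)}.
  apply: continuous_mulmx => [a b|a b].
    rewrite (_ : (fun S => _) = fun S => expmx A S b a); first exact: continuous_expmx.
    by apply/funext => S; rewrite mxE.
  apply: continuous_mulmx => [c d|c d]; first exact: continuous_expmx.
  by rewrite (ord1 d); exact: cY.
have coQ k l : {for T, continuous (fun S => obs (- s) (Q S) k l)}.
  apply: (@continuous_mulmx _ R _ _ _ (fun=> B^T)
      (fun S => (expmx A (- s))^T *m Q S)) => [a b|a b].
    exact: continuous_at_cst.
  apply: (@continuous_mulmx _ R _ _ _ (fun=> (expmx A (- s))^T) Q) => [c d|c d].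
    exact: continuous_at_cst.
  exact: cQ.
have cF : {for T, continuous F}.
  apply: (@continuous_at_sub R R (fun S => enorm (obs (- s) (Q S)) * obs (- s) p i 0)
    (fun S => enorm (obs (- s) p) * obs (- s) (Q S) i 0)).
    apply: continuous_at_mul; last exact: continuous_at_cst.
    by apply: (@continuous_enorm _ R _ (fun S => obs (- s) (Q S))) => k; exact: coQ.
  by apply: continuous_at_mul; [exact: continuous_at_cst|exact: coQ].
rewrite -QT -/(F T); apply/eqP; apply: contrapT => /negP FT.
have : \forall S \near T, F S != 0.
  by have := @cvgr_neq0 _ _ _ (nbhs T) _ _ (F T) cF FT; apply.
move=> /nbhs_ballP[e /= e0 he].
(* One bound puts [S] in the ball where [F] does not vanish, the other gives [s < S]. *)
have eta0 : 0 < Num.min e (T - s) by rewrite lt_min e0 subr_gt0.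
have [S [S0 TS ST hS]] := shared_adjoint eta0.
have Se : T - S < e.
  have : Num.min e (T - s) <= e by rewrite ge_min lexx.
  by move: TS; generalize (Num.min e (T - s)) => z; lra.
have sS : s < S.
  have : Num.min e (T - s) <= T - s by rewrite ge_min lexx orbT.
  by move: TS; generalize (Num.min e (T - s)) => z; lra.
have : F S != 0.
  by apply: he; rewrite /ball /= gtr0_norm ?subr_gt0.
move/eqP; apply.
have := hS s; rewrite (ltW s0) (ltW sS) => /(_ isT).
rewrite resp_Y ?(ltW S0) // -scalemxAr -/(Q S).
rewrite obsZ.
have TS0 : 0 < T - S by rewrite subr_gt0.
move=> /matrixP/(_ i 0); rewrite enormZ (gtr0_norm TS0).
rewrite [LHS]mxE [RHS]mxE [X in _ = _ * X]mxE -mulrA [RHS]mulrCA.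
move=> /(mulfI (lt0r_neq0 TS0)) hE.
by rewrite /F hE subrr.
Qed.

End Arc.

End SharedControls.

(** * From condition (a) to isotropy *)

Section Rigidity.
Context {R : realType} {n m : nat}.
Variables (A : 'M[R]_n) (B : 'M[R]_(n, m)).
Implicit Types (p q r : 'cV[R]_n) (s t S : R).

Local Notation obs := (obs A B).
Local Notation resp := (resp A B).
Local Notation drift := (drift A B).

(** Basis pairs kill the off-diagonal entries; the orthogonal pair [e i + e j], [e i - e j] equates
    the diagonal ones. *)
Lemma scalar_mx_dotp (Q : 'M[R]_n) : (0 < n)%N ->
  (forall p q, dotp p q = 0 -> dotp p (Q *m q) = 0) -> exists c, Q = c%:M.
Proof.
move=> n0 hQ; pose e i : 'cV[R]_n := delta_mx i 0.
have ee i j : dotp (e i) (e j) = (i == j)%:R by rewrite dotp_deltal mxE eqxx andbT.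
have Qe i j : dotp (e i) (Q *m e j) = Q i j by rewrite dotp_deltal -colE mxE.
have off i j : i != j -> Q i j = 0.
  by move=> ij; rewrite -Qe; apply: hQ; rewrite ee (negbTE ij).
have diag i j : Q i i = Q j j.
  have [->//|ij] := eqVneq i j; have := hQ (e i + e j) (e i - e j).
  rewrite mulmxBr !(dotpDl, dotpDr, dotpNr) !Qe !ee !eqxx [j == i]eq_sym (negbTE ij).
  rewrite (off i j ij) (off j i) 1?eq_sym // => h.
  by apply/eqP; rewrite -subr_eq0; apply/eqP; rewrite -[RHS]h; lra.
exists (Q (Ordinal n0) (Ordinal n0)); apply/matrixP => i j; rewrite [RHS]mxE.
by have [->|/off ->] := eqVneq i j; [rewrite mulr1n; exact: diag|].
Qed.

(** Otherwise the kernel of [B^T] is stable under [A^T], and [r] annihilates every [A ^+ j *m B],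
    against the rank condition. *)
Lemma kalman_unobserved r : kalman A B -> r != 0 -> B^T *m r = 0 ->
  exists2 q : 'cV[R]_n, B^T *m q = 0 & B^T *m (A^T *m q) != 0.
Proof.
move=> kal r0 Br; apply: contrapT => nq.
have step q : B^T *m q = 0 -> B^T *m (A^T *m q) = 0.
  move=> Bq; apply/eqP; apply: contrapT => /negP ABq; apply: nq.
  by exists q.
have Bj j : B^T *m ((A ^+ j)^T *m r) = 0.
  elim: j => [|j IH]; first by rewrite expr0 trmx1 mul1mx.
  by rewrite exprSr -mulmxE trmx_mul -mulmxA step.
have rAB j : r^T *m (A ^+ j *m B) = 0.
  by apply: trmx_inj; rewrite !trmx_mul trmxK trmx0 -mulmxA Bj.
have : r^T *m \mxrow_(j < n) (A ^+ j *m B) = 0.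
  apply/matrixP => i j; rewrite mxE [RHS]mxE.
  have h : (r^T *m (A ^+ tagnat.sig1 j *m B)) i (tagnat.sig2 j) = 0 by rewrite rAB mxE.
  rewrite mxE in h; rewrite -[RHS]h; apply: eq_bigr => l _; congr (_ * _).
  by rewrite mxE.
move=> /eqP; rewrite mulmx_free_eq0; last by rewrite /row_free kal.
by rewrite -trmx0 (inj_eq trmx_inj) (negbTE r0).
Qed.

Lemma is_derive_obs q i s :
  is_derive s (1 : R) (fun t => obs t q i 0) (obs s (A^T *m q) i 0).
Proof.
have oE t q' : obs t q' i 0 = \sum_l (q' l 0 * \sum_k (expmx A t l k * B k i)).
  rewrite -[LHS]dotp_deltal dotpC dotp_obs; apply: eq_bigr => l _.
  rewrite [X in _ * X]mxE; congr (_ * _); apply: eq_bigr => k _.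
  by rewrite -colE [col _ _ _ _]mxE.
rewrite (_ : (fun t => _) =
    fun t => \sum_l (q l 0 * \sum_k (expmx A t l k * B k i))); last first.
  by apply/funext => t; exact: oE.
apply: is_derive_eq.
  apply: is_derive_bigsum => l.
  apply: (is_derive_mul (is_derive_cst_fun (q l 0) s 1)).
  apply: is_derive_bigsum => k.
  exact: (is_derive_mul (is_derive_expmx A l k s) (is_derive_cst_fun (B k i) s 1)).
rewrite -[RHS]dotp_deltal dotpC dotp_obs dotp_mulmxl trmxK.
rewrite mulmxA; apply: eq_bigr => l _; rewrite mul0r add0r; congr (_ * _).
rewrite mulmxA -colE [RHS]mxE [RHS]mxE; apply: eq_bigr => k _.
by rewrite mulr0 addr0.
Qed.

Section SlopeQuotient.
Variables (f : R -> R) (df : R).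
Hypothesis cf : continuous f.
Hypothesis f0 : f 0 = 0.
Hypothesis dfP : is_derive (0 : R) (1 : R) f df.

Lemma continuous_slope : continuous (fun s => if s == 0 then df else s^-1 * f s).
Proof.
move=> s; have [->|s0] := eqVneq s 0.
  apply/continuous_withinNx; rewrite /= eqxx.
  have [dv <-] := dfP.
  have : h^-1 *: (f (h *: 1 + 0) - f 0) @[h --> (0 : R)^'] --> 'D_1 f 0 by exact: dv.
  apply: cvg_trans; apply: near_eq_cvg; near=> h.
  have h0 : h != 0 by near: h; exact: nbhs_dnbhs_neq.
  by rewrite (negbTE h0) f0 subr0 addr0 /GRing.scale /= mulr1.
have cg : {for s, continuous (fun s => s^-1 * f s)}.
  apply: continuous_at_mul; last exact: cf.
  by apply: (@continuous_at_inv R R id) => //; exact: cvg_id.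
rewrite /continuous_at (negbTE s0).
apply: cvg_trans cg; apply: near_eq_cvg; near=> h.
suff /negbTE -> : h != 0 by [].
near: h.
by have := @cvgr_neq0 _ _ _ (nbhs s) _ id s (@cvg_id _ _) s0; apply.
Unshelve. all: by end_near.
Qed.

End SlopeQuotient.

(** Both factors follow the adjoint flow, so only the symmetric part of [A] survives. *)
Lemma is_derive_dotp_expmx p q (c d : R) s :
  is_derive s (1 : R)
    (fun t => dotp ((expmx A (c - t))^T *m p) ((expmx A (d - t))^T *m q))
    (- dotp ((expmx A (c - s))^T *m p)
        ((A + A^T) *m ((expmx A (d - s))^T *m q))).
Proof.
have de (r : 'cV[R]_n) (e t : R) i : is_derive t (1 : R)
    (fun t => ((expmx A (e - t))^T *m r) i 0)
    (- ((A^T *m ((expmx A (e - t))^T *m r)) i 0)).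
  rewrite (_ : (fun t => _) =
      fun t => \sum_l (expmx A (e - t) l i * r l 0)); last first.
    by apply/funext => y; rewrite mxE; apply: eq_bigr => l _; rewrite [_^T _ _]mxE.
  apply: is_derive_eq.
    apply: is_derive_bigsum => l.
    apply: (is_derive_mul _ (is_derive_cst_fun (r l 0) t 1)).
    apply: (is_derive_oppc (f := fun s => expmx A (e + s) l i)).
    exact: is_derive_shiftc (is_derive_expmx A l i _).
  rewrite mulmxA -trmx_mul -expmx_comm mxE -sumrN; apply: eq_bigr => l _.
  by rewrite mulr0 addr0 mulNr [_^T _ _]mxE.
apply: is_derive_eq
  (is_derive_bigsum _ (fun l => is_derive_mul (de p c s l) (de q d s l))) _.
rewrite mulmxDl dotpDr [in RHS]dotp_mulmxr opprD big_split /=.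
by congr (_ + _); rewrite -sumrN; apply: eq_bigr => l _; rewrite (mulNr, mulrN).
Qed.

(** Joint continuity, because the hitting time and the running time approach the final time
    together. *)
Lemma continuous_symmetric_form (p q : 'cV[R]_n) :
  {for (0, 0) : R * R, continuous (fun z : R * R =>
    dotp ((expmx A (z.1 - z.2))^T *m (expmx A (- z.2) *m p))
      ((A + A^T) *m ((expmx A z.1)^T *m q)))}.
Proof.
have c1 : continuous (fun z : R * R => z.1) by move=> z; exact: cvg_fst.
have c2 : continuous (fun z : R * R => z.2) by move=> z; exact: cvg_snd.
have cE (f : R * R -> R) i j : continuous f -> continuous (fun z => expmx A (f z) i j).
  move=> cf z; apply: (@continuous_comp _ _ _ f (fun s => expmx A s i j)).
    exact: cf.
  exact: continuous_expmx.
have cET (f : R * R -> R) i j : continuous f ->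
    continuous (fun z => (expmx A (f z))^T i j).
  move=> cf; rewrite (_ : (fun z => _) = fun z => expmx A (f z) j i); first exact: cE.
  by apply/funext => z; rewrite mxE.
apply: (@continuous_dotp R (R * R)%type n
    (fun z : R * R => (expmx A (z.1 - z.2))^T *m (expmx A (- z.2) *m p))
    (fun z : R * R => (A + A^T) *m ((expmx A z.1)^T *m q))) => i.
  apply: (@continuous_mulmx _ (R * R)%type _ _ _ (fun z : R * R => (expmx A (z.1 - z.2))^T)
      (fun z : R * R => expmx A (- z.2) *m p)) => k l.
    apply: cET => z; apply: (@continuous_at_sub R (R * R)%type (fun z => z.1) (fun z => z.2)).
      exact: c1.
    exact: c2.
  apply: (@continuous_mulmx _ (R * R)%type _ _ _ (fun z : R * R => expmx A (- z.2)) (fun=> p)) => c d.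
    apply: cE => z; apply: (@continuous_comp _ _ _ (fun z : R * R => z.2) (fun s : R => - s)).
      exact: c2.
    exact: (@oppr_continuous _ R^o).
  exact: continuous_at_cst.
apply: (@continuous_mulmx _ (R * R)%type _ _ _ (fun=> A + A^T)
    (fun z : R * R => (expmx A z.1)^T *m q)) => k l; first exact: continuous_at_cst.
apply: (@continuous_mulmx _ (R * R)%type _ _ _ (fun z : R * R => (expmx A z.1)^T) (fun=> q)) => c d.
  by apply: cET.
exact: continuous_at_cst.
Qed.

Section CaseA.
Hypothesis kal : kalman A B.
Hypothesis ca : cond_a A B.

Section SwitchedArc.
Variables (k : R -> 'cV[R]_m) (t0 T : R) (p : 'cV[R]_n) (chi : R -> R).
Hypothesis ck : forall i, continuous (fun s => k s i 0).
Hypothesis k0 : forall t, 0 <= t <= T -> k t != 0.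
Hypothesis t00 : 0 < t0.
Hypothesis t0T : t0 <= T.
Hypothesis pk : forall t, obs (- t) p = chi t *: k t.
Hypothesis chip : forall t, 0 < t < t0 -> 0 < chi t.
Hypothesis chin : forall t, t0 < t < T -> chi t < 0.

Let T0 : 0 < T. Proof. exact: lt_le_trans t0T. Qed.

Let nz : {ae (@lebesgue_measure R), forall t, 0 < t < T -> obs (- t) p != 0}.
Proof.
apply: ae_imp (ae_neq t0) => t tt0 /andP[tp tT]; rewrite pk scaler_eq0 negb_or.
rewrite k0 ?(ltW tp) ?(ltW tT) // andbT.
have [tl|tg|] := ltgtP t t0; last by move=> tE; rewrite tE eqxx in tt0.
  by rewrite gt_eqF // chip // tp.
by rewrite lt_eqF // chin // tg.
Qed.

Lemma switch_adjoint_limit t : obs (- T) p != 0 -> 0 <= t <= T ->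
  let q := (expmx A T)^T *m (B *m unitv (obs (- T) p)) in
  enorm (obs (- t) q) *: obs (- t) p = enorm (obs (- t) p) *: obs (- t) q.
Proof.
move=> oT /andP[t1 tT].
exact: (shared_adjoint_limit T0 (clean_switch t0 T ck) (aligned_switch pk chip chin)
  (switch_hsupp_lt k0 pk chip chin) nz (u_star_switch ck k0 t00 t0T pk chip chin)
  ca oT).
Qed.

(** The shared relation read at [t = S], where the second adjoint has output [B^T y] with [y] the
    hitting point. *)
Lemma switch_shared_adjoint eta : 0 < eta -> exists S (y : 'cV[R]_n),
  [/\ [/\ 0 < S, T - eta < S & S < T],
    enorm (B^T *m y) *: obs (- S) p = enorm (obs (- S) p) *: (B^T *m y)
  & forall r, dotp r (expmx A (- S) *m y) =
      intg (fun s => dotp (obs (- s) r) (unitv (obs (- s) p))) S T].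
Proof.
move=> eta0; have cu := clean_switch t0 T ck.
have au := aligned_switch pk chip chin.
have [S [S0 TS ST hS]] := shared_adjoint T0 cu au
  (switch_hsupp_lt k0 pk chip chin) nz (u_star_switch ck k0 t00 t0T pk chip chin)
  ca eta0.
exists S, (resp (- drift (switch k t0 T) T) (switch k t0 T) S); split=> //.
  have := hS S; rewrite (ltW S0) lexx => /(_ isT).
  by rewrite obsD addNr !obsE expmx0 trmx1 mul1mx.
by move=> r; rewrite (arc_dotp_resp T0 cu au) ?(ltW S0) // ltW.
Qed.

End SwitchedArc.

(* If [B^T] had a kernel, Kalman's condition would give an adjoint whose output
   vanishes to first order at one time; the optimal control then switches there,
   and its final and initial directions cannot match in the limit. *)
Lemma cond_a_injective q : B^T *m q = 0 -> q = 0.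
Proof.
move=> Bq0; apply/eqP; apply: contrapT => /negP q0.
have [q' Bq' v0] := kalman_unobserved kal q0 Bq0.
set v := B^T *m (A^T *m q') in v0.
(* The output of [q'] vanishes at 0 with derivative [v]; dividing by [s] leaves a continuous
   direction, nonzero near 0. *)
pose kap s : 'cV[R]_m := if s == 0 then v else s^-1 *: obs s q'.
have ckap i : continuous (fun s => kap s i 0).
  rewrite (_ : (fun s => _) =
      fun s => if s == 0 then obs 0 (A^T *m q') i 0 else s^-1 * obs s q' i 0).
    apply: continuous_slope; [exact: continuous_obs| |exact: is_derive_obs].
    by rewrite obs0 Bq' mxE.
  apply/funext => s; rewrite /kap; case: ifP => _; first by rewrite obs0.
  by rewrite [LHS]mxE.
have kap0 : kap 0 = v by rewrite /kap eqxx.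
have kapE s : obs s q' = s *: kap s.
  rewrite /kap; case: eqP => [->|/eqP s0]; first by rewrite obs0 Bq' scale0r.
  by rewrite scalerA mulfV // scale1r.
have Bv : B *m v != 0.
  apply: contra v0 => /eqP Bv; apply/eqP/dotp_eq0.
  by rewrite {1}/v dotp_mulmxl trmxK Bv dotp0r.
(* Pairings with [v] of the initial direction and of the limit adjoint's initial output; both are
   positive at 0, hence for small [s]. *)
pose g1 s := dotp (kap s) v.
pose g2 s := dotp (B *m unitv (kap (- s))) (expmx A (2 * s) *m (B *m v)).
have near1 : \forall s \near (0 : R), 0 < g1 s.
  have c1 : {for 0, continuous g1}.
    by apply: (@continuous_dotp R R _ kap) => i; [exact: ckap|exact: continuous_at_cst].
  have p1 : 0 < g1 0 by rewrite /g1 kap0 -sqr_enorm exprn_gt0 // enorm_gt0.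
  by have := @cvgr_gt R _ (nbhs 0) _ _ (g1 0) c1; apply.
have near2 : \forall s \near (0 : R), 0 < g2 s.
  have c2 : {for 0, continuous g2}.
    apply: (@continuous_dotp R R _ (fun s => B *m unitv (kap (- s)))
        (fun s => expmx A (2 * s) *m (B *m v))) => i.
      apply: (@continuous_mulmx _ R _ _ _ (fun=> B) (fun s => unitv (kap (- s)))) => a b.
        exact: continuous_at_cst.
      rewrite (ord1 b).
      have cu' : {for 0, continuous (fun s => unitv (kap (- s)))}.
        apply: (@continuous_unitv R _ (fun s => kap (- s))); last by rewrite oppr0 kap0.
        by move=> l; exact: (continuous_oppc (ckap l)).
      exact: (cvg_comp _ _ cu' (@coord_continuous R m 1 a 0 _)).
    apply: (@continuous_mulmx _ R _ _ _ (fun s => expmx A (2 * s)) (fun=> B *m v)) => a b.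
      apply: (@continuous_comp _ _ _ (fun s : R => 2 * s) (fun s => expmx A s a b)).
        by apply: continuous_at_mul; [exact: continuous_at_cst|exact: cvg_id].
      exact: continuous_expmx.
    exact: continuous_at_cst.
  have p2 : 0 < g2 0.
    rewrite /g2 oppr0 mulr0 kap0 expmx0 mul1mx /unitv -scalemxAr dotpZl -sqr_enorm.
    by rewrite mulr_gt0 ?invr_gt0 ?exprn_gt0 // enorm_gt0.
  by have := @cvgr_gt R _ (nbhs 0) _ _ (g2 0) c2; apply.
have [e e0 he] : exists2 e, 0 < e & forall s, `|s| < e -> 0 < g1 s /\ 0 < g2 s.
  have /nbhs_ballP[e /= e0 he] : \forall s \near (0 : R), 0 < g1 s /\ 0 < g2 s.
    by apply: filterI.
  by exists e => // s se; apply: he; rewrite /ball /= sub0r normrN.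
pose s0 := e / 2.
have s00 : 0 < s0 by rewrite divr_gt0.
have s0e : s0 < e by rewrite /s0 ltr_pdivrMr // mulr_natr mulr2n ltrDl.
have kn0 s : `|s| <= s0 -> kap s != 0.
  move=> ss; have [+ _] := he s (le_lt_trans ss s0e).
  by apply: contraTneq => k0; rewrite /g1 k0 dotp0l ltxx.
have s0T : s0 <= 2 * s0 by rewrite mulr_natl mulr2n lerDl ltW.
(* The shift places the zero of the output in the middle of the horizon [2 * s0]. *)
pose p := (expmx A s0)^T *m q'.
have pk t : obs (- t) p = (s0 - t) *: kap (s0 - t).
  by rewrite obsD -kapE addrC.
have pT : obs (- (2 * s0)) p = - (s0 *: kap (- s0)).
  by rewrite pk (_ : s0 - 2 * s0 = - s0) ?scaleNr //; ring.
have := @switch_adjoint_limit (fun t => kap (s0 - t)) s0 (2 * s0) p (fun t => s0 - t)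
  _ _ s00 s0T pk _ _ 0 _ _.
rewrite /= oppr0 pT unitvN unitvZ // mulmxN mulmxN obsN enormN.
set w := obs 0 _.
have -> : obs 0 p = s0 *: kap s0 by rewrite obsD add0r kapE.
move=> /(_ _ _ _ _ _ _) h.
have {}h : enorm w *: (s0 *: kap s0) = enorm (s0 *: kap s0) *: - w.
  apply: h.
  - by move=> i; apply: (continuous_oppc (f := fun s => kap (s0 + s) i 0)) => s;
      apply: (@continuous_comp _ _ _ (fun s : R => s0 + s) (fun s => kap s i 0));
      [apply: continuous_at_add; [exact: continuous_at_cst|exact: cvg_id]|exact: ckap].
  - move=> t /andP[t1 t2]; apply: kn0; rewrite ler_norml; apply/andP; split; lra.
  - by move=> t /andP[_]; rewrite subr_gt0.
  - by move=> t /andP[+ _]; rewrite subr_lt0.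
  - by rewrite oppr_eq0 scaler_eq0 gt_eqF //= kn0 // normrN gtr0_norm.
  - by rewrite lexx mulr_ge0 // ltW.
have [g1s g2s] : 0 < g1 s0 /\ 0 < g2 s0 by apply: he; rewrite gtr0_norm.
have wv : dotp w v = g2 s0.
  by rewrite /w obsD add0r dotp_obs.
have /(congr1 (fun z => dotp z v)) := h.
rewrite !dotpZl dotpNl wv -/(g1 s0) => hh.
have l0 : 0 <= enorm w * (s0 * g1 s0) by rewrite !mulr_ge0 ?enorm_ge0 // ltW.
(* The sign reversed by the switch makes a nonnegative number equal to a negative one. *)
move: l0; rewrite hh mulrN oppr_ge0 leNgt mulr_gt0 //.
rewrite enormZ gtr0_norm // mulr_gt0 // enorm_gt0 // kn0 //.
by rewrite gtr0_norm.
Qed.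

Lemma cond_a_obs_neq0 s q : q != 0 -> obs s q != 0.
Proof.
apply: contra => /eqP; rewrite !obsE => /cond_a_injective => h.
have := expmxNK A s => /(congr1 trmx).
rewrite trmx1 trmx_mul => EE.
by rewrite -[q]mul1mx -EE -mulmxA h mulmx0.
Qed.

(** At the final time the limit relation makes [B^T q] parallel to [B^T B B^T q]; by injectivity
    every [q] is an eigenvector of [B B^T]. *)
Lemma cond_a_isotropic_B (n0 : (0 < n)%N) : exists2 b, 0 < b & B *m B^T = (b ^+ 2)%:M.
Proof.
have [p q pq|c BB] := @scalar_mx_dotp (B *m B^T) n0.
  have [->|q0] := eqVneq q 0; first by rewrite mulmx0 dotp0r.
  (* The horizon 1 is arbitrary; this adjoint has output [B^T q] at the final time. *)
  pose p1 := (expmx A 1)^T *m q.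
  have pT : obs (- 1) p1 = B^T *m q by rewrite obsD addNr obs0.
  have h01 : 0 <= (1 : R) <= 1 by rewrite ler01 lexx.
  have := @switch_adjoint_limit (fun t => obs (- t) p1) 1 1 p1 (fun=> 1) _ _
    ltr01 (lexx 1) _ _ _ 1 _ h01.
  rewrite /= pT obsD addNr obs0.
  move=> /(_ _ _ _ _ _ _) h.
  have {}h : enorm (B^T *m (B *m unitv (B^T *m q))) *: (B^T *m q) =
      enorm (B^T *m q) *: (B^T *m (B *m unitv (B^T *m q))).
    apply: h.
    - by move=> i; exact: continuous_obs_oppc.
    - move=> t _; apply: cond_a_obs_neq0; rewrite /p1 -(mulmx0 _ (expmx A 1)^T).
      apply: contra q0 => /eqP h; have /(congr1 (obs (- 1))) := h.
      rewrite obsD addNr obs0 mulmx0 !obsE !mulmx0 => /cond_a_injective.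
      by move=> ->.
    - by move=> t; rewrite scale1r.
    - by [].
    - by move=> t /andP[/lt_trans h /h]; rewrite ltxx.
    - by rewrite -(obs0 A B) cond_a_obs_neq0.
  set g := enorm (B^T *m (B *m _)) in h.
  rewrite /unitv -!scalemxAr scalerA mulfV ?scale1r in h; last first.
    by rewrite gt_eqF // enorm_gt0 // -(obs0 A B) cond_a_obs_neq0.
  have {}h : B *m B^T *m q = g *: q.
    apply/eqP; rewrite -subr_eq0; apply/eqP/cond_a_injective.
    by rewrite mulmxBr -scalemxAr h -mulmxA subrr.
  by rewrite h dotpZr pq mulr0.
have c0 : 0 < c.
  pose e : 'cV[R]_n := delta_mx (Ordinal n0) 0.
  have e0 : e != 0.
    by apply/eqP => /matrixP /(_ (Ordinal n0) 0) /eqP; rewrite !mxE !eqxx oner_eq0.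
  have := dotp_mulmxl B^T e (B^T *m e); rewrite trmxK mulmxA BB mul_scalar_mx dotpZr.
  rewrite -!sqr_enorm => h.
  have : 0 < c * enorm e ^+ 2.
    by rewrite -h exprn_gt0 // enorm_gt0 // -(obs0 A B) cond_a_obs_neq0.
  by rewrite pmulr_lgt0 // exprn_gt0 // enorm_gt0.
by exists (Num.sqrt c); rewrite ?sqrtr_gt0 // sqr_sqrtr // ltW.
Qed.

Section Symmetric.
Variable b : R.
Hypothesis b0 : 0 < b.
Hypothesis BB : B *m B^T = (b ^+ 2)%:M.

Let dotpBB p q : dotp (B^T *m p) (B^T *m q) = b ^+ 2 * dotp p q.
Proof. by rewrite dotp_mulmxl trmxK mulmxA BB mul_scalar_mx dotpZr. Qed.

(** If [D != 0], an integral over the remaining arc vanishes by orthogonality to the hitting point,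
    although its integrand has constant sign near the final time. *)
Lemma cond_a_symmetric (p q : 'cV[R]_n) :
  dotp p q = 0 -> dotp p ((A + A^T) *m q) = 0.
Proof.
move=> pq; set D := dotp p _; apply/eqP; apply: contrapT => /negP D0.
have q0 : q != 0 by apply: contraNneq D0 => q0; rewrite /D q0 mulmx0 dotp0r.
pose H (z : R * R) := dotp ((expmx A (z.1 - z.2))^T *m (expmx A (- z.2) *m p))
  ((A + A^T) *m ((expmx A z.1)^T *m q)).
have H0 : H (0, 0) = D.
  by rewrite /H /= subr0 oppr0 expmx0 trmx1 !mul1mx.
have [e e0 he] : exists2 e, 0 < e &
    forall s t : R, `|s| < e -> `|t| < e -> 0 < D * H (s, t).
  have cH : {for (0, 0) : R * R, continuous (fun z => D * H z)}.
    apply: (@continuous_at_mul R (R * R)%type (fun=> D) H); first exact: continuous_at_cst.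
    exact: continuous_symmetric_form.
  have p0 : 0 < D * H (0, 0) by rewrite H0 -expr2 exprn_even_gt0.
  have : \forall z \near ((0, 0) : R * R), 0 < D * H z.
    by have := @cvgr_gt R _ (nbhs ((0, 0) : R * R)) _ _ (D * H (0, 0)) cH; apply.
  move=> /nbhs_ballP[e /= e0 he]; exists e => // s t se te.
  by apply: he; split; rewrite /ball /= sub0r normrN.
pose p1 := (expmx A 1)^T *m q.
have op1 s : obs (- s) p1 != 0 by rewrite obsD cond_a_obs_neq0.
have [S [y [[S0 eS S1] yS hr]]] : exists S (y : 'cV[R]_n),
  [/\ [/\ 0 < S, 1 - e < S & S < 1],
    enorm (B^T *m y) *: obs (- S) p1 = enorm (obs (- S) p1) *: (B^T *m y)
  & forall r, dotp r (expmx A (- S) *m y) =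
      intg (fun s => dotp (obs (- s) r) (unitv (obs (- s) p1))) S 1].
  apply: (@switch_shared_adjoint (fun t => obs (- t) p1) 1 1 p1 (fun=> 1)) => //.
  - by move=> i; exact: continuous_obs_oppc.
  - by move=> t; rewrite scale1r.
  - by move=> t /andP[/lt_trans h /h]; rewrite ltxx.
(* Transported so as to stay orthogonal to [E(1 - S)^T q], of which [y] is a multiple by the shared
   relation. *)
pose rho := expmx A (- (1 - S)) *m p.
have rhoq : dotp rho ((expmx A (1 - S))^T *m q) = 0.
  by rewrite dotp_mulmxr trmxK mulmxA expmxNK mul1mx.
have rhoy : dotp rho y = 0.
  have : B^T *m (enorm (obs (- S) p1) *: y -
      enorm (B^T *m y) *: ((expmx A (1 - S))^T *m q)) = 0.
    by rewrite mulmxBr -!scalemxAr -yS obsD addrC !obsE [- S + 1]addrC addNr.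
  move/cond_a_injective/eqP; rewrite subr_eq0 => /eqP /(congr1 (dotp rho)).
  rewrite !dotpZr rhoq mulr0 => /eqP; rewrite mulf_eq0 => /orP[/eqP h|/eqP //].
  by have := enorm_gt0 (op1 S); rewrite h ltxx.
pose r := (expmx A S)^T *m rho.
have {}hr : intg (fun s => dotp (obs (- s) r) (unitv (obs (- s) p1))) S 1 = 0.
  by rewrite -hr /r dotp_mulmxl trmxK mulmxA expmxNK mul1mx.
(* Up to a positive factor the integrand of [hr]; it is 0 at [S], and its derivative has the sign of
   [- D] on [[S, 1]]. *)
pose ga s := dotp ((expmx A (S - s))^T *m rho) ((expmx A (1 - s))^T *m q).
have gaS : ga S = 0 by rewrite /ga subrr expmx0 trmx1 mul1mx.
have dga s : is_derive s (1 : R) ga (- H (1 - s, 1 - S)).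
  apply: is_derive_eq (is_derive_dotp_expmx _ _ _ _ _) _.
  by rewrite /H /= (_ : 1 - s - (1 - S) = S - s) //; ring.
have gap s : S < s <= 1 -> 0 < - (D * ga s).
  move=> /andP[Ss s1].
  have [|c] := @MVT R ga (fun s => - H (1 - s, 1 - S)) S s Ss (fun s _ => dga s).
    by apply: continuous_subspaceT; exact: continuous_derive1 dga.
  rewrite in_itv /= => /andP[Sc cs]; rewrite gaS subr0 => ->.
  have := he (1 - c) (1 - S); rewrite !ger0_norm ?subr_ge0 ?(ltW S1) //; last first.
    by rewrite ltW // (lt_le_trans cs).
  move=> /(_ ltac:(lra) ltac:(lra)) h.
  by rewrite mulNr mulrN opprK mulrA mulr_gt0 // subr_gt0.
pose f s := - D * dotp (obs (- s) r) (unitv (obs (- s) p1)).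
have fE s : f s = - (D * ga s) * (b ^+ 2 / enorm (obs (- s) p1)).
  rewrite /f /unitv dotpZr !obsD !obsE dotpBB /ga -/obs.
  rewrite [- s + S]addrC [- s + 1]addrC; ring.
have bp s : 0 < b ^+ 2 / enorm (obs (- s) p1).
  by rewrite divr_gt0 ?exprn_gt0 // enorm_gt0.
have cf : continuous f.
  move=> s; apply: (@continuous_at_mul R R (fun=> - D)
    (fun s => dotp (obs (- s) r) (unitv (obs (- s) p1)))); first exact: continuous_at_cst.
  apply: (@continuous_dotp R R _ (fun s => obs (- s) r)
    (fun s => unitv (obs (- s) p1))) => i; first exact: continuous_obs_oppc.
  have cu : {for s, continuous (fun s => unitv (obs (- s) p1))}.
    by apply: (@continuous_unitv R _ (fun s => obs (- s) p1)) => // l;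
      exact: continuous_obs_oppc.
  exact: (cvg_comp _ _ cu (@coord_continuous R m 1 i 0 _)).
have : 0 < intg f S 1.
  apply: (@intg_gt0 _ _ _ _ 1) => //.
  - move=> s /andP[]; rewrite le_eqVlt => /predU1P[<- _|Ss s1].
      by rewrite fE gaS mulr0 oppr0 mul0r.
    by rewrite fE mulr_ge0 // ltW // gap // Ss.
  - by rewrite lexx ltW.
  - by rewrite fE mulr_gt0 // gap // S1 lexx.
rewrite /f intgZ ?hr ?mulr0 ?ltxx //.
have := locbmN (locbm_obs_dotp A B r (clean_aligned A B p1)).
by congr locbm; apply/funext => s; rewrite dotpNr opprK.
Qed.

End Symmetric.

Lemma cond_a_isotropic : (0 < n)%N -> exists b a,
  [/\ 0 < b, B *m B^T = (b ^+ 2)%:M & A + A^T = (2 * a)%:M].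
Proof.
move=> n0; have [b b0 BB] := cond_a_isotropic_B n0.
have [c AA] := scalar_mx_dotp n0 (cond_a_symmetric b0 BB).
by exists b, (c / 2); split=> //; rewrite mulrC divfK.
Qed.

End CaseA.

End Rigidity.

Theorem corollary1p4 (R : realType) (n m : nat) (n_gt0 : (0 < n)%N)
    (m_gt0 : (0 < m)%N) (A : 'M[R]_n) (B : 'M[R]_(n, m))
    (specA : spectrum_nonpos A) (rankAB : kalman A B)
    (abc : [\/ cond_a A B, cond_b A B | cond_c A B]) :
  [/\
      [/\ elipschitz (V0 A B),
          smooth_on [set x | x != 0] (V0 A B)
        & forall x : 'cV[R]_n, x != 0 ->
            exists2 mu : R, is_min mu uball (hamiltonian A B x) & 1 + mu = 0],
      optimal_feedback A B (Kopt B)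
    &
      forall x : 'cV[R]_n, x != 0 ->
        unique_minimizer uball (hamiltonian A B x) (Kopt B x) /\
        feedback_along A B (Kopt B) x].
Proof.
have [b [a [b0 a0 BB AA]]] : exists b a : R,
    [/\ 0 < b, a <= 0, B *m B^T = (b ^+ 2)%:M & A + A^T = (2 * a)%:M].
  have iso : (exists b a : R, [/\ 0 < b, B *m B^T = (b ^+ 2)%:M & A + A^T = (2 * a)%:M]) ->
      exists b a : R, [/\ 0 < b, a <= 0, B *m B^T = (b ^+ 2)%:M & A + A^T = (2 * a)%:M].
    move=> [b [a [b0 BB AA]]]; exists b, a; split=> //.
    exact: spectrum_symmetric_part n_gt0 specA AA.
  case: abc => [ca|[b2 [a [b0 a0 BB AA]]]|cc].
  - exact: iso (cond_a_isotropic rankAB ca n_gt0).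
  - exists (Num.sqrt b2), a; split=> //; first by rewrite sqrtr_gt0.
    by rewrite sqr_sqrtr // ltW.
  (* With [B = 0] the Kalman matrix would have rank 0, against [0 < n]. *)
  - have B0 : B != 0.
      apply: contraTneq n_gt0 => B0; rewrite -leqNgt -[n in (n <= _)%N]rankAB B0.
      suff -> : \mxrow_(j < n) (A ^+ j *m (0 : 'M[R]_(n, m))) = 0 by rewrite mxrank0.
      by apply/matrixP => i j; rewrite mxE mulmx0 !mxE.
    exact: iso (cond_c_isotropic cc n_gt0 B0).
split.
- split; [exact: elipschitz_V0 b0 a0 BB AA|exact: smooth_V0 b0 a0 BB AA|].
  move=> x x0; exists (-1); last by rewrite subrr.
  exact: hamiltonian_is_min b0 a0 BB AA x x0.
- exact: feedback_along_isotropic b0 a0 BB AA n_gt0.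
- move=> x x0; split; last exact: feedback_along_isotropic b0 a0 BB AA n_gt0 x x0.
  rewrite (Kopt_isotropic b0 BB n_gt0).
  exact: unique_minimizer_isotropic b0 a0 BB AA x x0.
Qed.
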